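(* Let $k$ be a positive integer, let $G$ be a $50k$-connected graph and let $S \subseteq V(G)$. At least one of the following holds: (i) $G$ contains $k$ pairwise vertex-disjoint odd $S$-cycles; (ii) there is a set $X \subseteq V(G)$ with $|X| \le 2k-2$ such that $G - X$ contains no odd $S$-cycle.
   Context: All graphs are finite and simple. An $S$-cycle is a cycle containing at least one vertex of $S$; an odd $S$-cycle is one of odd length. *)

(* Defs.v *)
From mathcomp Require Import all_boot.
Set Implicit Arguments. Unset Strict Implicit. Unset Printing Implicit Defensive.

Definition simple_graph (T : finType) (e : rel T) : Prop :=
  symmetric e /\ irreflexive e.

Definition del_rel (T : finType) (e : rel T) (X : {set T}) : rel T :=
  fun x y => [&& e x y, x \notin X & y \notin X].

Definition k_connected (T : finType) (e : rel T) (k : nat) : Prop :=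
  k < #|T| /\
  forall X : {set T}, #|X| < k ->
    forall x y, x \notin X -> y \notin X -> connect (del_rel e X) x y.

Definition is_cycle (T : finType) (e : rel T) (c : seq T) : Prop :=
  [/\ 3 <= size c, uniq c & cycle e c].

Definition odd_S_cycle (T : finType) (e : rel T) (S : {set T}) (c : seq T) : Prop :=
  [/\ is_cycle e c, odd (size c) & has (mem S) c].

(* Main.v *)
Require Import Defs.
From Stdlib Require Import Classical ClassicalEpsilon.
From mathcomp Require Import all_boot zify.
Set Implicit Arguments. Unset Strict Implicit. Unset Printing Implicit Defensive.

(* If |S| < 2k - 1, delete S. Otherwise fix S1 in S with |S1| = k and a maximum cut of G - S1.
   Its bichromatic edges contain a dense subgraph K (the hub), minimal for an edge density
   condition that excludes separations of order at most 4k; a theorem in the style of Thomas and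
   Wollan then links any 2k disjoint pairs of vertices of K by disjoint bichromatic paths.

   Call a path with both ends in K and interior outside K an ear, and wrong if its length has
   the wrong parity for the colours of its ends. Applying Gallai's reduction to matchings and the
   Tutte-Berge formula in a double cover of G - S1, there are either 3k disjoint wrong ears or
   fewer than 6k vertices whose removal makes G - S1 bipartite.

   In the first case Menger's theorem gives k disjoint ears through the vertices of S1. Leaving
   the wrong ears as rarely as possible, they meet at most 2k of these, and links in K combine
   each of them, alone or with one of the k remaining wrong ears, into an odd S-cycle.

   In the second case few vertices X0 meet all odd cycles. Let Z be the vertices of X0 with many
   neighbours in both colour classes, recolour the rest of X0 by majority, and let M be a maximum
   matching of monochromatic edges outside Z. If |Z| + |M| < k, then Z and the ends of M meet all
   odd cycles. Otherwise k elements of Z and M yield disjoint wrong ears of the hub formed by the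
   other vertices; since |S| >= 2k - 1, those that avoid S can be paired with distinct ears of
   length two through further vertices of S. *)

(** The hub is taken bipartite so that the parity of a link is forced by the colours of its ends. No
    control over the lengths of links is then required; all parity is decided by the ears. A cycle
    uses at most two links, so [2 k] pairs, that is [4 k] ends, must be linked at once. The linkage
    theorem for [m] pairs asks for more than [12 m] ordered adjacent pairs per vertex, hence [24 k]
    here. Deleting the [k] vertices of S1 leaves degrees of at least [49 k], a maximum cut keeps
    half of each, and [49 k / 2] exceeds [24 k]; this is the origin of [50 k]. The number [3 k] of
    wrong ears is [2 k + k]: an ear through a vertex of S1 is built from two paths, each of which
    may spoil one wrong ear. In the other case X0 consists of S1 and fewer than [6 k] further
    vertices, which explains the bound [7 k]. The value [2 k - 2] arises twice: fewer than [k]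
    elements of Z and M cover at most [2 (k - 1)] vertices, and [2 k - 1] vertices of S are just
    enough to provide a private vertex of S for every element of Z and M that avoids S. *)

Lemma nat_min (P : nat -> Prop) :
  (exists n, P n) -> exists n, P n /\ forall m, P m -> n <= m.
Proof.
move=> [n Pn]; elim/ltn_ind: n Pn => n IH Pn.
case: (classic (exists2 m, P m & m < n)) => [[m Pm lt_mn]|no]; first exact: IH lt_mn Pm.
exists n; split=> // m Pm; rewrite leqNgt; apply/negP=> lt_mn; apply: no; by exists m.
Qed.

Lemma ex_argmin (A : Type) (P : A -> Prop) (f : A -> nat) :
  (exists a, P a) -> exists a, P a /\ forall b, P b -> f a <= f b.
Proof.
move=> [a Pa].
case: (@nat_min (fun n => exists2 b, P b & f b = n)); first by exists (f a), a.
move=> n [[b Pb fb] minn]; exists b; split=> // c Pc; rewrite fb; apply: minn; by exists c.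
Qed.

Lemma ex_argmax (A : Type) (P : A -> Prop) (f : A -> nat) (M : nat) :
  (exists a, P a) -> (forall a, P a -> f a <= M) ->
  exists a, P a /\ forall b, P b -> f b <= f a.
Proof.
move=> exP leM; case: (ex_argmin (fun a => M - f a) exP) => a [Pa mina].
exists a; split=> // b Pb; have := mina b Pb; have := leM a Pa; have := leM b Pb; lia.
Qed.

(** * Connected sets, links and routes *)

Section Connections.
Variable T : finType.
Implicit Types (e : rel T) (A B D V W X Y Z : {set T}) (x y z : T).

Definition restr e W x y := [&& e x y, x \in W & y \in W].
Arguments restr e W x y /.
Definition conn e W : rel T := connect (restr e W).

Lemma restr_sym e W : symmetric e -> symmetric (restr e W).
Proof. by move=> se x y; rewrite /restr /= [e y x]se [(y \in W) && _]andbC. Qed.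

Lemma symmetric_connect (r : rel T) : symmetric r -> symmetric (connect r).
Proof.
have sub (q : rel T) x y : symmetric q -> connect q x y -> connect q y x.
  move=> sq /connectP[p pth ->]; apply/connectP; exists (rev (belast x p)).
    by rewrite rev_path; apply: sub_path pth => u v; rewrite sq.
  by case: p {pth} => //= a p; rewrite rev_cons last_rcons.
by move=> sr x y; apply/idP/idP; apply: sub.
Qed.

Lemma conn_sym e W : symmetric e -> symmetric (conn e W).
Proof. by move=> se; apply: symmetric_connect; apply: restr_sym. Qed.

Lemma conn_refl e W x : conn e W x x. Proof. exact: connect0. Qed.

Lemma conn_trans e W y x z : conn e W x y -> conn e W y z -> conn e W x z.
Proof. exact: connect_trans. Qed.

Lemma conn1 e W x y : e x y -> x \in W -> y \in W -> conn e W x y.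
Proof. by move=> exy xW yW; apply: connect1; rewrite /= exy xW yW. Qed.

Lemma conn_sub e e' W W' x y :
  (forall u v, e u v -> u \in W -> v \in W -> conn e' W' u v) ->
  conn e W x y -> conn e' W' x y.
Proof. by move=> H; apply: connect_sub => u v /and3P[]; apply: H. Qed.

Lemma conn_mono e e' W W' x y :
  subrel e e' -> W \subset W' -> conn e W x y -> conn e' W' x y.
Proof.
move=> se /subsetP sW; apply: conn_sub => u v euv uW vW.
by apply: conn1; auto.
Qed.

Lemma conn_in e W x y : conn e W x y -> (x \in W) = (y \in W).
Proof.
move=> /connectP[p pth ->]; elim: p x pth => //= z p IH x /andP[/and3P[_ xW zW] /IH <-].
by rewrite xW zW.
Qed.

(** The walk is first made simple, so its tail never returns to [x]. This allows a terminal to be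
    dropped from a connected set while the rest still reaches the other end. *)
Lemma conn_first e W x y : conn e W x y -> x = y \/
  exists2 z, e x z & z \in W :\ x /\ conn e (W :\ x) z y.
Proof.
move=> /connectP[p pth ->]; case: (shortenP pth) => {pth}[[|z q]] /= pth; first by left.
move=> /andP[xq _] _; right; case/andP: pth => /and3P[exz _ zW] pth.
exists z => //; move: xq; rewrite inE negb_or => /andP[xz xq].
split; first by rewrite !inE eq_sym xz.
apply/connectP; exists q => //; elim: q z {exz} xz zW xq pth => //= w q IH z xz zW.
rewrite inE negb_or => /andP[xw xq] /andP[/and3P[ezw _ wW] pth].
by rewrite ezw !inE eq_sym xz eq_sym xw zW wW /= IH.
Qed.

Lemma path_conn e W x p : path e x p -> {subset x :: p <= W} -> conn e W x (last x p).
Proof.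
move=> pth sub; apply/connectP; exists p => //.
elim: p x pth sub => //= y p IH x /andP[exy pth] sub.
rewrite exy !sub ?inE ?eqxx ?orbT //=; apply: IH => // z zp; apply: sub.
by rewrite inE zp orbT.
Qed.

Lemma conn_path e W x y : x \in W -> conn e W x y -> exists p,
  [/\ path e x p, last x p = y, uniq (x :: p) & {subset x :: p <= W}].
Proof.
move=> xW /connectP[p pth ->]; case: (shortenP pth) => q pthq uq _.
exists q; split=> //; first by apply: sub_path pthq => u v /and3P[].
elim: q x xW pthq {uq pth} => /= [|z q IH] x xW; first by move=> _ z; rewrite inE => /eqP->.
by move=> /andP[/and3P[_ _ zW] pth] w; rewrite inE => /orP[/eqP->//|]; apply: IH.
Qed.

(* A link is given by a connected set containing its inner vertices, which is nonempty:
   edges inside Z play no role. *)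
Definition joins e W s t :=
  exists x y, [/\ x \in W, y \in W, e s x, e t y & conn e W x y].

(** Pairs are indexed by an arbitrary finite type, so that a subfamily, such as the links in need of
    repair, can be treated as a family over a subtype. *)
Definition lk e D Z := forall (I : finType) (s t : I -> T),
  (forall i, s i \in Z) -> (forall i, t i \in Z) -> injective s -> injective t ->
  (forall i j, s i != t j) ->
  exists W : I -> {set T}, [/\ forall i, W i \subset D,
    forall i j, i != j -> [disjoint W i & W j] & forall i, joins e (W i) (s i) (t i)].

Lemma joins_mono e e' W W' s t :
  subrel e e' -> W \subset W' -> joins e W s t -> joins e' W' s t.
Proof.
move=> se sW [x [y [xW yW sx ty c]]]; exists x, y.
by split; [exact: (subsetP sW)|exact: (subsetP sW)|exact: se|exact: se|exact: conn_mono c].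
Qed.

Lemma joins_sym e W s t : symmetric e -> joins e W s t -> joins e W t s.
Proof.
by move=> se [x [y [xW yW sx ty c]]]; exists y, x; split=> //; rewrite conn_sym.
Qed.

Lemma lk_mono e e' D D' Z Z' :
  subrel e e' -> D \subset D' -> Z' \subset Z -> lk e D Z -> lk e' D' Z'.
Proof.
move=> se sD /subsetP sZ H I s t sZ' tZ' is_ it_ st.
have [W [WD dW jW]] := H I s t (fun i => sZ _ (sZ' i)) (fun i => sZ _ (tZ' i)) is_ it_ st.
exists W; split=> // i; first exact: subset_trans (WD i) sD.
exact: joins_mono (jW i).
Qed.

(** Disjoint Menger paths in set form: later arguments only glue connected sets, so the order of
    vertices along a path is forgotten. *)
Definition routes e V X Y (W : T -> {set T}) (phi : T -> T) :=
  [/\ forall x, x \in X -> [/\ x \in W x, W x \subset V, W x :&: Y = [set phi x]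
        & conn e (W x) x (phi x)]
    & {in X &, forall x x', x != x' -> [disjoint W x & W x']}].

Lemma routes_inj e V X Y (W : T -> {set T}) phi : routes e V X Y W phi -> {in X &, injective phi}.
Proof.
move=> [H dis] x x' xX x'X eqp; apply/eqP; apply: contraT => ne.
have [_ _ w _] := H x xX; have [_ _ w' _] := H x' x'X.
have := dis x x' xX x'X ne; rewrite disjoint_subset => /subsetP/(_ (phi x)).
have /setIP[p1 _] : phi x \in W x :&: Y by rewrite w inE.
have /setIP[p2 _] : phi x' \in W x' :&: Y by rewrite w' inE.
by move=> /(_ p1); rewrite inE eqp p2.
Qed.

(** The link between [phi (s i)] and [phi (t i)] is prolonged by the two routes, from which the
    terminals themselves are removed, since terminals are not inner vertices of links. *)
Lemma routes_lk e V X Y (W : T -> {set T}) phi D :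
  symmetric e -> routes e V X Y W phi -> {in X, forall x, [disjoint W x & D]} ->
  lk e D (phi @: X) -> lk e (D :|: (V :\: X)) X.
Proof.
move=> se R dWD L I s t sX tX is_ it_ st.
have injphi := routes_inj R; case: R => HR dis.
case: (L I (phi \o s) (phi \o t)) => /=.
- by move=> i; apply: imset_f.
- by move=> i; apply: imset_f.
- by move=> i j /injphi h; apply: is_; apply: h.
- by move=> i j /injphi h; apply: it_; apply: h.
- move=> i j; apply/eqP => /injphi h.
  by move/eqP: (st i j); apply; apply: h.
move=> C [CD dC jC].
have disj x x' : x \in X -> x' \in X -> x != x' -> forall z, z \in W x -> z \in W x' -> False.
  move=> xX x'X ne z zx zx'; have := dis x x' xX x'X ne.
  by rewrite disjoint_subset => /subsetP/(_ z zx); rewrite inE zx'.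
have disD x : x \in X -> forall z, z \in W x -> z \in D -> False.
  move=> xX z zx zD; have := dWD x xX.
  by rewrite disjoint_subset => /subsetP/(_ z zx); rewrite inE zD.
have WX x : x \in X -> W x :\ x \subset V :\: X.
  move=> xX; apply/subsetP => z /setD1P[zx zW]; have [_ WV _ _] := HR x xX.
  rewrite inE (subsetP WV) // andbT; apply/negP => zX; apply: (disj x z) zW _ => //.
    by rewrite eq_sym.
  by have [] := HR z zX.
exists (fun i => C i :|: ((W (s i) :\ s i) :|: (W (t i) :\ t i))); split.
- move=> i; rewrite subUset; apply/andP; split.
    exact: subset_trans (CD i) (subsetUl _ _).
  by rewrite subUset !(subset_trans (WX _ _) (subsetUr _ _)).
- move=> i j ij; rewrite -setI_eq0; apply/eqP/setP=> z; rewrite !inE.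
  apply/negP=> /andP[].
  move=> /or3P[zi|/andP[_ zi]|/andP[_ zi]] /or3P[zj|/andP[_ zj]|/andP[_ zj]].
  + have := dC i j ij; rewrite disjoint_subset => /subsetP/(_ z zi); by rewrite inE zj.
  + exact: (disD (s j)) zj (subsetP (CD i) _ zi).
  + exact: (disD (t j)) zj (subsetP (CD i) _ zi).
  + exact: (disD (s i)) zi (subsetP (CD j) _ zj).
  + apply: (disj (s i) (s j)) zi zj => //.
    by apply: contraNneq ij => /is_->.
  + exact: (disj (s i) (t j)) zi zj.
  + exact: (disD (t i)) zi (subsetP (CD j) _ zj).
  + by apply: (disj (t i) (s j)) zi zj; rewrite // eq_sym.
  + apply: (disj (t i) (t j)) zi zj => //.
    by apply: contraNneq ij => /it_->.
move=> i; set WW := _ :|: _.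
(* Either the route of [x] is trivial and the link already starts next to [x], or its first step
   leads into what is left of the route once [x] is removed. *)
have key x : x \in X -> W x :\ x \subset WW -> C i \subset WW ->
  forall u, u \in C i -> e (phi x) u ->
  exists2 a, a \in WW /\ e x a & conn e WW a u.
  move=> xX sx sC u uC epu; have [xW _ wY cx] := HR x xX.
  case: (conn_first cx) => [eqx|[z exz [zW cz]]].
    exists u; last exact: conn_refl.
    by split; [exact: (subsetP sC)|rewrite {1}eqx].
  exists z; first by split=> //; exact: (subsetP sx).
  apply: (@conn_trans _ _ (phi x)); first by apply: conn_mono cz.
  apply: conn1 => //; last exact: (subsetP sC).
  by apply: (subsetP sx); rewrite -(conn_in cz).
case: (jC i) => x [y [xC yC /= sx ty cxy]].
have sC : C i \subset WW by apply: subsetUl.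
case: (key (s i) (sX i) _ sC x xC sx) => [|a [aW sa] ca].
  by rewrite /WW setUA setUAC subsetUr.
case: (key (t i) (tX i) _ sC y yC ty) => [|b [bW tb] cb].
  by rewrite /WW setUA subsetUr.
exists a, b; split=> //; apply: conn_trans ca _.
apply: (@conn_trans _ _ y); first by apply: conn_mono cxy.
by rewrite conn_sym.
Qed.

End Connections.

(** * Menger's theorem *)

Section Menger.
Variable T : finType.
Implicit Types (e : rel T) (A B S V X Y : {set T}) (x y z : T) (p q : seq T).

Lemma path_sub_source e e' x p :
  path e x p -> {in belast x p, forall u v, e u v -> e' u v} -> path e' x p.
Proof.
elim: p x => //= y p IH x /andP[exy pth] H.
rewrite H ?inE ?eqxx //=; apply: IH => // u up; apply: H; by rewrite inE up orbT.
Qed.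

Lemma path_sub_target e e' x p :
  path e x p -> {in p, forall v u, e u v -> e' u v} -> path e' x p.
Proof.
elim: p x => //= y p IH x /andP[exy pth] H.
rewrite H ?inE ?eqxx //=; apply: IH => // u up; apply: H; by rewrite inE up orbT.
Qed.

Lemma first_hit (a : pred T) x p : has a (x :: p) -> exists p1 p2,
  [/\ p = p1 ++ p2, a (last x p1) & {in belast x p1, forall u, ~~ a u}].
Proof.
elim: p x => [|y p IH] x /=; first by rewrite orbF => ax; exists [::], [::].
case: (boolP (a x)) => [ax _|nax /= /IH[p1 [p2 [-> al bl]]]].
  by exists [::], (y :: p).
exists (y :: p1), p2; split=> // u; rewrite inE => /orP[/eqP->//|]; exact: bl.
Qed.

Lemma last_hit (a : pred T) x p : has a (x :: p) -> exists p1 p2,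
  [/\ p = p1 ++ p2, a (last x p1) & {in p2, forall u, ~~ a u}].
Proof.
elim/last_ind: p => [|p y IH]; first by rewrite /= orbF => ax; exists [::], [::].
case: (boolP (a y)) => [ay _|nay].
  by exists (rcons p y), [::]; rewrite cats0 last_rcons.
rewrite -rcons_cons has_rcons (negbTE nay) /= => /IH[p1 [p2 [-> al bl]]].
exists p1, (rcons p2 y); rewrite rcons_cat; split=> // u.
by rewrite mem_rcons inE => /orP[/eqP->//|]; exact: bl.
Qed.

Lemma split_last x p z : z \in x :: p -> exists p1 p2, p = p1 ++ p2 /\ last x p1 = z.
Proof. by case/splitPl=> p1 p2 <-; exists p1, p2. Qed.

Definition separates e X Y S := forall x p,
  path e x p -> x \in X -> last x p \in Y -> has (mem S) (x :: p).

Definition linking e X Y k (h : 'I_k -> T) (p : 'I_k -> seq T) :=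
  (forall i, [/\ path e (h i) (p i), uniq (h i :: p i), h i \in X & last (h i) (p i) \in Y])
  /\ forall i j z, z \in h i :: p i -> z \in h j :: p j -> i = j.

Lemma linking_uniq e X Y k (h : 'I_k -> T) (p : 'I_k -> seq T) :
  (forall i, [/\ path e (h i) (p i), h i \in X & last (h i) (p i) \in Y]) ->
  (forall i j z, z \in h i :: p i -> z \in h j :: p j -> i = j) ->
  linking e X Y h (fun i => shorten (h i) (p i)).
Proof.
move=> H dis.
have sub i : {subset h i :: shorten (h i) (p i) <= h i :: p i}.
  move=> z; rewrite !inE => /orP[->//|]; have [pth _ _] := H i.
  by case: (shortenP pth) => // p' _ _ sp /sp ->; rewrite orbT.
split=> [i|i j z /sub zi /sub zj]; last exact: dis zi zj.
by have [pth hX] := H i; case: (shortenP pth).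
Qed.

(** Göring's induction on the number of edges. If [(x, y)] cannot be deleted, some [S] with [k - 1]
    elements separates without it, and both [x |: S] and [y |: S] separate in [e]. Paths into the
    first set and out of the second are concatenated, the edge [(x, y)] serving the path that ends
    at [x]. *)
Theorem menger_paths k e X Y :
  (forall S, separates e X Y S -> k <= #|S|) ->
  exists (h : 'I_k -> T) (p : 'I_k -> seq T), linking e X Y h p.
Proof.
move: {2}#|_| (leqnn #|[set q : T * T | e q.1 q.2]|) => n.
elim: n e X Y => [|n IH] e X Y.
  rewrite leqn0 cards_eq0 => /eqP e0 H.
  have noe x y : e x y = false.
    by have /setP/(_ (x, y)) := e0; rewrite !inE.
  have le : k <= #|X :&: Y|.
    apply: H => x [|y p] /=; last by rewrite noe.
    by move=> _ xX xY; rewrite inE xX xY.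
  pose h (i : 'I_k) : T := enum_val (widen_ord le i).
  exists h, (fun=> [::]); split=> [i|i j z] /=.
    by have := enum_valP (widen_ord le i); rewrite -/(h i) inE => /andP[-> ->].
  rewrite !inE => /eqP-> /eqP/enum_val_inj/(congr1 val) /= eqij.
  exact: val_inj.
move=> len H.
case: (pickP (fun q : T * T => e q.1 q.2)) => [[x y] /= exy|noe]; last first.
  apply: IH H; rewrite (_ : [set q | _] = set0) ?cards0 //.
  by apply/setP=> q; rewrite !inE noe.
pose e' u v := e u v && ((u, v) != (x, y)).
have e'e : subrel e' e by move=> u v /andP[].
have len' : #|[set q : T * T | e' q.1 q.2]| <= n.
  rewrite -ltnS; apply: leq_trans len; apply: proper_card; apply/properP; split.
    by apply/subsetP=> q; rewrite !inE => /e'e.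
  by exists (x, y); rewrite !inE //= /e' eqxx andbF.
case: (classic (forall S, separates e' X Y S -> k <= #|S|)) => [/(IH _ _ _ len')|].
  move=> [h [p [Hp dis]]]; exists h, p; split=> // i; have [pth u hX lY] := Hp i.
  by split=> //; apply: sub_path pth.
move=> nH; have [S sepS ltS] : exists2 S, separates e' X Y S & #|S| < k.
  apply: NNPP => no; apply: nH => S sepS; rewrite leqNgt; apply/negP => lt; apply: no.
  by exists S.
have e'x u v : u != x -> e u v -> e' u v.
  by move=> ux euv; rewrite /e' euv xpair_eqE (negbTE ux).
have e'y u v : v != y -> e u v -> e' u v.
  by move=> vy euv; rewrite /e' euv xpair_eqE (negbTE vy) andbF.
have sepx : separates e X Y (x |: S).
  move=> a p pth aX lY; case: (boolP (x \in a :: p)) => [xp|xp].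
    by apply/hasP; exists x => //; rewrite /= !inE eqxx.
  have pth' : path e' a p.
    apply: path_sub_source pth _ => u up v; apply: e'x; apply: contraNneq xp => <-.
    exact: mem_belast.
  case/hasP: (sepS a p pth' aX lY) => z zp zS; apply/hasP; exists z => //.
  by move: zS; rewrite /= !inE => ->; rewrite orbT.
have sepy : separates e X Y (y |: S).
  move=> a p pth aX lY; case: (boolP (y \in p)) => [yp|yp].
    by apply/hasP; exists y; rewrite /= !inE ?eqxx ?yp ?orbT.
  have pth' : path e' a p.
    apply: path_sub_target pth _ => v vp u; apply: e'y; apply: contraNneq yp => <-.
    by [].
  case/hasP: (sepS a p pth' aX lY) => z zp zS; apply/hasP; exists z => //.
  by move: zS; rewrite /= !inE => ->; rewrite orbT.
have cx := H _ sepx; have cy := H _ sepy.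
have [xS cardx] : x \notin S /\ #|x |: S| = k.
  by move: cx; rewrite cardsU1; case: (x \in S) => //=; split=> //; lia.
have [yS cardy] : y \notin S /\ #|y |: S| = k.
  by move: cy; rewrite cardsU1; case: (y \in S) => //=; split=> //; lia.
(* A walk from [X] is cut at its first vertex in [x |: S]; up to there it never leaves [x], so it
   avoids the deleted edge. A separator of the smaller instance thus separates [X] from [Y] in
   [e]. *)
have [h1 [p1 [L1 D1]]] : exists (h : 'I_k -> T) (p : 'I_k -> seq T), linking e' X (x |: S) h p.
  apply: IH => // S1 sep1; apply: H => a p pth aX lY.
  case: (first_hit (sepx a p pth aX lY)) => q1 [q2 [eqp lq bq]].
  move: pth; rewrite eqp cat_path => /andP[pth _].
  have : has (mem S1) (a :: q1).
    apply: sep1 => //; apply: path_sub_source pth _ => u uq v; apply: e'x.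
    by apply: contraNneq (bq u uq) => ->; rewrite /= !inE eqxx.
  by move=> hS; rewrite -cat_cons has_cat hS.
have [h2 [p2 [L2 D2]]] : exists (h : 'I_k -> T) (p : 'I_k -> seq T), linking e' (y |: S) Y h p.
  apply: IH => // S1 sep1; apply: H => a p pth aX lY.
  case: (last_hit (sepy a p pth aX lY)) => q1 [q2 [eqp lq bq]].
  move: pth; rewrite eqp cat_path => /andP[_ pth].
  have : has (mem S1) (last a q1 :: q2).
    apply: sep1 => //; last by rewrite -last_cat -eqp.
    apply: path_sub_target pth _ => v vq u; apply: e'y.
    by apply: contraNneq (bq v vq) => ->; rewrite /= !inE eqxx.
  case/hasP=> z zq zS; apply/hasP; exists z => //.
  move: zq; rewrite inE => /orP[/eqP->|zq]; last by rewrite inE mem_cat zq !orbT.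
  by rewrite -cat_cons mem_cat mem_last.
pose l1 i := last (h1 i) (p1 i).
have l1p i : l1 i \in h1 i :: p1 i by exact: mem_last.
have onto (f : 'I_k -> T) (A : {set T}) : (forall i, f i \in A) -> injective f -> #|A| = k ->
    forall z, z \in A -> exists i, f i = z.
  move=> fA injf cA z zA.
  have /setP/(_ z) : [set f i | i in 'I_k] = A.
    apply/eqP; rewrite eqEcard; apply/andP; split.
      by apply/subsetP=> _ /imsetP[i _ ->].
    by rewrite card_imset // cA card_ord.
  by rewrite zA => /imsetP[i _ ->]; exists i.
have l1S i : l1 i \in x |: S by have [] := L1 i.
have l1inj : injective l1 by move=> i j eq; apply: (D1 i j (l1 i)) => //; rewrite eq.
have l1onto := onto l1 _ l1S l1inj cardx.
have h2S i : h2 i \in y |: S by have [] := L2 i.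
have h2inj : injective h2.
  by move=> i j eq; apply: (D2 i j (h2 i)); rewrite ?eq mem_head.
have h2onto := onto h2 _ h2S h2inj cardy.
have A1 i z : z \in h1 i :: p1 i -> z \in x |: S -> z = l1 i.
  by move=> zi /l1onto[j eqz]; rewrite -eqz in zi *; rewrite (D1 i j _ zi (l1p j)).
have A2 i z : z \in h2 i :: p2 i -> z \in y |: S -> z = h2 i.
  by move=> zi /h2onto[j eqz]; rewrite -eqz in zi *; rewrite (D2 i j _ zi (mem_head _ _)).
(* At a common vertex the two paths splice into a walk of [e'] from [X] to [Y]. It meets [S], and
   the paths meet [S] only at the end of the first and at the start of the second. *)
have cross i j z : z \in h1 i :: p1 i -> z \in h2 j :: p2 j ->
    [/\ z = l1 i, z = h2 j & z \in S].
  move=> zi zj; have [q1 [q2 [eq1 lq]]] := split_last zi.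
  have [r1 [r2 [eq2 lr]]] := split_last zj.
  have [pth1 u1 hX _] := L1 i; have [pth2 u2 _ lY] := L2 j.
  move: pth1 pth2; rewrite eq1 eq2 !cat_path => /andP[pq _] /andP[_ pr].
  have : has (mem S) (h1 i :: q1 ++ r2).
    apply: sepS => //; first by rewrite cat_path pq lq -lr.
    by rewrite last_cat lq -lr -last_cat -eq2.
  rewrite -cat_cons has_cat => /orP[/hasP[w wq wS]|/hasP[w wr wS]].
    have eqw : w = l1 i.
      apply: A1; last by move: wS; rewrite /= !inE => ->; rewrite orbT.
      by rewrite eq1 -cat_cons mem_cat wq.
    have q20 : q2 = [::].
      move: eqw u1 wq; rewrite /l1 eq1 last_cat -cat_cons cat_uniq => -> /and3P[_ /hasPn no _].
      case: q2 {eq1} no => // b q2 no; move: (no (last b q2)) => /= /(_ (mem_last _ _)) /negP.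
      by move=> nq wq; case: nq.
    have zl : z = l1 i by rewrite /l1 eq1 q20 cats0.
    have zS : z \in S by rewrite zl -eqw.
    by split=> //; apply: A2 => //; rewrite !inE zS orbT.
  have eqw : w = h2 j.
    apply: A2; last by move: wS; rewrite /= !inE => ->; rewrite orbT.
    by rewrite eq2 inE mem_cat wr !orbT.
  by move: u2; rewrite /= eq2 mem_cat -eqw wr orbT.
(* Paths are matched by their common vertex of [S]; the one that ends at [x] continues with the one
   that starts at [y]. *)
have [J HJ] : exists J : 'I_k -> 'I_k, forall i, h2 (J i) = if l1 i == x then y else l1 i.
  apply: (fin_all_exists (P := fun i j => h2 j = if l1 i == x then y else l1 i)) => i.
  apply: h2onto; case: eqP => [_|/eqP nx]; first by rewrite !inE eqxx.
  by have := l1S i; rewrite !inE (negbTE nx) /= => ->; rewrite orbT.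
have l1ny i : l1 i != x -> l1 i != y.
  move=> nx; have := l1S i; rewrite !inE (negbTE nx) /= => lS.
  by apply: contraNneq yS => <-.
have Jinj : injective J.
  move=> i j eqJ; apply: l1inj; have := HJ i; rewrite eqJ HJ.
  case: eqP => [->|/eqP nj]; case: eqP => [->//|/eqP ni] //.
    by move=> eqy; have := l1ny i ni; rewrite eqy eqxx.
  by move=> eqy; have := l1ny j nj; rewrite -eqy eqxx.
pose p i := p1 i ++ (if l1 i == x then h2 (J i) :: p2 (J i) else p2 (J i)).
have pin i z : z \in h1 i :: p i -> z \in h1 i :: p1 i \/ z \in h2 (J i) :: p2 (J i).
  rewrite /p -cat_cons mem_cat => /orP[|]; first by left.
  by case: ifP => _ zp; right=> //; rewrite inE zp orbT.
exists h1, (fun i => shorten (h1 i) (p i)); apply: linking_uniq.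
  move=> i; have [pth1 _ hX _] := L1 i; have [pth2 _ _ lY] := L2 (J i).
  rewrite /p cat_path (sub_path e'e pth1) -/(l1 i) last_cat -/(l1 i); split=> //.
    have := HJ i; case: eqP => [-> eqh|_ <-]; last exact: (sub_path e'e pth2).
    by rewrite /= eqh exy; have := sub_path e'e pth2; rewrite eqh.
  by have := HJ i; case: eqP => [-> eqh|_ <-].
move=> i j z /pin[zi|zi] /pin[zj|zj].
- exact: D1 zi zj.
- have [zl zh zS] := cross _ _ _ zi zj; apply: l1inj; rewrite -zl.
  by have := HJ j; rewrite -zh; case: eqP => // _ zy; move: yS; rewrite -zy zS.
- have [zl zh zS] := cross _ _ _ zj zi; apply: l1inj; rewrite -zl.
  by have := HJ i; rewrite -zh; case: eqP => // _ zy; move: yS; rewrite -zy zS.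
- by apply: Jinj; apply: D2 zi zj.
Qed.

(** A separation of the graph induced on [V], of order [#|A :&: B|]. The condition is
    one-directional because Menger's theorem is proved for directed relations. *)
Definition sepn e V A B :=
  A :|: B = V /\ forall x y, x \in A :\: B -> y \in B :\: A -> ~~ e x y.

Theorem menger e V X Y :
  X \subset V -> Y \subset V ->
  (forall A B, sepn e V A B -> X \subset A -> Y \subset B -> #|X| <= #|A :&: B|) ->
  exists W phi, routes e V X Y W phi.
Proof.
move=> XV YV H.
have [|h [p [L dis]]] := @menger_paths #|X| (restr e V) X Y.
  move=> S sepS.
  (* Separators become separations: [R] is what [X] reaches while avoiding [S], and the separation
     built from it has its intersection inside [S]. *)
  pose D := V :\: S; pose R := [set y in D | [exists x in X :\: S, conn e D x y]].
  pose A := R :|: (V :&: S); pose B := V :\: R.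
  have RV : R \subset V by apply/subsetP=> z; rewrite !inE => /andP[/andP[]].
  have RS z : z \in R -> z \notin S by rewrite !inE => /andP[/andP[]].
  apply: leq_trans (_ : #|A :&: B| <= _).
    apply: H; first split.
    + apply/setP=> z; rewrite !inE; case: (boolP (z \in V)) => [zV|zV] //=; last by rewrite andbF.
      by case: (z \in S) => //=; case: [exists _ in _, _].
    + move=> x y; rewrite !in_setD !in_setU !in_setI negb_and !negb_or !negbK negb_and.
      move=> /andP[H1 H2] /andP[/andP[yR H3] /andP[_ yV]]; rewrite yV /= in H3.
      have xR : x \in R.
        case/orP: H2 => // /andP[xV xS]; case/orP: H1 => //; by rewrite xV.
      apply/negP=> exy; move: yR; rewrite in_set in_setD yV H3 /= => /negP[].
      have := xR; rewrite in_set in_setD => /andP[/andP[xS xV] /existsP[z /andP[zX cz]]].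
      apply/existsP; exists z; rewrite zX /=; apply: conn_trans cz _.
      by apply: conn1; rewrite ?inE ?xS ?xV ?H3.
    + apply/subsetP=> x xX; rewrite !inE (subsetP XV) //=.
      case: (boolP (x \in S)) => //= xS; rewrite orbF; apply/existsP; exists x.
      by rewrite !inE xX xS conn_refl.
    + apply/subsetP=> y yY; rewrite inE (subsetP YV) // andbT; apply/negP.
      rewrite in_set in_setD => /andP[/andP[yS _] /existsP[x /andP[xX]]].
      case/setDP: xX => xX xS cxy.
      have [|q [pth lq _ sub]] := conn_path _ cxy; first by rewrite in_setD xS (subsetP XV).
      have /hasP[z zq zS] : has (mem S) (x :: q).
        apply: sepS => //; last by rewrite lq.
        elim: q x {xX xS cxy lq} pth sub => //= b q IH x /andP[exb pth] sub.
        have xD : x \in D by apply: sub; rewrite mem_head.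
        have bD : b \in D by apply: sub; rewrite !inE eqxx orbT.
        move: (xD) (bD); rewrite !inE /restr exb => /andP[_ ->] /andP[_ ->] /=.
        by apply: IH => // w wq; apply: sub; rewrite inE wq orbT.
      by have := sub z zq; rewrite in_setD; move: zS => /= ->.
  apply: subset_leq_card; apply/subsetP=> z.
  by rewrite in_setI in_setU in_setD => /andP[/orP[zR|/setIP[]//] /andP[/negP[]]].
have hX i : h i \in X by have [] := L i.
have hinj : injective h.
  by move=> i j eq; apply: (dis i j (h i)); rewrite ?eq mem_head.
have honto x : x \in X -> exists i, h i = x.
  move=> xX; have /setP/(_ x) : [set h i | i in 'I_(#|X|)] = X.
    apply/eqP; rewrite eqEcard card_imset // card_ord leqnn andbT.
    by apply/subsetP=> _ /imsetP[i _ ->].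
  by rewrite xX => /imsetP[i _ ->]; exists i.
have key x : exists Wf : {set T} * T, x \in X -> exists i, [/\ h i = x, Wf.1 \subset [set z in h i :: p i],
   x \in Wf.1, Wf.1 \subset V & Wf.1 :&: Y = [set Wf.2] /\ conn e Wf.1 x Wf.2].
  case: (boolP (x \in X)) => [xX|_]; last by exists (set0, x).
  have [i eqx] := honto x xX; have [pth u _ lY] := L i.
  (* Truncation at the first vertex of [Y] makes the route meet [Y] exactly once. *)
  have : has (mem Y) (h i :: p i) by apply/hasP; exists (last (h i) (p i)); rewrite ?mem_last.
  case/first_hit=> q1 [q2 [eqp lq bq]].
  exists ([set z in h i :: q1], last (h i) q1) => _; exists i; split=> //=.
  + by apply/subsetP=> z; rewrite !inE eqp mem_cat => /orP[->|->] //; rewrite !orbT.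
  + by rewrite eqx !inE eqxx.
  + apply/subsetP=> z; rewrite in_set inE => /orP[/eqP->|zq].
      exact: (subsetP XV).
    move: pth; rewrite eqp cat_path => /andP[pth _].
    move: pth {eqp lq bq u eqx}; elim: q1 (h i) zq => //= b q1 IH a.
    by rewrite inE => zq /andP[/and3P[_ _ bV] pth]; case/orP: zq => [/eqP->//|zq]; apply: IH pth.
  split.
    apply/setP=> z; rewrite !inE; apply/idP/eqP => [/andP[]|->]; last first.
      by rewrite -in_cons mem_last.
    rewrite -in_cons lastI mem_rcons inE => /orP[/eqP//|zb zY].
    by have := bq z zb; rewrite /= zY.
  rewrite -eqx; apply: path_conn; last by move=> z; rewrite in_set.
  move: pth; rewrite eqp cat_path => /andP[pth _].
  by apply: sub_path pth => a b /and3P[].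
have [WF HWF] := fin_all_exists key.
exists (fun x => (WF x).1), (fun x => (WF x).2); split.
  by move=> x xX; have [i [_ _ ? ? []]] := HWF x xX.
move=> x x' xX x'X ne; have [i [hi si _ _ _]] := HWF x xX; have [j [hj sj _ _ _]] := HWF x' x'X.
rewrite disjoint_subset; apply/subsetP=> z /(subsetP si); rewrite !inE => zi.
apply/negP=> /(subsetP sj); rewrite !inE => zj.
by case/eqP: ne; rewrite -hi -hj; congr h; apply: (dis i j z).
Qed.

End Menger.

(** * Linkages in dense graphs *)

Section ListFacts.
Variable T : eqType.
Implicit Types (a : pred T) (l c : seq T) (x : T).

Lemma split_first a l : has a l ->
  exists l1 u l2, [/\ l = l1 ++ u :: l2, a u & count a l1 = 0].
Proof.
elim: l => //= x l IH; case: (boolP (a x)) => [ax _|nax /= /IH[l1 [u [l2 [-> au c0]]]]].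
  by exists [::], x, l.
by exists (x :: l1), u, l2; rewrite /= (negbTE nax) c0.
Qed.

Lemma split_last_occ a l : has a l ->
  exists l1 u l2, [/\ l = l1 ++ u :: l2, a u & count a l2 = 0].
Proof.
elim/last_ind: l => //= l x IH; rewrite has_rcons.
case: (boolP (a x)) => [ax _|nax /= /IH[l1 [u [l2 [-> au c0]]]]].
  by exists l, x, [::]; rewrite cats1.
exists l1, u, (rcons l2 x); rewrite -cats1 -catA cat_cons cats1 -cats1 count_cat c0 /=.
by rewrite (negbTE nax).
Qed.

(** The hypothesis applied to the first and the last occurrence already confines all occurrences to
    three consecutive places. *)
Lemma window_count a l :
  (forall l1 u l2 v l3, l = l1 ++ u :: l2 ++ v :: l3 -> a u -> a v -> size l2 <= 1) ->
  count a l <= 3 /\ (count a l = 3 -> exists l1 u w v l3,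
    [/\ l = l1 ++ [:: u, w, v & l3], a u, a w & a v]).
Proof.
move=> H; case: (boolP (has a l)) => [/split_first[l1 [u [r [eql au c0]]]]|]; last first.
  by rewrite has_count -leqNgt leqn0 => /eqP->.
case: (boolP (has a r)) => [/split_last_occ[l2 [v [l3 [eqr av c3]]]]|]; last first.
  rewrite has_count -leqNgt leqn0 => /eqP r0.
  by rewrite eql count_cat c0 /= au r0.
have := H l1 u l2 v l3; rewrite eql eqr => /(_ erefl au av) le2.
rewrite count_cat c0 /= au count_cat /= av c3 add0n addn0.
have cs := count_size a l2; split; first by lia.
move=> c2; have : size l2 = 1 by lia.
case: l2 {H eqr cs} le2 c2 => [//|w [|//]] _ /= cw _.
have aw : a w by move: cw; case: (a w) => //; lia.
by exists l1, u, w, v, l3.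
Qed.

Lemma count_uniq l : (forall x, count_mem x l <= 1) -> uniq l.
Proof.
move=> H; apply: count_mem_uniq => x; have := H x; have := has_count (pred1 x) l.
by rewrite has_pred1 => ->; case: (count _ _) => [|[]].
Qed.

Lemma endpoints_inside x y l1 u w v l3 c :
  x :: rcons c y = l1 ++ [:: u, w, v & l3] -> w \in c.
Proof.
move=> eql; have := congr1 size eql; rewrite /= size_rcons size_cat /= => sz.
have := congr1 (fun l => nth x l (size l1).+1) eql; rewrite /= nth_rcons.
have -> : size l1 < size c by lia.
rewrite nth_cat ltnNge leqnSn /= subSnn /= => <-; apply: mem_nth; lia.
Qed.

End ListFacts.

Lemma sum_upd q i (f g : nat -> nat) : i < q ->
  (forall j, j != i -> f j = g j) ->
  \sum_(0 <= j < q) f j + g i = \sum_(0 <= j < q) g j + f i.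
Proof.
move=> iq H; have iin : i \in index_iota 0 q by rewrite mem_index_iota.
rewrite (bigD1_seq i) ?iota_uniq //= [in RHS](bigD1_seq i) ?iota_uniq //=.
by rewrite (eq_bigr g) => [|j /H//]; lia.
Qed.

Definition upd (A : Type) (c : nat -> A) i x := fun j => if j == i then x else c j.

(** * Shortest links and detours *)

Section Detour.
Variables (T : finType) (e : rel T).
Hypothesis se : symmetric e.
Implicit Types (F W : {set T}) (a b f u v w x y z : T) (c l : seq T).

(** The interior is nonempty, as required of links, but may repeat vertices: a detour need not be
    checked for simplicity, and a shortest interior has no repetition anyway. *)
Definition gpath F a b c := [&& path e a (rcons c b), all (mem F) c & c != [::]].

Lemma path_sorted_cat x l u l' :
  path e x (l ++ u :: l') = path e x (rcons l u) && path e u l'.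
Proof. by rewrite cat_path rcons_path /= andbA. Qed.

(** The segment [l2] is bypassed through [f]. Stating the count for every predicate yields the
    length, the vertices and the multiplicities of the new interior from one equation. *)
Lemma detour a b c l1 u l2 v l3 f : path e a (rcons c b) ->
  a :: rcons c b = l1 ++ u :: l2 ++ v :: l3 -> e f u -> e f v ->
  exists c', [/\ path e a (rcons c' b), c' != [::]
    & forall p : pred T, count p c' + count p l2 = count p c + p f].
Proof.
move=> pth eqP fu fv.
have sz := congr1 size eqP; rewrite /= size_rcons !size_cat /= !size_cat /= in sz.
have cnt p := congr1 (count p) eqP.
have [c' eqP'] : exists c', a :: rcons c' b = l1 ++ [:: u, f, v & l3].
  have lastb : last v l3 = b.
    by have := congr1 (last a) eqP; rewrite /= last_rcons !last_cat /= last_cat.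
  case: l1 eqP {sz cnt} => [|a' l1] /= [<- eqc].
    exists (f :: belast v l3); rewrite /=; congr [:: _, _ & _].
    by rewrite -[X in rcons _ X]lastb -lastI.
  exists (l1 ++ [:: u, f & belast v l3]); congr (_ :: _).
  by rewrite rcons_cat /= -[X in rcons _ X]lastb -lastI.
have cnt' p := congr1 (count p) eqP'.
exists c'; split.
- case: l1 eqP eqP' {sz cnt cnt'} => [|a' l1] /= [eqa eqc] [eqa' ->]; last first.
    move: pth; rewrite eqc path_sorted_cat => /andP[p1 p2].
    rewrite path_sorted_cat p1 /= se fu fv /=.
    by move: p2; rewrite path_sorted_cat => /andP[].
  rewrite eqa /= se fu fv; move: pth; rewrite eqc eqa path_sorted_cat => /andP[_].
  by [].
- by case: c' eqP' {cnt'} => //; case: l1 {eqP sz cnt} => [|? [|? [|??]]].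
move=> p; have := cnt p; have := cnt' p.
by rewrite /= -!cats1 !count_cat /= !count_cat /=; lia.
Qed.

Definition linkable F a b := exists c, gpath F a b c.

(** On a shortest interior, [f] cannot bypass more than one vertex, so its neighbours lie in a
    window of three. The vertex [f] may itself lie on the path, since detours may repeat
    vertices. *)
Lemma linkable_short F a b : linkable F a b -> exists c,
  [/\ gpath F a b c, uniq c,
      forall c', gpath F a b c' -> size c <= size c'
    & {in F, forall f, count (e f) (a :: rcons c b) <= 3}].
Proof.
move=> /(ex_argmin size)[c [gc minc]]; exists c; have /and3P[pth Fc c0] := gc.
split=> //.
- case: c gc pth Fc c0 minc => //= x c gc.
  rewrite rcons_path => /and3P[ax pth lb] /andP[xF cF] _ minc.
  have : size c <= size (shorten x c).
    have : gpath F a b (x :: shorten x c).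
      move: lb; case: (shortenP pth) => p' pp' up' /= sp' lb.
      rewrite /gpath /= rcons_path ax pp' lb xF /= andbT.
      by apply/allP=> z /sp'; apply: (allP cF).
    by move/minc.
  case: (shortenP pth) => p' pp' up' sp' sz.
  have sub : {subset x :: p' <= x :: c}.
    by move=> z; rewrite !inE => /orP[->//|/sp' ->]; rewrite orbT.
  by have := leq_size_uniq up' sub sz.
move=> f fF; have [] // := @window_count _ (e f) (a :: rcons c b).
move=> l1 u l2 v l3 eqP fu fv.
have [c' [pth' c'0 cnt]] := detour pth eqP fu fv.
have := cnt predT; rewrite !count_predT /= => sz.
have : size c <= size c'; last by lia.
apply: minc; rewrite /gpath pth' c'0 andbT; apply/allP=> z zc' /=.
have := cnt (pred1 z); have : 0 < count_mem z c' by rewrite -has_count has_pred1.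
rewrite /=; case: (eqVneq f z) => [<-//|_] pos cz.
have aux (i j k : nat) : 0 < i -> i + j = k + 0 -> 0 < k by lia.
have : z \in c by rewrite -has_pred1 has_count; apply: aux pos cz.
by move/(allP Fc).
Qed.

Definition rch F z := [set y in F | [exists x, [&& x \in F, e z x & conn e F x y]]].

Lemma rch_sub F z : rch F z \subset F.
Proof. by apply/subsetP=> y; rewrite inE => /andP[]. Qed.

Lemma rch_nbr F z y : y \in F -> e z y -> y \in rch F z.
Proof.
by move=> yF zy; rewrite inE yF; apply/existsP; exists y; rewrite yF zy conn_refl.
Qed.

Lemma rch_step F z y y' : y \in rch F z -> y' \in F -> e y y' -> y' \in rch F z.
Proof.
rewrite !inE => /andP[yF /existsP[x /and3P[xF zx cxy]]] y'F yy'; rewrite y'F.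
by apply/existsP; exists x; rewrite xF zx (conn_trans cxy) // conn1.
Qed.

Lemma rch_mono F F' z : F \subset F' -> rch F z \subset rch F' z.
Proof.
move=> sF; apply/subsetP=> y; rewrite !inE.
move=> /andP[yF /existsP[x /and3P[xF zx cxy]]]; rewrite (subsetP sF) //.
apply/existsP; exists x; rewrite (subsetP sF) // zx; apply: conn_mono cxy => //.
Qed.

(** The reach witnesses itself, so it survives every change of [F] that takes place outside it. *)
Lemma rch_self F z : rch F z \subset rch (rch F z) z.
Proof.
apply/subsetP=> y yr; rewrite inE yr; move: (yr); rewrite inE.
move=> /andP[yF /existsP[x /and3P[xF zx cxy]]].
apply/existsP; exists x; rewrite rch_nbr // zx /=.
have [p [pth <- _ sub]] := conn_path xF cxy.
apply: path_conn => // {y yr yF cxy}; have xr := rch_nbr xF zx.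
elim: p x {xF zx} pth sub xr => [|w p IH] x /= pth sub xr y.
  by rewrite inE => /eqP->.
case/andP: pth => xw pth; rewrite inE => /orP[/eqP->//|]; apply: IH => //.
  by move=> v vp; apply: sub; rewrite inE vp orbT.
by apply: rch_step xr _ xw; apply: sub; rewrite !inE eqxx orbT.
Qed.

Lemma joins_gpath F a b : joins e F a b -> linkable F a b.
Proof.
move=> [x [y [xF yF ax yb cxy]]]; have [p [pth lp _ sub]] := conn_path xF cxy.
exists (x :: p); rewrite /gpath /= ax rcons_path pth lp se yb xF /=.
by rewrite andbT; apply/allP=> z zp; apply: sub; rewrite inE zp orbT.
Qed.

Lemma gpath_joins a b c : path e a (rcons c b) -> c != [::] ->
  joins e [set x in c] a b.
Proof.
case: c => //= x c; rewrite rcons_path => /and3P[ax pth lb] _.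
exists x, (last x c); rewrite !in_set mem_head mem_last ax se lb; split=> //.
by apply: path_conn => // z; rewrite in_set.
Qed.

Lemma rch_linkable F a b y : y \in rch F a -> y \in rch F b -> linkable F a b.
Proof.
rewrite !inE => /andP[yF /existsP[x /and3P[xF zx cxy]]].
move=> /andP[_ /existsP[x' /and3P[x'F zx' cxy']]]; apply: joins_gpath.
by exists x, x'; split=> //; apply: conn_trans cxy _; rewrite conn_sym.
Qed.

End Detour.

(** * Partial linkages of minimal total length *)

Section Configurations.
Variables (T : finType) (e : rel T) (L Z : {set T}) (n : nat) (s t : nat -> T).
Hypothesis se : symmetric e.
Hypothesis ZL : Z \subset L.
Implicit Types (c : nat -> seq T) (x y z f w : T).

Notation D := (L :\: Z).
Definition deg (W : {set T}) x := #|[set y in W | e x y]|.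
Definition terminals q := flatten [seq [:: s i; t i] | i <- iota 0 q].
Definition interiors q c := flatten [seq c i | i <- iota 0 q].
Definition config q c :=
  (forall i, i < q -> gpath e D (s i) (t i) (c i)) /\ uniq (interiors q c).
Definition mincfg q c :=
  config q c /\ forall c', config q c' -> size (interiors q c) <= size (interiors q c').
Definition free q c := D :\: [set x in interiors q c].
Definition rest q := Z :\: [set x in terminals q].
Definition whole c i := s i :: rcons (c i) (t i).

Hypothesis Hs : forall i, i < n -> s i \in Z.
Hypothesis Ht : forall i, i < n -> t i \in Z.
Hypothesis uniq_terminals : uniq (terminals n).

Definition is_ x : pred T := fun y => y == x.

Lemma mem_count x (l : seq T) : (x \in l) = (0 < count (is_ x) l).
Proof.
rewrite -has_count; apply/idP/hasP => [xl|[y yl /eqP <-]//].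
by exists x => //; rewrite /is_ eqxx.
Qed.

Lemma uniq_count (l : seq T) : (forall x, count (is_ x) l <= 1) -> uniq l.
Proof. exact: count_uniq. Qed.

Lemma count_uniq1 x (l : seq T) : uniq l -> count (is_ x) l <= 1.
Proof. by move=> u; have := count_uniq_mem x u; rewrite /pred1 /is_ => ->; case: (_ \in _). Qed.

Lemma count_interiors p q c : count p (interiors q c) = \sum_(0 <= i < q) count p (c i).
Proof.
by rewrite count_flatten sumnE -map_comp big_map /index_iota subn0.
Qed.

Lemma mem_interiors x q c : reflect (exists2 i, i < q & x \in c i) (x \in interiors q c).
Proof.
apply: (iffP flatten_mapP) => [[i]|[i iq xc]].
  by rewrite mem_iota => iq xc; exists i.
by exists i => //; rewrite mem_iota.
Qed.

Lemma interiorsS q c (c0 : seq T) : interiors q.+1 (upd c q c0) = interiors q c ++ c0.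
Proof.
rewrite /interiors -(addn1 q) iotaD map_cat flatten_cat /= cats0 add0n {2}/upd eqxx.
congr (flatten _ ++ _); apply/eq_in_map => i; rewrite mem_iota /= add0n => /ltn_eqF.
by rewrite /upd => ->.
Qed.

Lemma count_terminals p q : count p (terminals q) = \sum_(0 <= i < q) (p (s i) + p (t i)).
Proof.
rewrite count_flatten sumnE -map_comp big_map /index_iota subn0.
by apply: eq_bigr => i _; rewrite /= addn0.
Qed.

Lemma size_terminals q : size (terminals q) = 2 * q.
Proof.
rewrite -(count_predT (terminals q)) count_terminals (eq_bigr (fun=> 2)) //.
by rewrite sum_nat_const_nat; lia.
Qed.

Lemma terminals_uniq q : q <= n -> uniq (terminals q).
Proof.
move=> qn; move: uniq_terminals; rewrite /terminals -(subnKC qn) iotaD map_cat flatten_cat.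
by rewrite cat_uniq => /and3P[].
Qed.

Lemma terminals_sub q : q <= n -> {subset terminals q <= Z}.
Proof.
move=> qn x /flatten_mapP[i]; rewrite mem_iota => /= iq; have lt : i < n by lia.
by rewrite !inE => /orP[]/eqP->; auto.
Qed.

Lemma rest_end q i : q <= i -> i < n -> s i \in rest q /\ t i \in rest q.
Proof.
move=> qi lt; rewrite !in_setD !in_set Hs // Ht // !andbT.
have := uniq_terminals; rewrite /terminals.
have -> : n = i + (n - i) by lia.
rewrite iotaD map_cat flatten_cat cat_uniq => /and3P[_ /hasPn no _].
have sub : {subset terminals q <= terminals i}.
  move=> x /flatten_mapP[j]; rewrite mem_iota => /= jq xj; apply/flatten_mapP.
  by exists j => //; rewrite mem_iota; lia.
have hi x : x \in [:: s i; t i] ->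
    x \in flatten [seq [:: s j; t j] | j <- iota (0 + i) (n - i)].
  by move=> xi; apply/flatten_mapP; exists i => //; rewrite mem_iota; lia.
have key x : x \in [:: s i; t i] -> x \notin terminals q.
  by move=> xi; apply/negP => /sub h; have := no x (hi x xi); rewrite /= h.
by split; apply: key; rewrite !inE eqxx ?orbT.
Qed.

Lemma card_rest q : q <= n -> #|rest q| + 2 * q = #|Z|.
Proof.
move=> qn; rewrite cardsD (setIidPr _); last first.
  by apply/subsetP=> x; rewrite inE => /(terminals_sub qn).
rewrite cardsE (card_uniqP (terminals_uniq qn)) size_terminals subnK //.
rewrite -size_terminals -(card_uniqP (terminals_uniq qn)) -cardsE.
by apply: subset_leq_card; apply/subsetP=> x; rewrite inE => /(terminals_sub qn).
Qed.

Lemma interiors_sub q c : config q c -> {subset interiors q c <= D}.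
Proof.
by move=> [H _] x /mem_interiors[i iq xc]; have /and3P[_ /allP/(_ x xc)] := H i iq.
Qed.

Lemma card_free q c : config q c -> #|free q c| + size (interiors q c) + #|Z| = #|L|.
Proof.
move=> cf; have [_ u] := cf; have sub : [set x in interiors q c] \subset D.
  by apply/subsetP=> x; rewrite inE => /(interiors_sub cf).
have := cardsID [set x in interiors q c] D; rewrite (setIidPr sub) cardsE (card_uniqP u).
have := cardsID Z L; rewrite (setIidPr ZL) -/(free q c); lia.
Qed.

Lemma interior_gt0 q c i : config q c -> i < q -> 0 < size (c i).
Proof. by move=> [H _] /H /and3P[_ _]; rewrite -size_eq0 lt0n. Qed.

Lemma size_interiors_ge q c : config q c -> q <= size (interiors q c).
Proof.
move=> cf; rewrite -(count_predT (interiors q c)) count_interiors.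
rewrite -[X in X <= _](mul1n q) -[X in _ * X](subn0 q) mulnC -sum_nat_const_nat.
rewrite big_nat [X in _ <= X]big_nat; apply: leq_sum => i /= iq.
by rewrite count_predT (interior_gt0 cf).
Qed.

Lemma deg_bound q c x : config q c ->
  deg L x <= deg (free q c) x + deg (rest q) x + \sum_(0 <= i < q) count (e x) (whole c i).
Proof.
move=> cf.
have -> : \sum_(0 <= i < q) count (e x) (whole c i) =
    count (e x) (interiors q c) + count (e x) (terminals q).
  rewrite count_interiors count_terminals -big_split /=; apply: eq_bigr => i _.
  by rewrite -cats1 count_cat /=; lia.
have cnt (l : seq T) : #|[set y in l | e x y]| <= count (e x) l.
  rewrite -size_filter; apply: leq_trans (card_size _); apply: subset_leq_card.
  by apply/subsetP=> y; rewrite inE mem_filter andbC.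
apply: leq_trans (leq_add (leqnn _) (leq_add (cnt _) (cnt _))).
apply: leq_trans (leq_add (leq_card_setU _ _) (leq_card_setU _ _)).
apply: leq_trans (leq_card_setU _ _); apply: subset_leq_card; apply/subsetP=> y.
rewrite !inE => /andP[-> ->]; rewrite !andbT.
by case: (y \in interiors q c); case: (y \in terminals q); case: (y \in Z).
Qed.

Lemma config_upd q c i (c' l2 : seq T) f : config q c -> i < q -> f \in free q c ->
  path e (s i) (rcons c' (t i)) -> c' != [::] ->
  (forall p : pred T, count p c' + count p l2 = count p (c i) + p f) ->
  config q (upd c i c') /\ forall p : pred T,
    count p (interiors q (upd c i c')) + count p l2 = count p (interiors q c) + p f.
Proof.
move=> cf iq fF pth c'0 cnt.
have cntI p : count p (interiors q (upd c i c')) + count p l2 = count p (interiors q c) + p f.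
  rewrite !count_interiors.
  have off j : j != i -> count p (upd c i c' j) = count p (c j).
    by rewrite /upd => /negbTE->.
  have := sum_upd iq off; rewrite {2}/upd eqxx; have := cnt p; lia.
split=> //; have [H u] := cf.
have memc' x : x \in c' -> x \in c i \/ x = f.
  rewrite !mem_count => pos; have := cnt (is_ x); rewrite -[is_ x f]/(f == x).
  by case: (eqVneq f x) => [->|_] eqc; [right|left; lia].
move: (fF); rewrite !inE => /andP[fC /andP[fZ fL]].
split=> [j jq|].
  rewrite /upd; case: (eqVneq j i) => [->|_]; last exact: H.
  rewrite /gpath pth c'0 andbT; apply/allP=> x /memc'[xc|->] /=.
    by have /and3P[_ /allP/(_ x xc)] := H i iq.
  by rewrite !inE fZ.
apply: uniq_count => x; have := cntI (is_ x); have := count_uniq1 x u.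
rewrite -[is_ x f]/(f == x); have := fC; rewrite mem_count.
by case: (eqVneq f x) => [->|_]; clear; lia.
Qed.

Section Minimal.
Variables (q : nat) (c : nat -> seq T).
Hypothesis mc : mincfg q c.

(** Otherwise [f] would bypass at least two vertices at the price of one, against minimality. *)
Lemma config_window i f l1 u l2 v l3 : i < q -> f \in free q c ->
  whole c i = l1 ++ u :: l2 ++ v :: l3 -> e f u -> e f v -> size l2 <= 1.
Proof.
move=> iq fF eqP fu fv; have [cf minc] := mc; have [H _] := cf.
have /and3P[pth _ _] := H i iq.
have [c' [pth' c'0 cnt]] := detour se pth eqP fu fv.
have [cf' cnt'] := config_upd cf iq fF pth' c'0 cnt.
by have := minc _ cf'; have := cnt' predT; rewrite !count_predT; clear; lia.
Qed.

Lemma config_count i f : i < q -> f \in free q c -> count (e f) (whole c i) <= 3.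
Proof.
move=> iq fF; have [] // := @window_count _ (e f) (whole c i).
move=> l1 u l2 v l3; exact: config_window.
Qed.

Lemma config_three i f : i < q -> f \in free q c -> count (e f) (whole c i) = 3 ->
  exists l1 u w v l3, [/\ whole c i = l1 ++ [:: u, w, v & l3], e f u, e f w & e f v].
Proof.
move=> iq fF; have [] // := @window_count _ (e f) (whole c i).
move=> l1 u l2 v l3; exact: config_window.
Qed.

(** Bypassing exactly one vertex keeps the total length, so the new configuration is still minimal,
    with [f] and [w] exchanged in the free set. *)
Lemma config_swap i f l1 u w v l3 : i < q -> f \in free q c ->
  whole c i = l1 ++ [:: u, w, v & l3] -> e f u -> e f v ->
  [/\ w \in D, w \notin free q c & exists c', mincfg q c' /\
     forall x, (x \in free q c') = (x == w) || (x \in free q c) && (x != f)].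
Proof.
move=> iq fF eqP fu fv; have [cf minc] := mc; have [H uc] := cf.
have wc : w \in c i by apply: endpoints_inside eqP.
have wC : w \in interiors q c by apply/mem_interiors; exists i.
have wD := interiors_sub cf wC; split=> //; first by rewrite in_setD in_set wC.
have /and3P[pth _ _] := H i iq.
have [c' [pth' c'0 cnt]] := detour se pth (eqP : _ = _ ++ u :: [:: w] ++ v :: l3) fu fv.
have [cf' cnt'] := config_upd cf iq fF pth' c'0 cnt.
exists (upd c i c'); split.
  split=> // c2 /minc; apply: leq_trans; have := cnt' predT; rewrite !count_predT /=.
  by clear; lia.
move: (fF); rewrite in_setD in_set => /andP[fC fD].
have fw : f != w by apply: contraNneq fC => ->.
move=> x; rewrite [x \in free q (upd _ _ _)]in_setD in_set [x \in free q c]in_setD in_set.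
have := cnt' (is_ x); have := count_uniq1 x uc; rewrite !mem_count.
rewrite -[is_ x f]/(f == x); have -> : count (is_ x) [:: w] = (w == x) by rewrite /= addn0.
rewrite [w == x]eq_sym; case: (eqVneq x w) => [->|xw] /=.
  by have := wC; rewrite mem_count (negbTE fw) wD andbT; clear; lia.
rewrite eq_sym; case: (eqVneq x f) => [->|xf] /=; last by rewrite andbT addn0 addn0 => _ ->.
rewrite andbF; have := fC; rewrite mem_count; case: (f \in D) ; rewrite ?andbF //; clear; lia.
Qed.

End Minimal.

(* Maximising the part of t q makes exchanging a one-vertex interior with a vertex on the
   side of s q impossible. *)
Lemma config_split q : q < n ->
  (forall c, mincfg q c -> ~ linkable e (free q c) (s q) (t q)) ->
  (exists c a b, [/\ mincfg q c, a \in free q c, e (s q) a, b \in free q c & e (t q) b]) ->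
  exists c a b, [/\ mincfg q c, a \in rch e (free q c) (s q), e (s q) a,
      b \in rch e (free q c) (t q) &
      forall i f g, i < q -> f \in rch e (free q c) (s q) -> f != a ->
        g \in rch e (free q c) (t q) ->
        count (e f) (whole c i) + count (e g) (whole c i) <= minn (size (c i)) 2 + 4].
Proof.
move=> qn nolink [c0 [a0 [b0 [m0 a0F sa0 b0F tb0]]]].
pose P (x : (nat -> seq T) * T * T) := [/\ mincfg q x.1.1, x.1.2 \in free q x.1.1,
  e (s q) x.1.2, x.2 \in free q x.1.1 & e (t q) x.2].
have exP : exists o, P o by exists (c0, a0, b0).
pose size_of (x : (nat -> seq T) * T * T) := #|rch e (free q x.1.1) (t q)|.
have [[[c a] b] [Pc maxc]] :
    exists o, P o /\ forall o', P o' -> size_of o' <= size_of o.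
  by apply: (ex_argmax (M := #|T|) exP) => o _; apply: max_card.
have [mc aF sa bF tb] : [/\ mincfg q c, a \in free q c, e (s q) a, b \in free q c
  & e (t q) b] by [].
exists c, a, b; split=> //; [exact: rch_nbr|exact: rch_nbr|].
move=> i f g iq fA fa gB.
have fF := subsetP (rch_sub _ _ _) _ fA; have gF := subsetP (rch_sub _ _ _) _ gB.
have c1 := config_count mc iq fF; have c2 := config_count mc iq gF.
have [cf _] := mc; have c0' := interior_gt0 cf iq.
case: (ltngtP (count (e f) (whole c i)) 3) c1 => // c1 _; first by move: c1 c2 c0'; clear; lia.
case: (ltngtP (count (e g) (whole c i)) 3) c2 => // c2 _; first by move: c1 c2 c0'; clear; lia.
case: (ltnP 1 (size (c i))) => [sz|le1]; first by rewrite c1 c2; move: sz; clear; lia.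
(* What remains: [f] and [g] each have three neighbours on a path whose only inner vertex is [w].
   Exchanging [f] for [w] keeps [a] free because [f != a], keeps the reach of [t q] free, and adds
   [w] to that reach through [g], against the maximal choice. *)
exfalso.
have [l1 [u [w [v [l3 [eqP fu fw fv]]]]]] := config_three mc iq fF c1.
have gw : e g w.
  have [m1 [u' [w' [v' [m3 [eqP' gu' gw' gv']]]]]] := config_three mc iq gF c2.
  have wc := endpoints_inside eqP; have wc' := endpoints_inside eqP'.
  case: (c i) le1 wc wc' => [|x [|]] // _; rewrite !inE.
  by move=> /eqtype.eqP wx /eqtype.eqP w'x; rewrite wx -w'x.
have [wD wF [c' [mc' memF]]] := config_swap mc iq fF eqP fu fv.
have fB : f \notin rch e (free q c) (t q).
  apply/negP => fB; apply: (nolink c mc); exact: (rch_linkable se fA fB).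
have subB : rch e (free q c) (t q) \subset free q c'.
  apply/subsetP=> z zB; rewrite memF (subsetP (rch_sub _ _ _) _ zB) /=.
  by have -> : z != f; [apply: contraNneq fB => <-|rewrite orbT].
have bt := rch_nbr bF tb.
have Pc' : P (c', a, b).
  split=> //=; first by rewrite memF aF [a == f]eq_sym fa orbT.
  exact: (subsetP subB).
have := maxc _ Pc'; rewrite leqNgt => /negP[]; apply: proper_card; apply/properP.
have sub' : rch e (free q c) (t q) \subset rch e (free q c') (t q).
  exact: subset_trans (rch_self _ _ _) (rch_mono _ _ subB).
split=> //; exists w; last first.
  by apply: contra wF => /(subsetP (rch_sub _ _ _)).
apply: rch_step (subsetP sub' _ gB) _ gw.
by rewrite memF eqxx.
Qed.

Lemma config_extend q c (c0 : seq T) : config q c ->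
  gpath e (free q c) (s q) (t q) c0 -> uniq c0 -> config q.+1 (upd c q c0).
Proof.
move=> [H u] /and3P[pth cF c00] u0; split.
  move=> i iq; rewrite /upd; case: (eqVneq i q) => [->|ne]; last by apply: H; lia.
  rewrite /gpath pth c00 andbT; apply/allP=> x xc.
  by have /setDP[] := allP cF x xc.
rewrite interiorsS cat_uniq u u0 andbT /=; apply/hasPn => x xc.
by have /setDP[_] := allP cF x xc; rewrite in_set.
Qed.

Lemma config_min q : (exists c, config q c) -> exists c, mincfg q c.
Proof. by move=> /(ex_argmin (fun c => size (interiors q c)))[c ?]; exists c. Qed.

Lemma config0 : config 0 (fun=> [::]).
Proof. by split. Qed.

End Configurations.

Section Dense.
Variables (T : finType) (e : rel T).
Hypotheses (se : symmetric e) (ie : irreflexive e).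
Implicit Types (A B F L W X Y Z : {set T}) (f g x y z w : T).

Notation dg := (deg e).

Lemma deg_sub W W' x : W \subset W' -> dg W x <= dg W' x.
Proof.
move=> sub; apply: subset_leq_card; apply/subsetP=> y; rewrite !inE => /andP[yW ->].
by rewrite (subsetP sub).
Qed.

Lemma deg_setU W W' x : dg (W :|: W') x <= dg W x + dg W' x.
Proof.
apply: leq_trans (leq_card_setU _ _); apply: subset_leq_card; apply/subsetP=> y.
by rewrite !inE => /andP[/orP[->|->] ->] //; rewrite orbT.
Qed.

Lemma deg_card W x : dg W x <= #|W|.
Proof. by apply: subset_leq_card; apply/subsetP=> y; rewrite inE => /andP[]. Qed.

Lemma deg_lt W x z : z \in W -> ~~ e x z -> dg W x < #|W|.
Proof.
move=> zW nxz; apply: proper_card; apply/properP; split.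
  by apply/subsetP=> y; rewrite inE => /andP[].
by exists z => //; rewrite inE zW (negbTE nxz).
Qed.

Lemma deg_self W x : x \in W -> dg W x < #|W|.
Proof. by move=> xW; apply: (@deg_lt _ _ x); rewrite ?ie. Qed.

Lemma deg_gt0 W x : 0 < dg W x -> exists2 y, y \in W & e x y.
Proof. by case/card_gt0P=> y; rewrite inE => /andP[yW xy]; exists y. Qed.

Lemma deg_set_seq W x (l : seq T) : W \subset [set y in l] -> dg W x <= count (e x) l.
Proof.
move=> /subsetP sub; rewrite -size_filter; apply: leq_trans (card_size _).
apply: subset_leq_card; apply/subsetP=> y; rewrite inE mem_filter => /andP[/sub].
by rewrite inE => -> ->.
Qed.

Lemma lk_of_config L Z :
  (forall n (s t : nat -> T), (forall i, i < n -> s i \in Z) -> (forall i, i < n -> t i \in Z) ->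
     uniq (terminals s t n) -> exists c, config e L Z s t n c) ->
  lk e (L :\: Z) Z.
Proof.
move=> H I s t sZ tZ is_ it_ st.
case: (pickP (fun _ : I => true)) => [x0 _|no]; last first.
  by exists (fun=> set0); split=> i; have := no i.
pose f i := nth x0 (enum I) i.
have inj i j : i < #|I| -> j < #|I| -> f i = f j -> i = j.
  rewrite cardE => iI jI /eqP; rewrite nth_uniq ?enum_uniq // => /eqP//.
have [|||c [Hc uc]] := H #|I| (s \o f) (t \o f).
- by move=> i _; apply: sZ.
- by move=> i _; apply: tZ.
- have : #|I| <= #|I| by [].
  move: {1 3}#|I| => q; elim: q => // q IH lt.
  rewrite /terminals -addn1 iotaD map_cat flatten_cat cat_uniq.
  rewrite -/(terminals _ _ _) IH ?(ltnW lt) //= orbF !inE.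
  have no g : (forall i, i < q -> s (f i) != g /\ t (f i) != g) ->
      g \notin terminals (s \o f) (t \o f) q.
    move=> ng; apply/flatten_mapP=> -[i]; rewrite mem_iota /= => iq.
    have [/negbTE n1 /negbTE n2] := ng i iq.
    by rewrite !inE ![g == _]eq_sym n1 n2.
  have lf i : i < q -> f i != f q.
    by move=> iq; apply/eqP => /inj eqi; have := eqi (ltn_trans iq lt) lt; lia.
  have n1 : s (f q) \notin terminals (s \o f) (t \o f) q.
    apply: no => i iq; split; last by rewrite eq_sym st.
    by apply: contraNneq (lf i iq) => /is_->.
  have n2 : t (f q) \notin terminals (s \o f) (t \o f) q.
    apply: no => i iq; split; first exact: st.
    by apply: contraNneq (lf i iq) => /it_->.
  by rewrite (negbTE n1) (negbTE n2) /= andbT st.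
exists (fun i => [set x in c (index i (enum I))]).
have idx (i : I) : index i (enum I) < #|I| by rewrite cardE index_mem mem_enum.
have fidx (i : I) : f (index i (enum I)) = i by rewrite /f nth_index ?mem_enum.
split.
- move=> i; apply/subsetP=> x; rewrite in_set => xc.
  by have /and3P[_ /allP/(_ x xc)] := Hc _ (idx i).
- move=> i j ij; rewrite -setI_eq0; apply/eqP/setP=> x; rewrite !inE; apply/negP=> /andP[xi xj].
  have nij : index i (enum I) != index j (enum I).
    by apply: contra_neq ij => eqi; rewrite -(fidx i) eqi fidx.
  have := count_uniq1 x uc; rewrite count_interiors.
  rewrite (bigD1_seq (index i (enum I))) ?iota_uniq ?mem_index_iota //=.
  rewrite [X in _ + X <= _]big_mkcond (bigD1_seq (index j (enum I))) ?iota_uniq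
    ?mem_index_iota //=.
  rewrite eq_sym nij /=.
  move: xi xj; rewrite !mem_count => ai aj; apply/negP; rewrite -ltnNge.
  exact: (leq_add ai (leq_trans aj (leq_addr _ _))).
- move=> i; have /and3P[pth _ c0] := Hc _ (idx i).
  by have := gpath_joins se pth c0; rewrite /= fidx.
Qed.

Section Levels.
Variables (L Z : {set T}) (n : nat) (s t : nat -> T).
Hypothesis ZL : Z \subset L.
Hypothesis Hs : forall i, i < n -> s i \in Z.
Hypothesis Ht : forall i, i < n -> t i \in Z.
Hypothesis ut : uniq (terminals s t n).

Notation cfg := (config e L Z s t).
Notation mcf := (mincfg e L Z s t).
Notation fr := (free L Z).
Notation rs := (rest Z s t).

Lemma terminals_bound : 2 * n <= #|Z|.
Proof. by rewrite -(card_rest ZL Hs Ht ut (leqnn n)) leq_addl. Qed.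

Lemma sum_count_le3 q c f : mcf q c -> f \in fr q c ->
  \sum_(0 <= i < q) count (e f) (whole s t c i) <= 3 * q.
Proof.
move=> mc fF; rewrite big_nat.
apply: leq_trans (_ : \sum_(0 <= i < q | 0 <= i < q) 3 <= _).
  apply: leq_sum => i /andP[_ iq]; exact: (config_count se ZL ut mc iq fF).
by rewrite -big_nat sum_nat_const_nat; clear; lia.
Qed.

Lemma deg_free_lb q c f : mcf q c -> f \in fr q c ->
  deg e L f <= deg e (fr q c) f + deg e (rs q) f + 3 * q.
Proof.
move=> mc fF; apply: leq_trans (deg_bound ZL ut f mc.1) _.
by rewrite leq_add2l; apply: sum_count_le3.
Qed.

Lemma deg_interior q c x : cfg q c ->
  deg e (L :\: Z) x <= deg e (fr q c) x + count (e x) (interiors q c).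
Proof.
move=> cf; apply: leq_trans (_ : _ <= deg e (fr q c) x + deg e [set y in interiors q c] x) _.
  apply: leq_trans (deg_setU _ _ _); apply: deg_sub; apply/subsetP=> y yD.
  by rewrite inE orbC in_set in_setD in_set yD andbT; case: (y \in interiors q c).
by rewrite leq_add2l; apply: deg_set_seq.
Qed.

(** The two reaches are disjoint and closed under adjacency within the free set. A vertex of one
    reach is not adjacent to the terminal of the other, and this missing terminal makes the last two
    inequalities strict. *)
Lemma nolink_facts q c f g : q < n -> mcf q c ->
  ~ linkable e (fr q c) (s q) (t q) ->
  f \in rch e (fr q c) (s q) -> g \in rch e (fr q c) (t q) ->
  [/\ #|rch e (fr q c) (s q)| + #|rch e (fr q c) (t q)| <= #|fr q c|,
     deg e (fr q c) f <= deg e (rch e (fr q c) (s q)) f,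
     deg e (fr q c) g <= deg e (rch e (fr q c) (t q)) g,
     deg e (rs q) f < #|rs q| & deg e (rs q) g < #|rs q|].
Proof.
move=> qn mc nl fA gB; set A := rch _ _ _; set B := rch _ _ _.
have AB : A :&: B = set0.
  apply/eqP; rewrite setI_eq0 disjoint_subset; apply/subsetP=> y yA; rewrite inE.
  by apply/negP=> yB; apply: nl; apply: rch_linkable yA yB.
have fF := subsetP (rch_sub _ _ _) _ fA; have gF := subsetP (rch_sub _ _ _) _ gB.
have [sr tr] := rest_end ZL Hs Ht ut (leqnn q) qn.
split.
- have := cardsUI A B; rewrite AB cards0 addn0 => <-; apply: subset_leq_card.
  by rewrite subUset !rch_sub.
- apply: subset_leq_card; apply/subsetP=> y; rewrite [y \in [set _ in fr q c | _]]inE.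
  by move=> /andP[yF fy]; rewrite inE fy (rch_step fA).
- apply: subset_leq_card; apply/subsetP=> y; rewrite [y \in [set _ in fr q c | _]]inE.
  by move=> /andP[yF gy]; rewrite inE gy (rch_step gB).
- apply: deg_lt tr _; apply/negP=> ft; apply: nl; apply: (rch_linkable se fA).
  by apply: rch_nbr => //; rewrite se.
- apply: deg_lt sr _; apply/negP=> gs; apply: nl; apply: (rch_linkable se _ gB).
  by apply: rch_nbr => //; rewrite se.
Qed.

Lemma config_replace q c i (c' : seq T) : cfg q c -> i < q ->
  gpath e (fr q c) (s i) (t i) c' -> uniq c' ->
  cfg q (upd c i c') /\
  size (interiors q (upd c i c')) + size (c i) = size (interiors q c) + size c'.
Proof.
move=> cf iq /and3P[pth /allP cF c0] u'; have [H u] := cf.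
have cnt p : count p (interiors q (upd c i c')) + count p (c i) =
    count p (interiors q c) + count p c'.
  rewrite !count_interiors.
  have off j : j != i -> count p (upd c i c' j) = count p (c j).
    by rewrite /upd => /negbTE->.
  by have := sum_upd iq off; rewrite {2}/upd eqxx.
split; last by have := cnt predT; rewrite !count_predT.
split=> [j jq|].
  rewrite /upd; case: (eqVneq j i) => [->|_]; last exact: H.
  rewrite /gpath pth c0 andbT; apply/allP=> x /cF /=.
  by case/setDP.
apply: uniq_count => x; have := cnt (is_ x); have := count_uniq1 x u.
have := count_uniq1 x u'; case: (boolP (x \in c')) => [/cF|].
  rewrite /= in_setD in_set mem_count => /andP[].
  by clear; lia.
by rewrite mem_count; clear; lia.
Qed.

End Levels.
End Dense.

(** * Linking when all degrees are at least half of the order *)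

Section DenseLinking.
Variables (T : finType) (e : rel T).
Hypotheses (se : symmetric e) (ie : irreflexive e).
Implicit Types (A B F L W X Y Z : {set T}) (f g x y z w : T).

Section DenseConfig.
Variables (m : nat) (Y Z : {set T}) (n : nat) (s t : nat -> T).
Hypothesis ZY : Z \subset Y.
Hypothesis Zm : #|Z| <= 2 * m.
Hypothesis Hs : forall i, i < n -> s i \in Z.
Hypothesis Ht : forall i, i < n -> t i \in Z.
Hypothesis ut : uniq (terminals s t n).
Hypothesis deg3 : {in Y, forall y, 3 * m + 2 <= deg e Y y}.
Hypothesis deg2 : {in Y, forall y, #|Y| + 2 * m <= 2 * deg e Y y + 2}.

Notation cfg := (config e Y Z s t).
Notation mcf := (mincfg e Y Z s t).
Notation fr := (free Y Z).
Notation rs := (rest Z s t).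

Lemma free_sub q c : fr q c \subset Y.
Proof. by apply/subsetP=> y /setDP[/setDP[]]. Qed.

Lemma dense_deg_free q c f : q < n -> mcf q c -> f \in fr q c -> 3 <= deg e (fr q c) f.
Proof.
move=> qn mc fF; have h1 := deg_free_lb se ZY ut mc fF.
have h2 := deg_card e (rs q) f; have h3 := card_rest ZY Hs Ht ut (ltnW qn).
have h4 := terminals_bound ZY Hs Ht ut.
have := deg3 (subsetP (free_sub q c) _ fF).
move: h1 h2 h3 h4 Zm qn; clear; lia.
Qed.

(** This is the swap that gives the blocked terminal [z] a free neighbour [w]. If no path offered
    it, the neighbours of [z] inside a path and those of [f] on it would number at most
    [size (c i) + 2], too few for two vertices with degrees as large as in [deg2]. *)
Lemma dense_exchange q c z f : q < n -> mcf q c -> z \in rs q ->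
  (forall y, y \in fr q c -> ~~ e z y) -> f \in fr q c ->
  exists i l1 u w v l3, [/\ i < q, whole s t c i = l1 ++ [:: u, w, v & l3], e f u, e f v & e z w].
Proof.
move=> qn mc zr nz fF; apply: NNPP => no.
have [cf _] := mc; have zZ : z \in Z by case/setDP: zr.
have bnd i : i < q -> count (e z) (c i) + count (e f) (whole s t c i) <= size (c i) + 2.
  move=> iq; have c3 := config_count se ZY ut mc iq fF.
  have sz := count_size (e z) (c i).
  case: (ltnP (count (e f) (whole s t c i)) 3) => [c2|c3'].
    by move: sz c2; clear; lia.
  have c3e : count (e f) (whole s t c i) = 3 by apply/eqP; rewrite eqn_leq c3.
  have [l1 [u [w [v [l3 [eqW fu fw fv]]]]]] := config_three se ZY ut mc iq fF c3e.
  have wc := endpoints_inside eqW.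
  have nzw : ~~ e z w.
    by apply/negP=> zw; apply: no; exists i, l1, u, w, v, l3.
  have := count_predC (e z) (c i).
  have : 0 < count (predC (e z)) (c i) by rewrite -has_count; apply/hasP; exists w.
  by rewrite c3e; clear; lia.
have sum : count (e z) (interiors q c) + \sum_(0 <= i < q) count (e f) (whole s t c i)
    <= size (interiors q c) + 2 * q.
  rewrite -(count_predT (interiors q c)) !count_interiors -big_split /=.
  have -> : 2 * q = \sum_(0 <= i < q) 2 by rewrite sum_nat_const_nat subn0 mulnC.
  rewrite -big_split /= big_nat [X in _ <= X]big_nat; apply: leq_sum => i /andP[_ iq].
  by rewrite count_predT; apply: bnd.
have h1 := deg_bound ZY ut f cf.
have h2 : deg e (rs q) f < #|rs q| by apply: (deg_lt zr); rewrite se nz.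
have h3 := card_rest ZY Hs Ht ut (ltnW qn).
have h4 := deg_self ie fF.
have h5 := card_free ZY ut cf.
have h6 : deg e Y z <= deg e (Y :\: Z) z + deg e Z z.
  apply: leq_trans (deg_setU _ _ _ _); apply: deg_sub; apply/subsetP=> y yY.
  by rewrite !inE yY andbT orNb.
have h7 := deg_interior z cf.
have h8 : deg e (fr q c) z = 0.
  by apply/eqP; rewrite cards_eq0 -subset0; apply/subsetP=> y; rewrite inE => /andP[/nz/negbTE->].
have h9 := deg_self ie zZ.
have h10 := deg2 (subsetP ZY _ zZ); have h11 := deg2 (subsetP (free_sub q c) _ fF).
move: sum h1 h2 h3 h4 h5 h6 h7 h8 h9 h10 h11 Zm.
by move: (\sum_(_ <= _ < _) _) => S; clear; lia.
Qed.

(** Each blocked terminal is repaired by one swap. The second repair must not consume the free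
    neighbour [b] obtained by the first, so the vertex given away is chosen different from [b]; the
    free degrees leave room for that. *)
Lemma dense_free_ends q : q < n -> (exists c, mcf q c) ->
  (forall c, mcf q c -> 0 < #|fr q c|) ->
  exists c a b, [/\ mcf q c, a \in fr q c, e (s q) a, b \in fr q c & e (t q) b].
Proof.
move=> qn exc Fpos; have [sr tr] := rest_end ZY Hs Ht ut (leqnn q) qn.
have step z c b : z \in rs q -> mcf q c -> exists c' a,
    [/\ mcf q c', a \in fr q c', e z a & b \in fr q c -> b \in fr q c'].
  move=> zr mc; case: (pickP [pred y in fr q c | e z y]) => [a /andP[aF za]|no].
    by exists c, a.
  have nz y : y \in fr q c -> ~~ e z y by move=> yF; have := no y; rewrite /= yF => /negbT.
  have [f fF fb] : exists2 f, f \in fr q c & f != b.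
    have /card_gt0P[f fF] := Fpos c mc.
    case: (eqVneq f b) => [_|ne]; last by exists f.
    case: (pickP [pred y in fr q c | y != b]) => [g /andP[gF gb]|none]; first by exists g.
    have := dense_deg_free qn mc fF; have : deg e (fr q c) f <= #|[set b]|.
      apply: subset_leq_card; apply/subsetP=> y; rewrite in_set => /andP[yF _].
      by rewrite inE; have := none y; rewrite /= yF => /negbFE.
    by rewrite cards1; clear; lia.
  have [i [l1 [u [w [v [l3 [iq eqW fu fv zw]]]]]]] := dense_exchange qn mc zr nz fF.
  have [_ _ [c' [mc' mem]]] := config_swap se ZY ut mc iq fF eqW fu fv.
  exists c', w; split=> //; first by rewrite mem eqxx.
  by move=> bF; rewrite mem bF [b == f]eq_sym fb orbT.
have [c0 mc0] := exc.
have [c1 [b [mc1 bF tb _]]] := step (t q) c0 (t q) tr mc0.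
have [c [a [mc aF sa /(_ bF) bF']]] := step (s q) c1 b sr mc1.
by exists c, a, b.
Qed.

(** A nonempty free set is carried through the induction because every swap needs a free vertex to
    give away. *)
Lemma dense_config q : 0 < m -> Y != set0 -> q <= n ->
  exists c, cfg q c /\ 0 < #|fr q c|.
Proof.
move=> m0 Yn; elim: q => [_|q IH qn].
  exists (fun=> [::]); split; first exact: config0.
  have := card_free ZY ut (config0 e Y Z s t).
  have /set0Pn[y yY] := Yn; have := deg3 yY; have := deg_card e Y y.
  by rewrite /interiors /=; move: Zm; clear; lia.
have [c0 [cf0 F0]] := IH (ltnW qn).
have exc : exists c, mcf q c by apply: config_min; exists c0.
have Fpos c : mcf q c -> 0 < #|fr q c|.
  move=> [cf minc]; have := minc _ cf0; have := card_free ZY ut cf; have := card_free ZY ut cf0.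
  by move: F0; clear; lia.
case: (classic (exists c, mcf q c /\ linkable e (fr q c) (s q) (t q))) => [[c [mc lc]]|no].
  have [c1 [gc u1 _ c3]] := linkable_short se lc.
  exists (upd c q c1); split; first exact: (config_extend ZY ut mc.1 gc u1).
  have /and3P[pth /allP cF c10] := gc.
  case: c1 gc u1 c3 pth cF c10 => // x c1 _ u1 c3 /= /andP[sx _] cF _.
  have xF : x \in fr q c by apply: cF; rewrite mem_head.
  (* If the new path exhausted the free set, its first vertex [x] would have at least three free
     neighbours on it and [s q] besides, more than a shortest path allows. *)
  rewrite lt0n cards_eq0; apply/eqP=> F0'.
  have sub : fr q c \subset [set y in x :: c1].
    apply/subsetP=> y yF; rewrite in_set; apply: contraT => nyc.
    have : y \in fr q.+1 (upd c q (x :: c1)).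
      move: yF; rewrite !in_setD !in_set interiorsS mem_cat (negbTE nyc) orbF.
      by [].
    by rewrite F0' inE.
  have := @deg_set_seq _ e _ x _ sub; have := c3 x xF; have := dense_deg_free qn mc xF.
  rewrite -cats1 /= count_cat [e x (s q)]se sx; clear; lia.
exfalso.
have nl c : mcf q c -> ~ linkable e (fr q c) (s q) (t q).
  by move=> mc lc; apply: no; exists c.
have [c [a [b [mc aA sa bB cnt]]]] := config_split se ZY ut qn nl (dense_free_ends qn exc Fpos).
have aF := subsetP (rch_sub _ _ _) _ aA; have bF := subsetP (rch_sub _ _ _) _ bB.
(* The count of [config_split] exempts [a], so a neighbour of [a] on the same side takes its
   place. *)
have [f fF af] : exists2 f, f \in fr q c & e a f.
  by apply: deg_gt0; have := dense_deg_free qn mc aF; clear; lia.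
have fA := rch_step aA fF af.
have fa : f != a by apply: contraTneq af => ->; rewrite ie.
have [h1 h2 h3 h4 h5] := nolink_facts se ZY Hs Ht ut qn mc (nl c mc) fA bB.
have sum : \sum_(0 <= i < q) count (e f) (whole s t c i) +
   \sum_(0 <= i < q) count (e b) (whole s t c i) <= size (interiors q c) + 4 * q.
  rewrite -big_split /= -(count_predT (interiors q c)) count_interiors.
  have -> : 4 * q = \sum_(0 <= i < q) 4 by rewrite sum_nat_const_nat subn0 mulnC.
  rewrite -big_split /= big_nat [X in _ <= X]big_nat; apply: leq_sum => i /andP[_ iq].
  apply: leq_trans (cnt i f b iq fA fa bB) _; rewrite count_predT leq_add2r geq_minl //.
have h6 := deg_bound ZY ut f mc.1; have h7 := deg_bound ZY ut b mc.1.
have h8 := deg_self ie fA; have h9 := deg_self ie bB.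
have h10 := card_rest ZY Hs Ht ut (ltnW qn); have h11 := card_free ZY ut mc.1.
have h12 := deg2 (subsetP (free_sub q c) _ fF); have h13 := deg2 (subsetP (free_sub q c) _ bF).
move: sum h1 h2 h3 h4 h5 h6 h7 h8 h9 h10 h11 h12 h13 Zm.
move: (\sum_(_ <= _ < _) count (e f) _) (\sum_(_ <= _ < _) count (e b) _) => S1 S2.
by clear; lia.
Qed.

End DenseConfig.

Lemma dense_lk m Y : 0 < m -> Y != set0 ->
  {in Y, forall y, 3 * m + 2 <= deg e Y y} ->
  {in Y, forall y, #|Y| + 2 * m <= 2 * deg e Y y + 2} ->
  forall Z, Z \subset Y -> #|Z| <= 2 * m -> lk e (Y :\: Z) Z.
Proof.
move=> m0 Yn d3 d2 Z ZY Zm; apply: (lk_of_config se) => n s t Hs Ht ut.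
by have [c [cf _]] := dense_config ZY Zm Hs Ht ut d3 d2 m0 Yn (leqnn n); exists c.
Qed.

End DenseLinking.

(** * Linking inside the closed neighbourhood of a vertex *)

Section Core.
Variables (T : finType) (e : rel T).
Hypotheses (se : symmetric e) (ie : irreflexive e).
Implicit Types (A B F W X Y Z : {set T}) (f g x y z w : T).

Section CoreConfig.
Variables (m : nat) (L Z : {set T}) (n : nat) (s t : nat -> T).
Hypothesis ZL : Z \subset L.
Hypothesis Zm : #|Z| <= 2 * m.
Hypothesis Lm : #|L| <= 12 * m + 1.
Hypothesis Hs : forall i, i < n -> s i \in Z.
Hypothesis Ht : forall i, i < n -> t i \in Z.
Hypothesis ut : uniq (terminals s t n).
Hypothesis degD : {in L :\: Z, forall f, 6 * m + 1 <= deg e L f}.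
Hypothesis degZ : {in Z, forall z, 4 * m + 2 <= deg e (L :\: Z) z}.
Hypothesis nocluster : forall Y, Y \subset L :\: Z -> Y != set0 ->
  {in Y, forall y, 3 * m + 2 <= deg e Y y} ->
  {in Y, forall y, #|Y| + 2 * m <= 2 * deg e Y y + 2} -> False.

Notation cfg := (config e L Z s t).
Notation mcf := (mincfg e L Z s t).
Notation fr := (free L Z).
Notation rs := (rest Z s t).

(** Since neither [A :\ a] nor [B] is a cluster, each contains a vertex with few neighbours on its
    own side. The degrees of these two in [L] would then add up to less than [2 (6 m + 1)]. *)
Lemma core_split q c a b : q < n -> q < m -> mcf q c ->
  ~ linkable e (fr q c) (s q) (t q) ->
  a \in rch e (fr q c) (s q) -> b \in rch e (fr q c) (t q) ->
  (forall i f g, i < q -> f \in rch e (fr q c) (s q) -> f != a ->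
      g \in rch e (fr q c) (t q) ->
      count (e f) (whole s t c i) + count (e g) (whole s t c i) <= minn (size (c i)) 2 + 4) ->
  False.
Proof.
move=> qn qm mc nl aA bB cnt; set A := rch _ _ (s q) in aA cnt; set B := rch _ _ (t q) in bB cnt.
have AF : A \subset fr q c by apply: rch_sub.
have BF : B \subset fr q c by apply: rch_sub.
have h0 := card_rest ZL Hs Ht ut (ltnW qn).
have degf f : f \in fr q c -> 6 * m + 1 <= deg e L f.
  by move=> /setDP[fD _]; apply: degD.
have [f0 f0F af0] : exists2 f, f \in fr q c & e a f.
  apply: deg_gt0; have := deg_free_lb se ZL ut mc (subsetP AF _ aA).
  have := degf a (subsetP AF _ aA); have := deg_card e (rs q) a.
  by move: Zm qm h0; clear; lia.
have f0a : f0 != a by apply: contraTneq af0 => ->; rewrite ie.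
have f0A : f0 \in A :\ a by rewrite in_setD1 f0a; apply: rch_step aA f0F af0.
have cA := cardsD1 a A; rewrite aA in cA.
have dA f : f \in A :\ a -> deg e A f <= deg e (A :\ a) f + 1.
  move=> fA; apply: leq_trans (_ : _ <= deg e (A :\ a) f + deg e [set a] f) _.
    by apply: leq_trans (deg_setU _ _ _ _); rewrite setUC setD1K.
  by rewrite leq_add2l; apply: leq_trans (deg_card _ _ _) _; rewrite cards1.
have low f : f \in A -> deg e L f <= deg e A f + #|rs q| - 1 + 3 * q.
  move=> fA; have [_ h1 _ h2 _] := nolink_facts se ZL Hs Ht ut qn mc nl fA bB.
  have := deg_free_lb se ZL ut mc (subsetP AF _ fA).
  by move: h1 h2; rewrite -/A; clear; lia.
have lowB g : g \in B -> deg e L g <= deg e B g + #|rs q| - 1 + 3 * q.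
  move=> gB; have [_ _ h1 _ h2] := nolink_facts se ZL Hs Ht ut qn mc nl aA gB.
  have := deg_free_lb se ZL ut mc (subsetP BF _ gB).
  by move: h1 h2; rewrite -/B; clear; lia.
have FD : fr q c \subset L :\: Z by apply: subsetDl.
have [f fA f2] : exists2 f, f \in A :\ a & 2 * deg e (A :\ a) f + 2 < #|A :\ a| + 2 * m.
  apply: NNPP => no; apply: (@nocluster (A :\ a)).
  - by apply: subset_trans FD; apply: subset_trans AF; apply: subD1set.
  - by apply/set0Pn; exists f0.
  - move=> f fA; have fA' : f \in A by case/setD1P: fA.
    have := dA f fA; have := low f fA'; have := degf f (subsetP AF _ fA').
    by move: Zm qm h0; clear; lia.
  - by move=> f fA; rewrite leqNgt; apply/negP=> lt; apply: no; exists f.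
have [g gB g2] : exists2 g, g \in B & 2 * deg e B g + 2 < #|B| + 2 * m.
  apply: NNPP => no; apply: (@nocluster B).
  - exact: subset_trans BF FD.
  - by apply/set0Pn; exists b.
  - move=> g gB; have := lowB g gB; have := degf g (subsetP BF _ gB).
    by move: Zm qm h0; clear; lia.
  - by move=> g gB; rewrite leqNgt; apply/negP=> lt; apply: no; exists g.
have /setD1P[fa fA'] := fA.
have [h1 h2 h3 h4 h5] := nolink_facts se ZL Hs Ht ut qn mc nl fA' gB.
have h6 := deg_bound ZL ut f mc.1; have h7 := deg_bound ZL ut g mc.1.
have h8 := card_free ZL ut mc.1; have h9 := dA f fA.
have h10 := degf f (subsetP AF _ fA'); have h11 := degf g (subsetP BF _ gB).
(* Twice [minn s 2 + 4] is at most [s + 10] for every [s >= 1]. For [s = 1] the plain count of three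
   neighbours for each vertex would give 12 instead of at most 11; this is what [config_split]
   gains. *)
have sum : 2 * (\sum_(0 <= i < q) count (e f) (whole s t c i) +
   \sum_(0 <= i < q) count (e g) (whole s t c i)) <= size (interiors q c) + 10 * q.
  rewrite -big_split /= -(count_predT (interiors q c)) count_interiors.
  have -> : 10 * q = \sum_(0 <= i < q) 10 by rewrite sum_nat_const_nat subn0 mulnC.
  rewrite -big_split /= big_distrr /= big_nat [X in _ <= X]big_nat.
  apply: leq_sum => i /andP[_ iq]; rewrite count_predT.
  apply: leq_trans (leq_mul (leqnn 2) (cnt i f g iq fA' fa gB)) _.
  by rewrite -[X in _ <= X]/(size (c i) + 10); have := interior_gt0 mc.1 iq; clear; lia.
move: sum h0 h1 h2 h3 h4 h5 h6 h7 h8 h9 h10 h11 cA f2 g2 Zm Lm qm; rewrite -/A -/B.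
move: (\sum_(_ <= _ < _) count (e f) _) (\sum_(_ <= _ < _) count (e g) _) => S1 S2.
by clear; lia.
Qed.

Lemma core_free_end q c z : mcf q c -> size (interiors q c) <= 4 * m + 1 -> z \in Z ->
  exists2 y, y \in fr q c & e z y.
Proof.
move=> mc sz zZ; apply: deg_gt0; have := deg_interior z mc.1; have := degZ zZ.
by have := count_size (e z) (interiors q c); move: sz; clear; lia.
Qed.

(** The bound [4 m + 1] on used vertices stays below the degree [4 m + 2] of a terminal into
    [L :\: Z], so every terminal keeps a free neighbour. The bound persists either because free
    vertices are so close that all paths are short, or because two distant ones force a large free
    set. *)
Lemma core_config q : q <= n -> exists c, cfg q c /\ (q < m -> size (interiors q c) <= 4 * m + 1).
Proof.
have nm := terminals_bound ZL Hs Ht ut.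
elim: q => [_|q IH qn].
  by exists (fun=> [::]); split; first exact: config0.
have [c0 [cf0 R0]] := IH (ltnW qn).
have qm : q < m by move: nm qn Zm; clear; lia.
have {}R0 := R0 qm.
have exc : exists c, mcf q c by apply: config_min; exists c0.
have R c : mcf q c -> size (interiors q c) <= 4 * m + 1.
  by move=> [_ minc]; apply: leq_trans (minc _ cf0) R0.
have ends c z : mcf q c -> z \in Z -> exists2 y, y \in fr q c & e z y.
  by move=> mc; apply: core_free_end mc (R c mc).
case: (classic (exists c, mcf q c /\ linkable e (fr q c) (s q) (t q))) => [[c [mc lc]]|no];
  last first.
  exfalso.
  have nl c : mcf q c -> ~ linkable e (fr q c) (s q) (t q).
    by move=> mc lc; apply: no; exists c.
  have [c1 mc1] := exc.
  have [a1 a1F sa1] := ends c1 (s q) mc1 (Hs qn); have [b1 b1F tb1] := ends c1 (t q) mc1 (Ht qn).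
  have [|c [a [b [mc aA sa bB cnt]]]] := config_split se ZL ut qn nl.
    by exists c1, a1, b1.
  exact: (core_split qn qm mc (nl c mc) aA bB cnt).
have [c1 [gc u1 minc1 c3]] := linkable_short se lc.
exists (upd c q c1); split; first exact: (config_extend ZL ut mc.1 gc u1).
move=> q1m; rewrite interiorsS size_cat.
set F := fr q c in lc gc c3 minc1 *.
have cR := card_rest ZL Hs Ht ut (ltnW qn); have cF := card_free ZL ut mc.1.
(* If free vertices are pairwise at distance at most two, every interior can be replaced by one of
   at most three vertices, so the new total is at most [3 (q + 1)]. *)
case: (classic (forall f g, f \in F -> g \in F ->
   [\/ f = g, e f g | exists2 h, h \in F & e f h && e h g])) => [close|far].
  have short z z' : z \in Z -> z' \in Z -> exists c', gpath e F z z' c' /\ size c' <= 3.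
    move=> zZ z'Z; have [f fF zf] := ends c z mc zZ; have [g gF zg] := ends c z' mc z'Z.
    case: (close f g fF gF) => [eqf|fg|[h hF /andP[fh hg]]].
    - exists [:: f]; split=> //; rewrite /gpath /= zf se eqf zg /= -eqf.
      by rewrite fF.
    - by exists [:: f; g]; split=> //; rewrite /gpath /= zf fg se zg fF gF.
    - by exists [:: f; h; g]; split=> //; rewrite /gpath /= zf fh hg se zg fF hF gF.
  have r3 : size c1 <= 3.
    have [c' [gc' sz]] := short (s q) (t q) (Hs qn) (Ht qn).
    exact: leq_trans (minc1 c' gc') sz.
  have ri i : i < q -> size (c i) <= 3.
    move=> iq; have iN : i < n by move: iq qn; clear; lia.
    have [c' [gc' sz]] := short (s i) (t i) (Hs iN) (Ht iN).
    have [c2 [gc2 u2 min2 _]] := linkable_short se (ex_intro _ c' gc').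
    have [cf' eqs] := config_replace mc.1 iq gc2 u2.
    by have := mc.2 _ cf'; have := min2 c' gc'; move: eqs sz; clear; lia.
  have : size (interiors q c) <= 3 * q.
    rewrite -(count_predT (interiors q c)) count_interiors.
    have -> : 3 * q = \sum_(0 <= i < q) 3 by rewrite sum_nat_const_nat subn0 mulnC.
    rewrite big_nat [X in _ <= X]big_nat; apply: leq_sum => i /andP[_ iq].
    by rewrite count_predT ri.
  by move: r3 qm q1m; clear; lia.
have [f [g [fF gF nfg]]] : exists f g, [/\ f \in F, g \in F &
    ~ [\/ f = g, e f g | exists2 h, h \in F & e f h && e h g]].
  apply: NNPP => no; apply: far => f g fF gF; apply: NNPP => nfg; apply: no.
  by exists f, g.
have lowF h : h \in F -> 6 * m + 1 <= deg e F h + #|rs q| + 3 * q.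
  move=> hF; apply: leq_trans (_ : _ <= deg e L h) _.
    by apply: degD; case/setDP: hF.
  apply: leq_trans (deg_free_lb se ZL ut mc hF) _.
  by rewrite leq_add2r leq_add2l deg_card.
have fgF : deg e F f + deg e F g + 2 <= #|F|.
  have gNf : g \notin [set y in F | e f y].
    by rewrite inE gF /=; apply/negP=> fg; apply: nfg; constructor 2.
  have fNg : f \notin [set y in F | e g y].
    by rewrite inE fF /=; apply/negP=> gf; apply: nfg; constructor 2; rewrite se.
  have fNf : f \notin [set y in F | e f y] by rewrite inE ie andbF.
  have gNg : g \notin [set y in F | e g y] by rewrite inE ie andbF.
  have cU : #|f |: [set y in F | e f y]| + #|g |: [set y in F | e g y]| <= #|F|.
    have I0 : (f |: [set y in F | e f y]) :&: (g |: [set y in F | e g y]) = set0.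
      apply/setP=> y; rewrite in_setI !in_setU1 in_set0; apply/negP=> /andP[].
      case: eqP => [-> _|_ /= yf]; case: eqP => [eqy|_ /= yg] //.
      - by move=> _; apply: nfg; constructor 1.
      - by rewrite (negbTE fNg) in yg.
      - by rewrite eqy (negbTE gNf) in yf.
      - move: yf; rewrite in_set => /andP[yF fy]; move: yg; rewrite in_set => /andP[_ gy].
        apply: nfg; constructor 3.
        by exists y => //; rewrite fy se.
    have := cardsUI (f |: [set y in F | e f y]) (g |: [set y in F | e g y]).
    rewrite I0 cards0 addn0 => <-; apply: subset_leq_card.
    apply/subsetP=> y; rewrite in_setU !in_setU1.
    by case/orP=> /orP[/eqP->//|]; rewrite in_set => /andP[].
  by move: cU; rewrite !cardsU1 fNf gNg /deg; clear; lia.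
(* Double counting: a free vertex has at most three neighbours on [c1], while each vertex of [c1]
   has many free neighbours. Nine such vertices would require more free vertices than [L] has room
   for. *)
have r8 : size c1 <= 8.
  rewrite leqNgt; apply/negP=> r9.
  have dbl : \sum_(x <- c1) deg e F x <= 3 * #|F|.
    apply: leq_trans (_ : \sum_(h in F) count (e h) c1 <= _).
      have -> : \sum_(x <- c1) deg e F x = \sum_(x <- c1) \sum_(h in F) e h x.
        apply: eq_bigr => x _; rewrite /deg -sum1_card big_mkcond [RHS]big_mkcond /=.
        by apply: eq_bigr => h _; rewrite inE se; case: (h \in F); case: (e h x).
      rewrite exchange_big /=; apply: leq_sum => h _.
      by rewrite -sum1_count [X in _ <= X]big_mkcond /=; apply: leq_sum => x _; case: (e h x).
    rewrite mulnC -sum_nat_const; apply: leq_sum => h hF.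
    apply: leq_trans (c3 h hF); rewrite -cats1 /= count_cat; clear; lia.
  have /and3P[_ /allP cF1 _] := gc.
  have lb : size c1 * (6 * m + 1 - #|rs q| - 3 * q) <= \sum_(x <- c1) deg e F x.
    rewrite -sum1_size big_distrl /= big_seq [X in _ <= X]big_seq; apply: leq_sum => x xc.
    by have := lowF x (cF1 x xc); clear; lia.
  have nine : 9 * (6 * m + 1 - #|rs q| - 3 * q) <= 3 * #|F|.
    apply: leq_trans dbl; apply: leq_trans lb; exact: leq_mul.
  have := size_interiors_ge mc.1; move: nine cR cF q1m Zm Lm; rewrite -/F; clear; lia.
(* By [fgF] the free set is so large that at most [4 m - 7] vertices were used before; eight more
   give [4 m + 1]. *)
have := lowF f fF; have := lowF g gF; move: fgF cR cF r8 q1m Zm Lm; rewrite -/F; clear; lia.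
Qed.

End CoreConfig.

(** Either [L] itself links everything required, or for some bad [Z] the construction of
    [core_config] must fail. It fails only if [L :\: Z] contains a cluster with degrees at least
    half of its order, and such a cluster links all its small subsets by [dense_lk]. *)
Theorem dense_core m (L X : {set T}) : 0 < m -> #|L| <= 12 * m + 1 -> X \subset L -> #|X| <= 2 * m ->
  L :\: X != set0 ->
  {in L :\: X, forall w, 6 * m + 1 <= deg e L w} ->
  {in X, forall x, 6 * m + 2 <= deg e (L :\: X) x + #|X|} ->
  exists Y, [/\ Y \subset L, 2 * m < #|Y| &
    forall Z, Z \subset Y -> #|Z| <= 2 * m -> X :&: Y \subset Z -> lk e (Y :\: Z) Z].
Proof.
move=> m0 Lm XL Xm LX degL degX.
case: (classic (forall Z, Z \subset L -> #|Z| <= 2 * m -> X :&: L \subset Z ->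
    lk e (L :\: Z) Z)) => [allZ|no].
  exists L; split=> //; have /set0Pn[w wL] := LX.
  by have := degL w wL; have := deg_card e L w; clear; lia.
apply: NNPP => nY; apply: no => Z ZL Zm; rewrite (setIidPl XL) => XZ.
apply: (lk_of_config se) => n s t Hs Ht ut.
have degD : {in L :\: Z, forall f, 6 * m + 1 <= deg e L f}.
  by move=> f /setDP[fL fZ]; apply: degL; rewrite inE fL (contra (subsetP XZ _) fZ).
have splitD W x : deg e W x <= deg e (W :\: Z) x + deg e (W :&: Z) x.
  by apply: leq_trans (deg_setU _ _ _ _); rewrite setUC setID.
have degZ : {in Z, forall z, 4 * m + 2 <= deg e (L :\: Z) z}.
  move=> z zZ; case: (boolP (z \in X)) => zX.
    have h1 := degX z zX; have h2 := splitD (L :\: X) z.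
    have h3 : deg e ((L :\: X) :\: Z) z <= deg e (L :\: Z) z.
      by apply: deg_sub; apply: setSD; apply: subsetDl.
    have h4 : deg e ((L :\: X) :&: Z) z <= #|Z| - #|X|.
      apply: leq_trans (deg_card _ _ _) _; rewrite -cardsDS //; apply: subset_leq_card.
      by apply/subsetP=> y /setIP[/setDP[_ yX] yZ]; rewrite inE yX.
    have := subset_leq_card XZ; move: h1 h2 h3 h4 Zm; clear; lia.
  have zL : z \in L :\: X by rewrite inE zX (subsetP ZL).
  have h1 := degL z zL; have h2 := splitD L z.
  have h3 : deg e (L :&: Z) z < #|Z|.
    by apply: leq_ltn_trans (deg_self ie zZ); apply: deg_sub; apply: subsetIr.
  by move: h1 h2 h3 Zm; clear; lia.
have nocl Y : Y \subset L :\: Z -> Y != set0 ->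
    {in Y, forall y, 3 * m + 2 <= deg e Y y} ->
    {in Y, forall y, #|Y| + 2 * m <= 2 * deg e Y y + 2} -> False.
  move=> YD Yn d3 d2; apply: nY; exists Y; split.
  - exact: subset_trans YD (subsetDl _ _).
  - by have /set0Pn[y yY] := Yn; have := d3 y yY; have := deg_card e Y y; clear; lia.
  - by move=> Z' Z'Y Z'm _; apply: (dense_lk se ie m0 Yn d3 d2).
by have [c [cf _]] := core_config ZL Zm Lm Hs Ht ut degD degZ nocl (leqnn n); exists c.
Qed.

End Core.

(** * Massed graphs *)

Section Lifting.
Variable T : finType.
Implicit Types (e : rel T) (A B C D E V W X Y Z : {set T}) (u v x y z : T).

Definition clique_add e C x y := e x y || [&& x != y, x \in C & y \in C].

Lemma clique_add_sym e C : symmetric e -> symmetric (clique_add e C).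
Proof. by move=> se x y; rewrite /clique_add se eq_sym [(x \in C) && _]andbC. Qed.

Lemma clique_add_irr e C : irreflexive e -> irreflexive (clique_add e C).
Proof. by move=> ie x; rewrite /clique_add ie eqxx. Qed.

(** Describes how far a link can be followed from its terminal by original edges; [a = s] occurs
    when the terminal itself lies in the added clique. *)
Definition half e W s a := a = s \/ a \in rch e W s.

Lemma half_start e W E s a x : half e W s a -> e a x -> x \in E ->
  exists2 y, y \in W :|: E /\ e s y & conn e (W :|: E) y x.
Proof.
move=> [->|ar] ax xE.
  by exists x; [rewrite inE xE orbT|exact: conn_refl].
move: ar; rewrite inE => /andP[aW /existsP[y /and3P[yW sy cya]]].
exists y; first by rewrite inE yW.
apply: (@conn_trans _ _ _ a); first by apply: conn_mono cya => //; apply: subsetUl.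
by apply: conn1; rewrite ?inE ?aW ?xE ?orbT.
Qed.

Lemma joins_glue e W E s t a b : symmetric e ->
  half e W s a -> half e W t b -> joins e E a b -> joins e (W :|: E) s t.
Proof.
move=> se hs ht [x [y [xE yE ax byy cxy]]].
have [x' [x'W sx'] cx] := half_start hs ax xE; have [y' [y'W ty'] cy] := half_start ht byy yE.
exists x', y'; split=> //; apply: conn_trans cx _; apply: (@conn_trans _ _ _ y).
  by apply: conn_mono cxy => //; apply: subsetUr.
by rewrite conn_sym.
Qed.

Lemma rch_joins e W s t y : symmetric e -> y \in rch e W s -> y \in rch e W t -> joins e W s t.
Proof.
move=> se; rewrite !inE => /andP[yW /existsP[x /and3P[xW sx cxy]]].
move=> /andP[_ /existsP[x' /and3P[x'W tx' cxy']]].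
by exists x, x'; split=> //; apply: conn_trans cxy _; rewrite conn_sym.
Qed.

(** An added edge has both ends in [C], so following original edges from [s] either completes the
    link or meets [C]. *)
Lemma joins_half e C W s t : symmetric e -> joins (clique_add e C) W s t ->
  joins e W s t \/ exists2 a, a \in C & half e W s a.
Proof.
move=> se [x [y [xW yW sx ty cxy]]].
case: (classic (exists2 a, a \in C & half e W s a)) => [?|no]; [by right|left].
have noC a : half e W s a -> a \notin C by move=> ha; apply/negP=> aC; apply: no; exists a.
have real a b : half e W s a -> clique_add e C a b -> e a b.
  by move=> /noC naC; rewrite /clique_add (negbTE naC) andbF orbF.
have xR : x \in rch e W s by apply: rch_nbr => //; apply: (real _ _ (or_introl erefl) sx).
have yR : y \in rch e W s.
  case/connectP: cxy => p pth ->; elim: p x xR {xW sx} pth => //= z p IH x xR.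
  move=> /andP[/and3P[xz _ zW] pth]; have ez := real _ _ (or_intror xR) xz.
  by apply: IH pth; apply: rch_step zW ez.
apply: (rch_joins se yR); apply: rch_nbr => //.
by rewrite se; apply: (real _ _ (or_intror yR)); rewrite clique_add_sym.
Qed.

(** Only links that depend on added edges need repair. Each of them has an entry and an exit in [C],
    which differ since otherwise the link would be genuine already. The resulting pairs are disjoint
    because the links are, and one linkage of [C] in [D'] joins them all. *)
Lemma clique_lift e C D D' Z : symmetric e -> [disjoint D & D'] -> [disjoint Z & D] ->
  lk (clique_add e C) D Z -> lk e D' C -> lk e (D :|: D') Z.
Proof.
move=> se dD dZ L L' I s t sZ tZ is_ it_ st.
have ZD z : z \in Z -> z \in D -> False.
  by move=> zZ; move: dZ; rewrite disjoint_subset => /subsetP/(_ z zZ)/negP.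
have [W [WD dW jW]] := L I s t sZ tZ is_ it_ st.
pose bad i := if excluded_middle_informative (joins e (W i) (s i) (t i)) then false else true.
have good i : ~~ bad i -> joins e (W i) (s i) (t i).
  by rewrite /bad; case: excluded_middle_informative.
have nW z i : z \in Z -> z \notin W i.
  by move=> zZ; apply/negP=> /(subsetP (WD i)); apply: ZD.
have [ab Hab] : exists ab : I -> T * T, forall i, bad i ->
    [/\ (ab i).1 \in C, (ab i).2 \in C, (ab i).1 != (ab i).2,
        half e (W i) (s i) (ab i).1 & half e (W i) (t i) (ab i).2].
  apply: (fin_all_exists (P := fun i (ab : T * T) => bad i ->
    [/\ ab.1 \in C, ab.2 \in C, ab.1 != ab.2,
        half e (W i) (s i) ab.1 & half e (W i) (t i) ab.2])) => i.
  case: (boolP (bad i)) => [bi|_]; last by exists (s i, t i).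
  have nj : ~ joins e (W i) (s i) (t i).
    by move: bi; rewrite /bad; case: excluded_middle_informative.
  have [//|[a aC ha]] := joins_half se (jW i).
  have sc := clique_add_sym C se.
  have [/(joins_sym se)//|[b bC hb]] := joins_half se (joins_sym sc (jW i)).
  exists (a, b) => _; split=> //=; apply/eqP=> eab; apply: nj; subst b.
  case: ha => [ha|ha]; case: hb => [hb|hb].
  - by have := st i i; rewrite -ha -hb eqxx.
  - have := nW _ i (sZ i); rewrite -ha => /negP[]; exact: (subsetP (rch_sub _ _ _) _ hb).
  - have := nW _ i (tZ i); rewrite -hb => /negP[]; exact: (subsetP (rch_sub _ _ _) _ ha).
  - exact: rch_joins ha hb.
have near i z zz : z \in Z -> half e (W i) z zz -> zz = z \/ zz \in W i.
  by move=> zZ [->|h]; [left|right; exact: (subsetP (rch_sub _ _ _) _ h)].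
have sep i j z z' a : i != j -> z \in Z -> z' \in Z -> z != z' ->
    half e (W i) z a -> half e (W j) z' a -> False.
  move=> ij zZ z'Z zz' /(near _ _ _ zZ) h /(near _ _ _ z'Z) h'.
  case: h h' => [->|aW] [eqa|aW'].
  - by rewrite eqa eqxx in zz'.
  - by have := nW z j zZ; rewrite aW'.
  - by have := nW z' i z'Z; rewrite -eqa aW.
  - by have := dW i j ij; rewrite disjoint_subset => /subsetP/(_ a aW); rewrite inE aW'.
have [|||||E [ED dE jE]] := L' {i : I | bad i} (fun j => (ab (val j)).1) (fun j => (ab (val j)).2).
- by move=> j; have [] := Hab _ (valP j).
- by move=> j; have [] := Hab _ (valP j).
- move=> j j' eqj; apply/val_inj/eqP; apply: contraT => ne.
  have [_ _ _ h _] := Hab _ (valP j); have [_ _ _ h' _] := Hab _ (valP j').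
  exfalso; rewrite eqj in h; apply: (sep _ _ _ _ _ ne _ _ _ h h') => //.
  by apply: contra_neq ne => /is_.
- move=> j j' eqj; apply/val_inj/eqP; apply: contraT => ne.
  have [_ _ _ _ h] := Hab _ (valP j); have [_ _ _ _ h'] := Hab _ (valP j').
  exfalso; rewrite eqj in h; apply: (sep _ _ _ _ _ ne _ _ _ h h') => //.
  by apply: contra_neq ne => /it_.
- move=> j j'; apply/eqP=> eqj; have [_ _ n1 h _] := Hab _ (valP j).
  have [_ _ _ _ h'] := Hab _ (valP j').
  case: (eqVneq (val j) (val j')) => [eqv|ne].
    by move: n1; rewrite eqj eqv eqxx.
  by rewrite eqj in h; apply: (sep _ _ _ _ _ ne _ _ _ h h').
pose EE i := if @idP (bad i) is ReflectT b then E (exist _ i b) else set0.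
have EED i : EE i \subset D' by rewrite /EE; case: {-}_ / idP => // *; rewrite sub0set.
exists (fun i => W i :|: EE i); split.
- by move=> i; apply: setUSS.
- move=> i j ij; rewrite -setI_eq0; apply/eqP/setP=> z; rewrite !inE.
  have DD y : y \in D -> y \in D' -> False.
    by move=> yD; move: dD; rewrite disjoint_subset => /subsetP/(_ y yD)/negP.
  apply/negP=> /andP[/orP[zi|zi] /orP[zj|zj]].
  + by have := dW i j ij; rewrite disjoint_subset => /subsetP/(_ z zi); rewrite inE zj.
  + exact: (DD z (subsetP (WD i) _ zi) (subsetP (EED j) _ zj)).
  + exact: (DD z (subsetP (WD j) _ zj) (subsetP (EED i) _ zi)).
  + move: zi zj; rewrite /EE; case: {-}_ / idP => [bi|]; last by rewrite inE.
    case: {-}_ / idP => [bj|]; last by rewrite inE.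
    move=> zi zj; have nij : exist _ i bi != exist _ j bj :> {i : I | bad i} by [].
    by have := dE _ _ nij; rewrite disjoint_subset => /subsetP/(_ z zi); rewrite inE zj.
- move=> i; rewrite /EE; case: {-}_ / idP => [bi|/negP/good]; last by rewrite setU0.
  have [_ _ _ h h'] := Hab i bi; exact: (joins_glue se h h' (jE (exist _ i bi))).
Qed.

(** The neighbours of [v] are handed to [u], while [v] keeps its own edges; it is discarded by
    leaving it out of the vertex set. *)
Definition contract e u v x y :=
  (x != y) && [|| e x y, (x == u) && e v y | (y == u) && e x v].

Lemma contract_sym e u v : symmetric e -> symmetric (contract e u v).
Proof.
move=> se x y; rewrite /contract eq_sym se [e x v]se [e y v]se; congr (_ && (_ || _)).
by rewrite orbC.
Qed.

Lemma contract_irr e u v : irreflexive (contract e u v).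
Proof. by move=> x; rewrite /contract eqxx. Qed.

Lemma contract_away e u v x y : x != u -> y != u -> contract e u v x y -> e x y.
Proof. by move=> /negbTE xu /negbTE yu; rewrite /contract xu yu /= !orbF => /andP[]. Qed.

(** Links and terminals are disjoint, so at most one link involves [u]. It receives [v], and every
    contracted edge is replaced by a passage through [v]. *)
Lemma contract_lift e u v D Z : symmetric e -> e u v -> v \notin D -> v \notin Z ->
  [disjoint Z & D] -> lk (contract e u v) D Z -> lk e (v |: D) Z.
Proof.
move=> se uv vD vZ dZ L I s t sZ tZ is_ it_ st.
have [W [WD dW jW]] := L I s t sZ tZ is_ it_ st.
have ZW z i : z \in Z -> z \notin W i.
  move=> zZ; apply/negP=> /(subsetP (WD i)) zD.
  by move: dZ; rewrite disjoint_subset => /subsetP/(_ z zZ); rewrite inE zD.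
pose touch i := [|| u \in W i, s i == u | t i == u].
have touch1 i j : touch i -> touch j -> i = j.
  move=> ti tj; apply/eqP; apply: contraT => ij; exfalso.
  have d z : z \in W i -> z \in W j -> False.
    by move=> zi; have := dW i j ij; rewrite disjoint_subset => /subsetP/(_ z zi)/negP.
  case/or3P: ti => [ui|/eqP si|/eqP ti]; case/or3P: tj => [uj|/eqP sj|/eqP tj].
  - exact: d ui uj.
  - by have := ZW _ i (sZ j); rewrite sj ui.
  - by have := ZW _ i (tZ j); rewrite tj ui.
  - by have := ZW _ j (sZ i); rewrite si uj.
  - by move/eqP: ij; apply; apply: is_; rewrite si sj.
  - by have := st i j; rewrite si tj eqxx.
  - by have := ZW _ j (tZ i); rewrite ti uj.
  - by have := st j i; rewrite sj ti eqxx.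
  - by move/eqP: ij; apply; apply: it_; rewrite ti tj.
exists (fun i => W i :|: (if touch i then [set v] else set0)); split.
- move=> i; rewrite setUC; apply: setUSS => //; by case: (touch i); rewrite ?sub0set.
- move=> i j ij; rewrite -setI_eq0; apply/eqP/setP=> z; rewrite !inE.
  have vW k : v \notin W k by apply: contra vD => /(subsetP (WD k)).
  apply/negP=> /andP[/orP[zi|zi] /orP[zj|zj]].
  + by have := dW i j ij; rewrite disjoint_subset => /subsetP/(_ z zi); rewrite inE zj.
  + by move: zj; case: (touch j); rewrite !inE // => /eqP zv; have := vW i; rewrite -zv zi.
  + by move: zi; case: (touch i); rewrite !inE // => /eqP zv; have := vW j; rewrite -zv zj.
  + move: zi zj; case: (boolP (touch i)) => ti; last by rewrite inE.
    case: (boolP (touch j)) => tj; last by rewrite !inE.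
    by move: ij; rewrite (touch1 i j ti tj) eqxx.
move=> i; set WW := _ :|: _.
have sW : W i \subset WW by apply: subsetUl.
have vWW : touch i -> v \in WW by rewrite /WW => ->; rewrite !inE eqxx orbT.
have start z x : z = s i \/ z = t i -> x \in W i -> contract e u v z x ->
    exists2 y, y \in WW /\ e z y & conn e WW y x.
  move=> zst xW; have xWW := subsetP sW _ xW; have zZ : z \in Z by case: zst => ->.
  rewrite /contract => /andP[_ /or3P[zx|/andP[/eqP zu vx]|/andP[/eqP xu zv]]].
  - by exists x => //; exact: conn_refl.
  - have ti : touch i by rewrite /touch -zu; case: zst => ->; rewrite eqxx ?orbT.
    by exists v; [rewrite vWW // zu|apply: conn1; rewrite ?vWW].
  - have ti : touch i by rewrite /touch -xu xW.
    exists v; first by rewrite vWW.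
    by apply: conn1 => //; [rewrite se xu|exact: vWW].
have [x [y [xW yW sx ty cxy]]] := jW i.
have [x' [x'W sx'] cx] := start (s i) x (or_introl erefl) xW sx.
have [y' [y'W ty'] cy] := start (t i) y (or_intror erefl) yW ty.
exists x', y'; split=> //; apply: conn_trans cx _; apply: (@conn_trans _ _ _ y).
  apply: conn_sub cxy => a b /andP[_ ab] aW bW.
  have aWW := subsetP sW _ aW; have bWW := subsetP sW _ bW.
  case/or3P: ab => [ab|/andP[/eqP au vb]|/andP[/eqP bu av]]; first exact: conn1.
    have vW : v \in WW by apply: vWW; rewrite /touch -au aW.
    by apply: (@conn_trans _ _ _ v); apply: conn1; rewrite // au.
  have vW : v \in WW by apply: vWW; rewrite /touch -bu bW.
  by apply: (@conn_trans _ _ _ v); apply: conn1; rewrite // bu se.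
by rewrite conn_sym.
Qed.

End Lifting.

Section Massed.
Variable T : finType.
Implicit Types (e : rel T) (A B C D E V W X Y Z : {set T}) (u v w x y z : T).

(* Counts ordered pairs, hence twice the number of edges of V with an end in Y. *)
Definition rho e V Y :=
  #|[set p : T * T | [&& e p.1 p.2, p.1 \in V, p.2 \in V & (p.1 \in Y) || (p.2 \in Y)]]|.

Lemma rho_le e e' V V' Y Y' :
  (forall x y, e x y -> x \in V -> y \in V -> (x \in Y) || (y \in Y) ->
     [&& e' x y, x \in V', y \in V' & (x \in Y') || (y \in Y')]) ->
  rho e V Y <= rho e' V' Y'.
Proof.
move=> H; apply: subset_leq_card; apply/subsetP=> -[x y]; rewrite !inE /=.
by move=> /and4P[exy xV yV xY]; apply: H.
Qed.

Lemma sepnW e V A B : sepn e V A B ->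
  [/\ A \subset V, B \subset V & forall x, x \in V -> x \notin A -> x \in B].
Proof.
move=> [<- _]; split; [exact: subsetUl|exact: subsetUr|].
by move=> x; rewrite inE => /orP[->|].
Qed.

Lemma sepn_no e V A B x y : sepn e V A B ->
  x \in A -> x \notin B -> y \in B -> y \notin A -> e x y -> False.
Proof.
by move=> [_ no] xA xB yB yA xy; have := no x y; rewrite !inE xA xB yA yB xy => /(_ isT isT).
Qed.

Lemma sepn_edge e V A B x y : symmetric e -> sepn e V A B ->
  x \in B :\: A -> y \in V -> e x y -> y \in B.
Proof.
move=> se [eqV no] xBA yV xy; apply: contraT => yB.
have yA : y \in A by move: yV; rewrite -eqV inE (negbTE yB) orbF.
by have := no y x; rewrite se xy !inE yB yA /= => /(_ isT); apply; move: xBA; rewrite inE.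
Qed.

Lemma rho_sep e V A B : symmetric e -> sepn e V A B -> rho e V (B :\: A) = rho e B (B :\: A).
Proof.
move=> se S; have [AV BV _] := sepnW S; apply/eqP; rewrite eqn_leq; apply/andP; split.
  apply: rho_le => x y xy xV yV H; rewrite xy H andbT /=.
  case/orP: H => [xB|yB]; first by rewrite (sepn_edge se S xB yV xy); case/setDP: xB => ->.
  by rewrite andbC (sepn_edge se S yB xV) 1?se //; case/setDP: yB => ->.
by apply: rho_le => x y -> /(subsetP BV)-> /(subsetP BV)->.
Qed.

Lemma rho_split e V A B X : symmetric e -> sepn e V A B -> X \subset A ->
  rho e V (V :\: X) <= rho e A (A :\: X) + rho e V (B :\: A).
Proof.
move=> se S XA; have [AV BV VAB] := sepnW S.
apply: leq_trans (leq_card_setU _ _); apply: subset_leq_card; apply/subsetP=> -[x y].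
rewrite !inE /= => /and4P[-> xV yV]; rewrite xV yV /= andbT.
case: (boolP (x \in A)) => xA; last by rewrite (VAB x xV xA) orbT.
case: (boolP (y \in A)) => yA; last by rewrite (VAB y yV yA) !orbT.
by rewrite !andbT => ->.
Qed.

Lemma sepn_glue e V A B A2 B2 : sepn e V A B -> sepn e B A2 B2 -> A :&: B \subset A2 ->
  [/\ sepn e V (A :|: A2) B2, (A :|: A2) :&: B2 = A2 :&: B2 & B2 :\: (A :|: A2) = B2 :\: A2].
Proof.
move=> [eqV no] S2 sub; have [A2B B2B BAB] := sepnW S2; have [eqB no2] := S2.
have key z : z \in A -> z \in B -> z \in A2.
  by move=> zA zB; apply: (subsetP sub); rewrite inE zA.
split.
- split; first by rewrite -setUA eqB.
  move=> x y /setDP[xAA xB2] /setDP[yB2]; rewrite inE negb_or => /andP[yA yA2].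
  have yB := subsetP B2B _ yB2.
  case: (boolP (x \in A2)) => xA2; first by apply: no2; rewrite inE ?xB2 ?xA2 ?yB2 ?yA2.
  have xA : x \in A by move: xAA; rewrite inE (negbTE xA2) orbF.
  apply: no; rewrite inE ?xA ?yA ?yB ?andbT //.
  by apply: contra xA2; apply: key.
- apply/setP=> z; rewrite !inE; case: (boolP (z \in B2)) => zB2; rewrite ?andbF ?andbT //.
  by case: (boolP (z \in A)) => //= zA; rewrite (key z zA (subsetP B2B _ zB2)).
- apply/setP=> z; rewrite !inE; case: (boolP (z \in B2)) => zB2; rewrite ?andbF ?andbT //.
  by case: (boolP (z \in A)) => //= zA; rewrite (key z zA (subsetP B2B _ zB2)).
Qed.

(** The last clause forbids the excess of edges to sit behind a separation too small to be reached
    from all of [X]. *)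
Definition massed c e V X := [/\ X \subset V, c * #|V :\: X| < rho e V (V :\: X) &
  forall A B, sepn e V A B -> X \subset A -> #|A :&: B| < #|X| ->
    rho e V (B :\: A) <= c * #|B :\: A|].

Lemma setDIr_self A B : B :\: (A :&: B) = B :\: A.
Proof. by apply/setP=> z; rewrite !inE; case: (z \in A); case: (z \in B). Qed.

Lemma sub_massed c e V A B : symmetric e -> sepn e V A B ->
  c * #|B :\: A| < rho e V (B :\: A) ->
  (forall A' B', sepn e V A' B' -> A \subset A' -> B' \subset B -> #|A' :&: B'| < #|A :&: B| ->
     rho e V (B' :\: A') <= c * #|B' :\: A'|) ->
  massed c e B (A :&: B).
Proof.
move=> se S M1 H; split; first exact: subsetIr.
  by rewrite setDIr_self -(rho_sep se S).
move=> A2 B2 S2 sub lt; have [S3 eqI eqD] := sepn_glue S S2 sub.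
rewrite (rho_sep se S2) -eqD -(rho_sep se S3); apply: H => //.
- exact: subsetUl.
- by have [] := sepnW S2.
- by rewrite eqI.
Qed.

(** A violating separation with smallest far side: a violation inside [B1] would extend to one of
    [V] with a smaller far side, so [B1] is massed with respect to the separator. *)
Lemma violator c e V X A B : symmetric e -> sepn e V A B -> X \subset A -> #|A :&: B| < #|X| ->
  c * #|B :\: A| < rho e V (B :\: A) ->
  exists A1 B1, [/\ sepn e V A1 B1, X \subset A1, #|A1 :&: B1| < #|X|,
    c * #|B1 :\: A1| < rho e V (B1 :\: A1) & massed c e B1 (A1 :&: B1)].
Proof.
move=> se S XA ltX big.
pose P (p : {set T} * {set T}) := [/\ sepn e V p.1 p.2, X \subset p.1, #|p.1 :&: p.2| < #|X| &
  c * #|p.2 :\: p.1| < rho e V (p.2 :\: p.1)].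
have [|[A1 B1] [[/= S1 XA1 lt1 big1] minB]] := @ex_argmin _ P (fun p => #|p.2|).
  by exists (A, B).
exists A1, B1; split=> //; apply: (sub_massed se S1 big1) => A' B' S' AA' BB' lt'.
rewrite leqNgt; apply/negP=> big'.
have /minB /= le : P (A', B').
  by split=> //=; [exact: subset_trans AA'|exact: ltn_trans lt1].
have eqB : B' = B1 by apply/eqP; rewrite eqEcard BB'.
by move: lt'; rewrite eqB ltnNge => /negP[]; apply: subset_leq_card; apply: setSI.
Qed.

Section Counterexample.
Variables (m : nat) (e : rel T) (V X : {set T}).
Hypotheses (se : symmetric e) (ie : irreflexive e).
Hypothesis M : massed (12 * m) e V X.
Hypothesis Xm : #|X| <= 2 * m.
Hypothesis nl : ~ lk e (V :\: X) X.
Hypothesis IH : forall (V' : {set T}) (e' : rel T) (X' : {set T}), #|V'| < #|V| ->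
  symmetric e' -> irreflexive e' -> massed (12 * m) e' V' X' -> #|X'| <= 2 * m ->
  lk e' (V' :\: X') X'.

(* If (G[B], A \cap B) were linked, then replacing B by a clique on A \cap B would give
   a smaller massed graph, or a separation with a smaller first side. *)
Lemma no_rigid A B : sepn e V A B -> X \subset A -> #|A :&: B| <= #|X| ->
  B :\: A != set0 -> lk e (B :\: A) (A :&: B) -> False.
Proof.
have [n] := ubnP #|A|; elim: n A B => // n IHn A B ltA S XA leX nz L.
have [AV BV VAB] := sepnW S; have [XV M1 M2] := M.
have AsV : #|A| < #|V|.
  apply: proper_card; apply/properP; split=> //; have /set0Pn[z /setDP[zB zA]] := nz.
  by exists z => //; apply: (subsetP BV).
have BAV : B :\: A \subset V :\: X.
  apply/subsetP=> z /setDP[zB zA]; rewrite inE (subsetP BV) // andbT.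
  by apply: contra zA; apply: (subsetP XA).
have AXV : A :\: X \subset V :\: X by apply: setSD.
(* If the separator is as large as [X], either [X] is routed onto it inside [A] and then linked
   through [B], or a smallest separation of [A] between the two makes [A2 :|: B] a linked far side
   with smaller near side [A1]. *)
case: (ltnP #|A :&: B| #|X|) => [ltX|geX]; last first.
  case: (classic (forall A1 A2, sepn e A A1 A2 -> X \subset A1 -> A :&: B \subset A2 ->
      #|X| <= #|A1 :&: A2|)) => [|no].
    move/(menger XA (subsetIl A B)) => [W [phi R]]; apply: nl.
    have dW : {in X, forall x, [disjoint W x & B :\: A]}.
      move=> x xX; have [/(_ x xX)[_ WA _ _] _] := R.
      rewrite disjoint_subset; apply/subsetP=> z /(subsetP WA) zA.
      by rewrite !inE zA.
    have sphi : phi @: X \subset A :&: B.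
      apply/subsetP=> _ /imsetP[x xX ->]; have [/(_ x xX)[_ _ eqW _] _] := R.
      by have /setIP[] : phi x \in W x :&: (A :&: B) by rewrite eqW inE.
    have := routes_lk se R dW (lk_mono (fun _ _ h => h) (subxx _) sphi L).
    by apply: lk_mono => //; rewrite subUset BAV.
  pose P (p : {set T} * {set T}) := [/\ sepn e A p.1 p.2, X \subset p.1 & A :&: B \subset p.2].
  have exP : exists p, P p /\ #|p.1 :&: p.2| < #|X|.
    apply: NNPP => none; apply: no => A1 A2 S12 XA1 AB2; rewrite leqNgt; apply/negP=> lt.
    by apply: none; exists (A1, A2).
  have [p0 [Pp0 lt0]] := exP.
  have [|[A1 A2] [[/= S12 XA1 AB2] minA]] := @ex_argmin _ P (fun p => #|p.1 :&: p.2|).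
    by exists p0.
  have lt : #|A1 :&: A2| < #|X| by apply: leq_ltn_trans (minA _ Pp0) lt0.
  have [A1A A2A AA12] := sepnW S12; have [eqA no12] := S12.
  have [|W [phi R]] := menger (subsetIr A1 A2) AB2 (e := e).
    move=> B1 B2 SB sub1 sub2; have [S3 eqI _] := sepn_glue S12 SB sub1.
    have := minA (A1 :|: B1, B2); rewrite /= eqI; apply; split=> //=.
    exact: subset_trans XA1 (subsetUl _ _).
  have dW : {in A1 :&: A2, forall x, [disjoint W x & B :\: A]}.
    move=> x xX; have [/(_ x xX)[_ WA _ _] _] := R.
    rewrite disjoint_subset; apply/subsetP=> z /(subsetP WA)/(subsetP A2A) zA.
    by rewrite !inE zA.
  have sphi : phi @: (A1 :&: A2) \subset A :&: B.
    apply/subsetP=> _ /imsetP[x xX ->]; have [/(_ x xX)[_ _ eqW _] _] := R.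
    by have /setIP[] : phi x \in W x :&: (A :&: B) by rewrite eqW inE.
  have L' := routes_lk se R dW (lk_mono (fun _ _ h => h) (subxx _) sphi L).
  have [_ noS] := S.
  have eqI : A1 :&: (A2 :|: B) = A1 :&: A2.
    apply/setP=> z; rewrite !inE; case: (boolP (z \in A1)) => //= zA1.
    case: (boolP (z \in B)) => zB; rewrite ?orbF ?orbT //; symmetry.
    by apply: (subsetP AB2); rewrite inE zB (subsetP A1A).
  apply: (IHn A1 (A2 :|: B)).
  - rewrite ltnS in ltA; apply: leq_trans ltA; apply: proper_card; apply/properP; split=> //.
    have /subsetPn[z zAB zA1] : ~~ (A :&: B \subset A1).
      apply/negP=> sub; move: lt; rewrite ltnNge => /negP[]; apply: leq_trans geX _.
      by apply: subset_leq_card; rewrite subsetI sub.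
    by exists z => //; case/setIP: zAB.
  - split; first by rewrite setUA eqA; case: S.
    move=> x y /setDP[xA1]; rewrite inE negb_or => /andP[xA2 xB] /setDP[yAB yA1].
    have xA := subsetP A1A _ xA1.
    case: (boolP (y \in A)) => yA; last first.
      apply: noS; rewrite inE ?xA ?xB //= yA; move: yAB; rewrite inE => /orP[yA2|//].
      by rewrite (subsetP A2A) in yA.
    by apply: no12; rewrite inE ?xA1 ?xA2 ?yA1 //= AA12.
  - exact: XA1.
  - by rewrite eqI ltnW.
  - apply: contra nz => /eqP nz0; apply/eqP/setP=> z; have /setP/(_ z) := nz0.
    rewrite !inE; case: (boolP (z \in B)) => zB; rewrite ?andbF //= orbT andbT => /negbFE zA1.
    by rewrite (subsetP A1A).
  - rewrite eqI; apply: lk_mono L' => //; apply/subsetP=> z; rewrite !inE.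
    case/orP=> [/andP[zA zB]|/andP[H zA2]].
      by rewrite zB orbT andbT; apply: contra zA; apply: (subsetP A1A).
    by rewrite zA2 /= andbT; move: H; rewrite zA2 andbT.
(* For a smaller separator, [B] is replaced by a clique on [A :&: B]. The excess of edges survives,
   since by massedness [B :\: A] carried no more than its share. *)
pose e1 := clique_add e (A :&: B).
have se1 : symmetric e1 by apply: clique_add_sym.
have ie1 : irreflexive e1 by apply: clique_add_irr.
have ee1 : subrel e e1 by move=> x y; rewrite /e1 /clique_add => ->.
have M1' : 12 * m * #|A :\: X| < rho e1 A (A :\: X).
  have h1 := rho_split se S XA; have h2 := M2 A B S XA ltX.
  have h3 : rho e A (A :\: X) <= rho e1 A (A :\: X).
    by apply: rho_le => x y /ee1-> -> -> ->.
  have h4 : #|V :\: X| = #|A :\: X| + #|B :\: A|.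
    have := cardsUI (A :\: X) (B :\: A).
    have -> : (A :\: X) :&: (B :\: A) = set0.
      by apply/setP=> z; rewrite !inE; case: (z \in A); rewrite ?andbF.
    rewrite cards0 addn0 => <-; apply: eq_card => z.
    have [<- _] := S; rewrite !inE.
    case: (boolP (z \in A)) => zA; rewrite ?andbT ?andbF ?orbF //=.
    by rewrite (contra (subsetP XA z) zA).
  by move: M1 h1 h2 h3; rewrite h4 mulnDr; clear; lia.
have dis1 : [disjoint A :\: X & B :\: A].
  by rewrite disjoint_subset; apply/subsetP=> z /setDP[zA _]; rewrite !inE zA.
case: (classic (massed (12 * m) e1 A X)) => [mA|nM].
  apply: nl; have L1 := IH AsV se1 ie1 mA Xm.
  have dX : [disjoint X & A :\: X].
    by rewrite disjoint_subset; apply/subsetP=> z zX; rewrite !inE zX.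
  apply: lk_mono (clique_lift se dis1 dX L1 L) => //.
  by rewrite subUset AXV.
have [A0 [B0 [S0 XA0 lt0 big0]]] : exists A0 B0, [/\ sepn e1 A A0 B0, X \subset A0,
    #|A0 :&: B0| < #|X| & 12 * m * #|B0 :\: A0| < rho e1 A (B0 :\: A0)].
  apply: NNPP => none; apply: nM; split=> // A0 B0 S0 XA0 lt0; rewrite leqNgt.
  by apply/negP=> big; apply: none; exists A0, B0.
have [A1 [B1 [S1 XA1 lt1 big1 mas1]]] := violator se1 S0 XA0 lt0 big0.
have [A1A B1A AAB1] := sepnW S1; have [_ no] := S; have [eqA no1] := S1.
(* If the clique lies in [A1], adding [B] to [A1] turns the violation into one of the original
   massed pair. *)
case: (boolP (A :&: B \subset A1)) => sub.
  have S2 : sepn e V (A1 :|: B) B1.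
    split; first by rewrite setUAC eqA; case: S.
    move=> x y /setDP[xAB xB1] /setDP[yB1]; rewrite inE negb_or => /andP[yA1 yB].
    have yA := subsetP B1A _ yB1; apply/negP=> xy.
    case: (boolP (x \in A1)) => xA1.
      exact: (sepn_no S1 xA1 xB1 yB1 yA1 (ee1 _ _ xy)).
    have xB : x \in B by move: xAB; rewrite inE (negbTE xA1).
    have xA : x \notin A.
      by apply: contra xA1 => xA; apply: (subsetP sub); rewrite inE xA.
    by apply: (sepn_no S yA yB xB xA); rewrite se.
  have eqI : (A1 :|: B) :&: B1 = A1 :&: B1.
    apply/setP=> z; rewrite !inE; case: (boolP (z \in B1)) => zB1; rewrite ?andbF ?andbT //.
    case: (boolP (z \in B)) => zB; rewrite ?orbF ?orbT //; symmetry; apply: (subsetP sub).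
    by rewrite inE zB (subsetP B1A).
  have eqD : B1 :\: (A1 :|: B) = B1 :\: A1.
    apply/setP=> z; rewrite !inE; case: (boolP (z \in B1)) => zB1; rewrite ?andbF ?andbT //.
    case: (boolP (z \in B)) => zB; rewrite ?orbF ?orbT //; symmetry; apply/negbTE.
    by rewrite negbK; apply: (subsetP sub); rewrite inE zB (subsetP B1A).
  have := M2 _ _ S2 (subset_trans XA1 (subsetUl _ _)); rewrite eqI eqD => /(_ lt1).
  rewrite leqNgt => /negP[]; apply: leq_trans big1 _.
  apply: rho_le => x y; rewrite /e1 /clique_add => xy xA yA H.
  rewrite (subsetP AV) // (subsetP AV) // H !andbT; case/orP: xy => // /and3P[_ xAB yAB].
  by case/orP: H => /setDP[_ /negP[]]; apply: (subsetP sub).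
have [w wAB wA1] := subsetPn sub.
(* Otherwise some clique vertex is outside [A1], which forces the whole clique into [B1]. Then
   [B1 :|: B] is a linked far side and [A1] is smaller than [A]. *)
have AB1 : A :&: B \subset B1.
  apply/subsetP=> z zAB; apply: contraT => zB1; have zA : z \in A by case/setIP: zAB.
  have zA1 : z \in A1 by apply: contraT => h; rewrite AAB1 in zB1.
  have wB1 : w \in B1 by apply: AAB1 => //; case/setIP: wAB.
  have := no1 z w; rewrite !inE zB1 zA1 wA1 wB1 => /(_ isT isT)/negP[].
  rewrite /e1 /clique_add zAB wAB !andbT; apply/orP; right.
  by apply: contraNneq wA1 => <-.
have ltB1 : #|B1| < #|V| by apply: leq_ltn_trans AsV; apply: subset_leq_card.
have L1 := IH ltB1 se1 ie1 mas1 (leq_trans (ltnW lt1) Xm).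
have dis2 : [disjoint B1 :\: (A1 :&: B1) & B :\: A].
  by rewrite disjoint_subset; apply/subsetP=> z /setDP[/(subsetP B1A) zA _]; rewrite !inE zA.
have dZ : [disjoint A1 :&: B1 & B1 :\: (A1 :&: B1)].
  by rewrite disjoint_subset; apply/subsetP=> z /setIP[h1 h2]; rewrite !inE h1 h2.
have L2 := clique_lift se dis2 dZ L1 L.
have eqI : A1 :&: (B1 :|: B) = A1 :&: B1.
  apply/setP=> z; rewrite !inE; case: (boolP (z \in A1)) => //= zA1.
  case: (boolP (z \in B)) => zB; rewrite ?orbF ?orbT //; symmetry; apply: (subsetP AB1).
  by rewrite inE zB (subsetP A1A).
apply: (IHn A1 (B1 :|: B)).
- rewrite ltnS in ltA; apply: leq_trans ltA; apply: proper_card; apply/properP; split=> //.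
  by exists w => //; case/setIP: wAB.
- split; first by rewrite setUA eqA; case: S.
  move=> x y /setDP[xA1]; rewrite inE negb_or => /andP[xB1 xB] /setDP[yBB yA1].
  have xA := subsetP A1A _ xA1; apply/negP=> xy.
  case: (boolP (y \in B1)) => yB1.
    exact: (sepn_no S1 xA1 xB1 yB1 yA1 (ee1 _ _ xy)).
  have yB : y \in B by move: yBB; rewrite inE (negbTE yB1).
  have yA : y \notin A.
    by apply: contra yB1 => yA; apply: (subsetP AB1); rewrite inE yA.
  exact: (sepn_no S xA xB yB yA xy).
- exact: XA1.
- by rewrite eqI ltnW.
- apply: contra nz => /eqP nz0; apply/eqP/setP=> z; have /setP/(_ z) := nz0.
  rewrite !inE; case: (boolP (z \in B)) => zB; rewrite ?andbF //= orbT andbT => /negbFE zA1.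
  by rewrite (subsetP A1A).
- rewrite eqI; apply: lk_mono L2 => //; apply/subsetP=> z; rewrite !inE.
  case/orP=> [/andP[H zB1]|/andP[zA zB]].
    by rewrite zB1 /= andbT; move: H; rewrite zB1 andbT.
  by rewrite zB orbT andbT; apply: contra zA; apply: (subsetP A1A).
Qed.

(** Extends the last clause of massedness to order [#|X|]: a heavy far side would itself be massed
    and smaller than [V], hence linked, which [no_rigid] excludes. *)
Lemma small_side A B : sepn e V A B -> X \subset A -> #|A :&: B| <= #|X| -> A :\: B != set0 ->
  rho e V (B :\: A) <= 12 * m * #|B :\: A|.
Proof.
move=> S XA leX nz; have [XV M1 M2] := M; have [AV BV VAB] := sepnW S.
rewrite leqNgt; apply/negP=> big.
have ltB : #|B| < #|V|.
  apply: proper_card; apply/properP; split=> //; have /set0Pn[z /setDP[zA zB]] := nz.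
  by exists z => //; apply: (subsetP AV).
have mas : massed (12 * m) e B (A :&: B).
  apply: (sub_massed se S big) => A' B' S' AA' BB' lt'; apply: M2 => //.
    exact: subset_trans AA'.
  exact: leq_trans leX.
have L := IH ltB se ie mas (leq_trans leX Xm).
apply: (no_rigid S XA leX); last by rewrite setDIr_self in L.
apply/eqP=> z0; move: big; rewrite z0 cards0 muln0 /rho.
rewrite (_ : [set _ | _] = set0) ?cards0 //.
by apply/setP=> p; rewrite !inE orbF !andbF.
Qed.

End Counterexample.
End Massed.

(** * Contractions in a minimal counterexample *)

Section MassedLinked.
Variable T : finType.
Implicit Types (e : rel T) (A B C D E V W X Y Z : {set T}) (u v w x y z : T).

Lemma lk_mono_in e e' D Z : {in D :|: Z &, forall x y, e x y -> e' x y} ->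
  lk e D Z -> lk e' D Z.
Proof.
move=> sub L I s t sZ tZ is_ it_ st.
have [W [WD dW jW]] := L I s t sZ tZ is_ it_ st; exists W; split=> // i.
have WZ z : z \in W i -> z \in D :|: Z by move=> /(subsetP (WD i)) zD; rewrite inE zD.
have sDZ z : z \in Z -> z \in D :|: Z by rewrite inE orbC => ->.
have [x [y [xW yW sx ty cxy]]] := jW i; exists x, y; split=> //.
- by apply: sub => //; [apply: sDZ|apply: WZ].
- by apply: sub => //; [apply: sDZ|apply: WZ].
- by apply: conn_sub cxy => a b ab aW bW; apply: conn1 => //; apply: sub; rewrite ?WZ.
Qed.

(** Besides the edge [u v], contraction loses one edge for each neighbour [w] of [v] whose new edge
    either duplicates [u w] or falls inside [X] and is no longer counted. The factors two come from
    ordered pairs. *)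
Lemma rho_contract e u v V X : symmetric e -> irreflexive e ->
  e u v -> u \in V -> v \in V :\: X ->
  rho e V (V :\: X) <= rho (contract e u v) (V :\ v) ((V :\ v) :\: X) + 2 +
    2 * #|[set w in V | [&& e v w, w != u & e u w || (u \in X) && (w \in X)]]|.
Proof.
move=> se ie uv uV /setDP[vV vX]; set bad := [set w in V | _].
pose good := [set w in V | [&& e v w, w != u & ~~ (e u w || (u \in X) && (w \in X))]].
pose P0 := [set p : T * T | [&& e p.1 p.2, p.1 \in V :\ v, p.2 \in V :\ v &
  (p.1 \in V :\: X) || (p.2 \in V :\: X)]].
have uvn : u != v by apply: contraTneq uv => ->; rewrite ie.
have degv : deg e V v <= 1 + #|bad| + #|good|.
  rewrite -(cards1 u); apply: leq_trans (leq_add (leq_card_setU _ _) (leqnn _)).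
  apply: leq_trans (leq_card_setU _ _); apply: subset_leq_card; apply/subsetP=> w.
  rewrite !inE => /andP[-> ->] /=; case: (w == u) => //=; exact: orbN.
have upper : rho e V (V :\: X) <= #|P0| + 2 * deg e V v.
  have -> : 2 * deg e V v = #|(pair v) @: [set w in V | e v w]| +
      #|(fun w => (w, v)) @: [set w in V | e v w]|.
    by rewrite !card_imset ?mul2n ?addnn //; [move=> a b [] | move=> a b []].
  rewrite addnA; apply: leq_trans (leq_add (leq_card_setU _ _) (leqnn _)).
  apply: leq_trans (leq_card_setU _ _); apply: subset_leq_card; apply/subsetP=> -[x y].
  rewrite !inE /= => /and4P[xy xV yV H].
  case: (eqVneq x v) => [xv|xv].
    apply/orP; left; apply/orP; right; apply/imsetP; exists y; rewrite ?xv //.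
    by rewrite inE yV -xv.
  case: (eqVneq y v) => [yv|yv].
    apply/orP; right; apply/imsetP; exists x; rewrite ?yv //.
    by rewrite inE xV se -yv.
  by move: H; rewrite xy xV yV /= !andbT => ->.
have lower : #|P0| + 2 * #|good| <= rho (contract e u v) (V :\ v) ((V :\ v) :\: X).
  have -> : 2 * #|good| = #|(pair u) @: good| + #|(fun w => (w, u)) @: good|.
    by rewrite !card_imset ?mul2n ?addnn //; [move=> a b [] | move=> a b []].
  have goodE w : w \in good -> [/\ w \in V, w != v, w != u, e v w &
      ~~ e u w /\ ((u \notin X) || (w \notin X))].
    rewrite inE negb_or negb_and => /and4P[wV vw wu /andP[nuw H]]; split=> //.
    by apply: contraTneq vw => ->; rewrite ie.
  have I1 : P0 :&: (pair u) @: good = set0.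
    apply/setP=> -[x y]; rewrite in_set0 in_setI; apply/negP=> /andP[].
    rewrite inE /= => /and4P[xy _ _ _] /imsetP[w /goodE[_ _ _ _ [nuw _]] [xu yw]].
    by move: nuw; rewrite -xu -yw xy.
  have I2 : (P0 :|: (pair u) @: good) :&: (fun w => (w, u)) @: good = set0.
    apply/setP=> -[x y]; rewrite in_set0 in_setI in_setU; apply/negP=> /andP[].
    move=> H /imsetP[w /goodE[_ _ wu _ [nuw _]] [xw yu]]; case/orP: H.
      by rewrite inE /= => /and4P[xy _ _ _]; move: nuw; rewrite se -xw -yu xy.
    by case/imsetP=> w' _ [xu _]; move: wu; rewrite -xw xu eqxx.
  have := cardsUI (P0 :|: (pair u) @: good) ((fun w => (w, u)) @: good).
  rewrite I2 cards0 addn0; have := cardsUI P0 ((pair u) @: good); rewrite I1 cards0 addn0.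
  move=> E1 E2; rewrite addnA -E1 -E2; apply: subset_leq_card; apply/subsetP=> -[x y].
  rewrite !in_setU => /orP[/orP[|/imsetP[w /goodE[wV wv wu vw [_ nX]] [-> ->]]]|
     /imsetP[w /goodE[wV wv wu vw [_ nX]] [-> ->]]].
  - rewrite !inE /= => /and4P[xy /andP[xv ->] /andP[yv ->] H].
    rewrite xv yv /= andbT /contract xy /=; move: H; rewrite !andbT => ->; rewrite ?andbT.
    by apply: contraTneq xy => ->; rewrite ie.
  - rewrite !inE /= uvn uV wv wV /= !andbT nX andbT /contract eqxx vw orbT andbT.
    by rewrite eq_sym.
  - rewrite !inE /= uvn uV wv wV /= !andbT orbC nX andbT /contract eqxx.
    by rewrite [e w v]se vw !orbT andbT.
by move: degv upper lower; clear; lia.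
Qed.

Section Counterexample.
Variables (m : nat) (e : rel T) (V X : {set T}).
Hypotheses (se : symmetric e) (ie : irreflexive e).
Hypothesis M : massed (12 * m) e V X.
Hypothesis Xm : #|X| <= 2 * m.
Hypothesis nl : ~ lk e (V :\: X) X.
Hypothesis IH : forall (V' : {set T}) (e' : rel T) (X' : {set T}), #|V'| < #|V| ->
  symmetric e' -> irreflexive e' -> massed (12 * m) e' V' X' -> #|X'| <= 2 * m ->
  lk e' (V' :\: X') X'.

(** If fewer than [6 m] vertices were affected, contraction would lose at most
    [2 + 2 (6 m - 1) = 12 m] ordered pairs, the share of the vanished vertex, and the density would
    persist. Then a violating separation must be excluded, according to the position of [u]. *)
Lemma contraction_loss u v : u \in V -> v \in V :\: X -> e u v ->
  6 * m <= #|[set w in V | [&& e v w, w != u & e u w || (u \in X) && (w \in X)]]|.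
Proof.
move=> uV vVX uv; have /setDP[vV vX] := vVX; have [XV M1 M2] := M.
have rc := rho_contract se ie uv uV vVX.
set e' := contract e u v in rc; set V' := V :\ v in rc.
have uvn : u != v by apply: contraTneq uv => ->; rewrite ie.
have ltV : #|V'| < #|V| by rewrite (cardsD1 v V) vV.
have se' : symmetric e' by apply: contract_sym.
have ie' : irreflexive e' by apply: contract_irr.
have XV' : X \subset V'.
  by apply/subsetP=> x xX; rewrite !inE (subsetP XV) // andbT; apply: contraNneq vX => <-.
have vV' : v \notin V' by rewrite !inE eqxx.
have V'V : V' \subset V by apply: subD1set.
have ee' x y : e x y -> e' x y.
  by move=> xy; rewrite /e' /contract xy andbT; apply: contraTneq xy => ->; rewrite ie.
rewrite leqNgt; apply/negP=> small.
have M1' : 12 * m * #|V' :\: X| < rho e' V' (V' :\: X).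
  have : #|V :\: X| = #|V' :\: X|.+1.
    rewrite (cardsD1 v (V :\: X)) vVX add1n; congr _.+1; apply: eq_card => z.
    by rewrite !inE andbCA.
  by move: M1 rc small => /= + + + eqc; rewrite eqc mulnS; clear; lia.
case: (classic (massed (12 * m) e' V' X)) => [mas|nM].
  have L := IH ltV se' ie' mas Xm; apply: nl.
  have vD : v \notin V' :\: X by rewrite inE negb_and vV' orbT.
  have dX : [disjoint X & V' :\: X].
    by rewrite disjoint_subset; apply/subsetP=> z zX; rewrite !inE zX.
  apply: lk_mono (contract_lift se uv vD vX dX L) => //.
  by apply/subsetP=> z; rewrite in_setU1 => /orP[/eqP-> //|]; apply: (subsetP (setSD _ V'V)).
have [A0 [B0 [S0 XA0 lt0 big0]]] : exists A0 B0, [/\ sepn e' V' A0 B0, X \subset A0,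
    #|A0 :&: B0| < #|X| & 12 * m * #|B0 :\: A0| < rho e' V' (B0 :\: A0)].
  apply: NNPP => none; apply: nM; split=> // A0 B0 S0 XA0 lt0; rewrite leqNgt.
  by apply/negP=> big; apply: none; exists A0, B0.
have [A [B [S XA lt big mas]]] := violator se' S0 XA0 lt0 big0.
have [AV BV VAB] := sepnW S; have [eqV no] := S.
have vA : v \notin A by apply: contra vV'; apply: (subsetP AV).
have vB : v \notin B by apply: contra vV'; apply: (subsetP BV).
have ltB : #|B| < #|V| by apply: leq_ltn_trans ltV; apply: subset_leq_card.
have L := IH ltB se' ie' mas (leq_trans (ltnW lt) Xm).
have nz : B :\: A != set0.
  apply/eqP=> z0; move: big; rewrite z0 cards0 muln0 /rho.
  rewrite (_ : [set _ | _] = set0) ?cards0 //.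
  by apply/setP=> p; rewrite !inE orbF !andbF.
have eqVv : v |: (A :|: B) = V by rewrite eqV /V' setD1K.
have uV' : u \in V' by rewrite !inE uvn.
(* With [u] only on the near side, [v] joins that side at no cost, and the linked far side is an
   unchanged part of the original graph. *)
case: (boolP (u \in B)) => uB; last first.
  have uA : u \in A by move: uV'; rewrite -eqV inE (negbTE uB) orbF.
  have eqI : (v |: A) :&: B = A :&: B.
    apply/setP=> z; rewrite !inE; case: eqP => //= ->.
    by rewrite (negbTE vB) andbF.
  have eqD : B :\: (v |: A) = B :\: A.
    apply/setP=> z; rewrite !inE; case: eqP => //= ->.
    by rewrite (negbTE vB) andbF.
  apply: (no_rigid se ie M Xm nl IH (A := v |: A) (B := B)).
  - split; first by rewrite -setUA.
    move=> x y /setDP[+ xB]; rewrite eqD => + /setDP[yB yA]; rewrite !inE.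
    case/orP=> [/eqP->|xA]; apply/negP=> h; last exact: (sepn_no S xA xB yB yA (ee' _ _ h)).
    apply: (sepn_no S uA uB yB yA); rewrite /e' /contract eqxx h orbT andbT.
    by apply: contraNneq uB => ->.
  - exact: subset_trans XA (subsetUr _ _).
  - by rewrite eqI ltnW.
  - by rewrite eqD.
  - rewrite eqI eqD -(setDIr_self A B); apply: lk_mono_in L => x y xB yB.
    have inB z : z \in (B :\: A :&: B) :|: (A :&: B) -> z != u.
      by move=> h; apply: contraNneq uB => <-; move: h; rewrite !inE; case: (z \in B); rewrite ?andbF.
    by apply: contract_away; apply: inB.
have dZ : [disjoint A :&: B & B :\: A :&: B].
  by rewrite disjoint_subset; apply/subsetP=> z zI; rewrite in_simpl in_setD zI.
(* With [u] only on the far side, [v] joins that side, and the linkage lifts through the contracted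
   edge. *)
case: (boolP (u \in A)) => uA; last first.
  have eqI : A :&: (v |: B) = A :&: B.
    apply/setP=> z; rewrite !inE; case: eqP => //= ->.
    by rewrite (negbTE vA).
  apply: (no_rigid se ie M Xm nl IH (A := A) (B := v |: B)).
  - split; first by rewrite setUCA.
    move=> x y /setDP[xA]; rewrite !inE negb_or => /andP[xv xB] /andP[yA].
    case/orP=> [/eqP->|yB]; apply/negP=> h; last exact: (sepn_no S xA xB yB yA (ee' _ _ h)).
    apply: (sepn_no S xA xB uB uA); rewrite /e' /contract eqxx h !orbT andbT.
    by apply: contraNneq uA => <-.
  - exact: XA.
  - by rewrite eqI ltnW.
  - apply: contra nz => /eqP z0; apply/eqP/setP=> z; have /setP/(_ z) := z0; rewrite !inE.
    by case: (z \in A) => //=; case: (z \in B); rewrite ?orbT.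
  - rewrite eqI; have := contract_lift se uv _ _ dZ L; rewrite !inE (negbTE vA) (negbTE vB).
    rewrite andbF => /(_ isT isT); apply: lk_mono => //.
    rewrite setDIr_self; apply/subsetP=> z; rewrite !inE.
    by case: eqP => [-> _|_ /andP[-> ->]] //; rewrite vA.
(* With [u] in the separator, [v] joins both sides and the order grows by one. It is still at most
   [#|X|], which is the case that [small_side] was prepared for. *)
have eqD : (v |: B) :\: (v |: A) = B :\: A.
  apply/setP=> z; rewrite !inE; case: (eqVneq z v) => [->|] //=.
  by rewrite (negbTE vB) andbF.
have S' : sepn e V (v |: A) (v |: B).
  split; first by rewrite -setUUr.
  move=> x y /setDP[]; rewrite eqD !inE negb_or => H1 /andP[xv xB] /andP[yA yB].
  rewrite (negbTE xv) /= in H1; apply/negP=> h; exact: (sepn_no S H1 xB yB yA (ee' _ _ h)).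
have le : #|(v |: A) :&: (v |: B)| <= #|X|.
  rewrite -setUIr cardsU1 !inE (negbTE vA) /=; exact: lt.
have nz' : (v |: A) :\: (v |: B) != set0.
  apply/set0Pn; have /subsetPn[a aA aB] : ~~ (A \subset B).
    apply/negP=> sub; move: lt; rewrite ltnNge => /negP[]; apply: subset_leq_card.
    by rewrite subsetI XA (subset_trans XA sub).
  exists a; rewrite !inE negb_or aA aB orbT !andbT.
  by apply: contraNneq vA => <-.
have := small_side se ie M Xm nl IH S' (subset_trans XA (subsetUr _ _)) le nz'.
rewrite eqD leqNgt => /negP[]; apply: leq_trans big _.
(* Edges at [u] that stem from [v] are sent back to [v]. The map is injective because [v] is not a
   vertex of the contraction. *)
pose g (p : T * T) := (if (p.1 == u) && ~~ e p.1 p.2 then v else p.1,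
                       if (p.2 == u) && ~~ e p.1 p.2 then v else p.2).
rewrite /rho -(card_in_imset (f := g)).
  apply: subset_leq_card; apply/subsetP=> _ /imsetP[[x y] + ->]; rewrite inE /= /g /=.
  move=> /and4P[xy xV yV H]; have xV0 := subsetP V'V _ xV; have yV0 := subsetP V'V _ yV.
  case: (boolP (e x y)) => exy; rewrite ?andbT ?andbF !inE /=.
    by move: H; rewrite exy xV0 yV0 !inE.
  move: xy; rewrite /e' /contract (negbTE exy) /= => /andP[xyn /orP[/andP[/eqP xu vy]|/andP[/eqP yu xv]]].
    have yu : y != u by rewrite -xu eq_sym.
    rewrite xu eqxx (negbTE yu) vy vV yV0 /=.
    by move: H; rewrite xu !inE uA /= => /andP[-> ->]; rewrite orbT.
  have xu : x != u by rewrite -yu.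
  rewrite yu eqxx (negbTE xu) xv vV xV0 /=.
  by move: H; rewrite yu !inE uA /= orbF => /andP[-> ->].
move=> [x y] [x' y']; rewrite !inE /= => /and4P[_ /andP[xv _] /andP[yv _] _].
move=> /and4P[_ /andP[xv' _] /andP[yv' _] _]; rewrite /g /= => -[].
have key a a' b b' : a != v -> a' != v ->
   (if (a == u) && b then v else a) = (if (a' == u) && b' then v else a') -> a = a'.
  move=> av av'; case: ifP => [/andP[/eqP-> _]|_]; case: ifP => [/andP[/eqP-> _]|_] // h.
    by rewrite -h eqxx in av'.
  by rewrite h eqxx in av.
by move=> /(key _ _ _ _ xv xv') -> /(key _ _ _ _ yv yv') ->.
Qed.

End Counterexample.
End MassedLinked.

(** * Deletions, a vertex of low degree and the linkage theorem *)

Section MassedTheorem.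
Variable T : finType.
Implicit Types (e : rel T) (A B C D E V W X Y Z : {set T}) (u v w x y z : T).

Definition del_edge e u v x y := e x y && ~~ (((x == u) && (y == v)) || ((x == v) && (y == u))).

Lemma del_edge_sym e u v : symmetric e -> symmetric (del_edge e u v).
Proof. by move=> se x y; rewrite /del_edge se orbC; congr (_ && ~~ (_ || _)); rewrite andbC. Qed.

Lemma rho_del_edge e u v V Y : symmetric e -> e u v -> u \in Y -> u \in V -> v \in V ->
  rho e V Y <= rho (del_edge e u v) V Y + 2.
Proof.
move=> se uv uY uV vV.
have c2 : #|[set (u, v); (v, u)]| <= 2 by rewrite cards2; case: (_ != _).
apply: leq_trans (leq_add (leqnn _) c2); apply: leq_trans (leq_card_setU _ _).
apply: subset_leq_card; apply/subsetP=> -[x y]; rewrite !inE /= => /and4P[xy -> -> ->].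
by rewrite /del_edge xy /= !xpair_eqE !andbT; case: ((x == u) && _) => //=; case: (_ && _).
Qed.

Lemma sum_deg e V Y : \sum_(v in Y) deg e V v = #|[set p : T * T | [&& p.1 \in Y, p.2 \in V & e p.1 p.2]]|.
Proof.
rewrite -sum1_card (partition_big fst (mem Y)) /=; last by move=> p; rewrite inE => /and3P[].
apply: eq_bigr => v vY; rewrite sum1_card /deg -(card_imset _ (f := pair v)) => [|a b [] //].
apply: eq_card => -[x y]; apply/imsetP/idP => [[w wN [xv yw]]|].
  move: wN; rewrite in_set xv yw => /andP[wV vw].
  by rewrite unfold_in /= in_set /= vY wV vw eqxx.
rewrite unfold_in /= in_set /= => /andP[/and3P[xY yV xy] /eqP xv].
by exists y; rewrite ?in_set ?yV -?xv.
Qed.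

Lemma deg_rho e V Y : Y \subset V -> \sum_(v in Y) deg e V v <= rho e V Y.
Proof.
move=> YV; rewrite sum_deg; apply: subset_leq_card; apply/subsetP=> -[x y].
by rewrite !inE /= => /and3P[xY -> ->]; rewrite xY (subsetP YV).
Qed.

Section Counterexample.
Variables (m : nat) (e : rel T) (V X : {set T}).
Hypotheses (m0 : 0 < m) (se : symmetric e) (ie : irreflexive e).
Hypothesis M : massed (12 * m) e V X.
Hypothesis Xm : #|X| <= 2 * m.
Hypothesis nl : ~ lk e (V :\: X) X.
Hypothesis IH : forall (V' : {set T}) (e' : rel T) (X' : {set T}), #|V'| < #|V| ->
  symmetric e' -> irreflexive e' -> massed (12 * m) e' V' X' -> #|X'| <= 2 * m ->
  lk e' (V' :\: X') X'.
Hypothesis IHe : forall e' : rel T, #|[set p : T * T | e' p.1 p.2]| < #|[set p : T * T | e p.1 p.2]| ->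
  symmetric e' -> irreflexive e' -> massed (12 * m) e' V X -> lk e' (V :\: X) X.

(** With slack in the density, deleting [u v] could only create a new separation that splits this
    edge. Moving its near end into [B] restores a separation of [e], of order at most [#|X|], to
    which [small_side] applies. *)
Lemma deletion_tight u v : u \in V :\: X -> v \in V :\: X -> e u v ->
  rho e V (V :\: X) <= 12 * m * #|V :\: X| + 2.
Proof.
move=> uVX vVX uv; have [XV M1 M2] := M; rewrite leqNgt; apply/negP=> big.
have /setDP[uV uX] := uVX; have /setDP[vV vX] := vVX.
pose e' := del_edge e u v.
have e'e : subrel e' e by move=> x y /andP[].
have se' : symmetric e' by apply: del_edge_sym.
have ie' : irreflexive e' by move=> x; rewrite /e' /del_edge ie.
apply: nl; apply: lk_mono (IHe _ se' ie' _) => //.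
  apply: proper_card; apply/properP; split.
    by apply/subsetP=> p; rewrite !inE => /e'e.
  by exists (u, v); rewrite !inE //= /e' /del_edge !eqxx andbF.
split=> //.
  by have := rho_del_edge se uv uVX uV vV; move: big; rewrite -/e'; clear; lia.
move=> A B S XA lt; have [AV BV VAB] := sepnW S; have [eqV no] := S.
have le : rho e' V (B :\: A) <= rho e V (B :\: A) by apply: rho_le => x y /e'e-> -> -> ->.
apply: leq_trans le _.
case: (classic (sepn e V A B)) => [S'|nS]; first exact: M2.
have [x [y [xA yB xy]]] : exists x y, [/\ x \in A :\: B, y \in B :\: A & e x y].
  apply: NNPP => none; apply: nS; split=> // x y xA yB; apply/negP=> xy; apply: none.
  by exists x, y.
have xyuv : (x == u) && (y == v) || (x == v) && (y == u).
  apply: contraT => nxy; have := no x y xA yB; rewrite /e' /del_edge xy => /negP[] //.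
have xX : x \notin X by case/orP: xyuv => /andP[/eqP->].
have /setDP[xA' xB] := xA; have /setDP[yB' yA] := yB.
have eqD : (x |: B) :\: A = B :\: A.
  by apply/setP=> z; rewrite !inE; case: eqP => [->|] //=; rewrite xA'.
have le' : #|A :&: (x |: B)| <= #|X|.
  apply: leq_trans lt; rewrite setIUr; apply: leq_trans (leq_card_setU _ _) _.
  by rewrite -addn1 addnC leq_add2l; apply: leq_trans (subset_leq_card (subsetIr _ _)) _; rewrite cards1.
have S' : sepn e V A (x |: B).
  split; first by rewrite setUCA eqV; apply/setUidPr; rewrite sub1set (subsetP AV).
  move=> a b /setDP[aA]; rewrite !inE negb_or => /andP[ax aB] /andP[bA].
  have bx : b != x by apply: contraNneq bA => ->.
  rewrite (negbTE bx) /= => bB; apply/negP=> ab; apply: (sepn_no S aA aB bB bA).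
  rewrite /e' /del_edge ab /=; apply/negP=> abuv.
  case/orP: xyuv abuv => /andP[/eqP xu /eqP yv] /orP[/andP[/eqP au /eqP bv]|/andP[/eqP au /eqP bv]].
  - by rewrite xu au eqxx in ax.
  - by rewrite yv -au aA in yA.
  - by rewrite yv -au aA in yA.
  - by rewrite xu au eqxx in ax.
have nz : A :\: (x |: B) != set0.
  apply/set0Pn; apply: NNPP => none; have sub : A \subset x |: B.
    by apply/subsetP=> z zA; apply: contraT => zB; case: none; exists z; rewrite inE zB.
  have cAX : #|A| <= #|X| by rewrite -(setIidPl sub).
  have eqAX : X = A by apply/eqP; rewrite eqEcard XA.
  by rewrite eqAX xA' in xX.
by have := small_side se ie M Xm nl IH S' XA le' nz; rewrite eqD.
Qed.

Lemma no_isolated v : v \in V :\: X -> 0 < deg e V v.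
Proof.
move=> vVX; have /setDP[vV vX] := vVX; have [XV M1 M2] := M.
rewrite lt0n; apply/eqP=> d0.
have nv y : y \in V -> ~~ e v y.
  move=> yV; apply/negP=> vy; have := cards0_eq d0 => /setP/(_ y).
  by rewrite !inE yV vy.
have V'V : V :\ v \subset V by apply: subD1set.
have ltV : #|V :\ v| < #|V| by rewrite (cardsD1 v V) vV.
apply: nl; apply: lk_mono (IH ltV se ie _ Xm) => //; first exact: setSD.
have rhoE Y : rho e V Y <= rho e (V :\ v) (Y :\ v).
  apply: rho_le => x y xy xV yV H; rewrite xy !inE xV yV !andbT.
  have -> : x != v by apply: contraTneq xy => ->; rewrite (negbTE (nv _ yV)).
  have -> : y != v by apply: contraTneq xy => ->; rewrite se (negbTE (nv _ xV)).
  by [].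
have subX : X \subset V :\ v.
  by apply/subsetP=> x xX; rewrite !inE (subsetP XV) // andbT; apply: contraNneq vX => <-.
split=> //.
  apply: leq_ltn_trans (_ : 12 * m * #|V :\: X| < _).
    by rewrite leq_mul2l; apply/orP; right; apply: subset_leq_card; apply: setSD.
  apply: leq_trans M1 (leq_trans (rhoE _) _); apply: rho_le => x y -> -> -> /=.
  by rewrite !inE !(andbCA (_ != v)).
move=> A B S XA lt; have [AV BV VAB] := sepnW S; have [eqV no] := S.
have vB : v \notin B by apply/negP=> /(subsetP BV); rewrite !inE eqxx.
have S' : sepn e V (v |: A) B.
  split; first by rewrite -setUA eqV setD1K.
  move=> x y /setDP[+ xB] /setDP[yB]; rewrite !inE negb_or => + /andP[yv yA].
  case/orP=> [/eqP->|xA]; first by apply: nv; apply: (subsetP V'V); apply: (subsetP BV).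
  by apply/negP; apply: (sepn_no S xA xB yB yA).
have eqI : (v |: A) :&: B = A :&: B.
  by apply/setP=> z; rewrite !inE; case: eqP => //= ->; rewrite (negbTE vB) andbF.
have eqD : B :\: (v |: A) = B :\: A.
  by apply/setP=> z; rewrite !inE; case: eqP => //= ->; rewrite (negbTE vB) andbF.
have := M2 _ _ S' (subset_trans XA (subsetUr _ _)); rewrite eqI eqD => /(_ lt).
by apply: leq_trans; apply: rho_le => x y -> /(subsetP V'V)-> /(subsetP V'V)->.
Qed.

(** Otherwise the degree sum exceeds the bound of [deletion_tight] unless [V :\: X] has at most two
    vertices, yet each of them has more than [10 m] neighbours there. *)
Lemma low_degree : exists2 v, v \in V :\: X & deg e V v <= 12 * m.
Proof.
have [XV M1 M2] := M; set N := V :\: X in M1 *.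
have NV : N \subset V by apply: subsetDl.
apply: NNPP => none.
have hi v : v \in N -> 12 * m + 1 <= deg e V v.
  by move=> vN; rewrite addn1 ltnNge; apply/negP=> le; apply: none; exists v.
have lb : #|N| * (12 * m + 1) <= rho e V N.
  apply: leq_trans (deg_rho _ NV); rewrite -sum_nat_const; exact: leq_sum.
have N0 : 0 < #|N|.
  rewrite lt0n; apply/eqP=> N0; move: M1; rewrite N0 muln0 /rho.
  rewrite (_ : [set _ | _] = set0) ?cards0 //.
  by apply/setP=> p; rewrite in_set (cards0_eq N0) !in_set0 /= !andbF.
have [v vN] := card_gt0P N0.
have dv : deg e V v <= #|X| + deg e N v.
  apply: leq_trans (_ : _ <= deg e X v + deg e N v) _; last by rewrite leq_add2r deg_card.
  by apply: leq_trans (deg_setU _ _ _ _); rewrite /N -{1}(setIidPr XV) setID.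
have [u uN vu] : exists2 u, u \in N & e v u.
  by apply: deg_gt0; have := hi v vN; move: dv Xm m0; clear; lia.
have tight := deletion_tight vN uN vu; rewrite -/N in tight.
have : #|N| <= 2.
  have : #|N| * (12 * m + 1) <= 12 * m * #|N| + 2 by apply: leq_trans lb tight.
  by rewrite mulnDr muln1 mulnC leq_add2l.
have := deg_card e N v; have := hi v vN; move: dv Xm m0; clear; lia.
Qed.

(** In the closed neighbourhood [L] of a vertex of low degree, [contraction_loss] supplies the
    degrees that [dense_core] asks for. The linked set [Y] found there is separated from [X] at
    least order; routes from the separator to [Y] make the far side linked, against [no_rigid]. *)
Lemma no_counterexample : False.
Proof.
have [XV M1 M2] := M; have [v vVX dv] := low_degree; have /setDP[vV vX] := vVX.
pose N := [set w in V | e v w]; pose L := v |: N; pose X' := X :&: L.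
have vN : v \notin N by rewrite inE ie andbF.
have NV : N \subset V by apply/subsetP=> w; rewrite inE => /andP[].
have LV : L \subset V by rewrite subUset sub1set vV.
have X'L : X' \subset L by apply: subsetIr.
have vX' : v \notin X' by rewrite inE (negbTE vX).
have badL w u : u \in [set w' in V | [&& e v w', w' != w & e w w' || (w \in X) && (w' \in X)]] ->
    [/\ u \in L, u != v, u != w & e w u || (w \in X) && (u \in X)].
  rewrite inE => /and4P[uV vu uw H]; split=> //; first by rewrite !inE uV vu orbT.
  by apply: contraTneq vu => ->; rewrite ie.
have loss w : w \in N -> 6 * m <= #|[set w' in V | [&& e v w', w' != w & e w w' || (w \in X) && (w' \in X)]]|.
  by rewrite inE => /andP[wV vw]; apply: (contraction_loss se ie M Xm nl IH wV vVX); rewrite se.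
have [w0 w0V vw0] := deg_gt0 (no_isolated vVX).
have w0N : w0 \in N by rewrite inE w0V.
have [||||||Y [YL Ym HY]] := @dense_core T e se ie m L X' m0.
- by rewrite cardsU1 vN add1n addn1 ltnS.
- exact: X'L.
- by apply: leq_trans Xm; apply: subset_leq_card; apply: subsetIl.
- by apply/set0Pn; exists v; rewrite inE vX' !inE eqxx.
- move=> w /setDP[wL wX']; have wX : w \notin X by apply: contra wX' => wX; rewrite inE wX.
  case: (eqVneq w v) wL => [-> _|wv].
    have : 6 * m + 1 <= #|w0 |: [set w' in V | [&& e v w', w' != w0 & e w0 w' || (w0 \in X) && (w' \in X)]]|.
      by rewrite cardsU1 inE eqxx /= !andbF /= add1n addn1 ltnS loss.
    move=> h; apply: leq_trans h _; apply: subset_leq_card; apply/subsetP=> u.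
    rewrite in_setU1 => /orP[/eqP->|]; first by rewrite !inE w0V vw0 orbT.
    by rewrite !inE => /and4P[-> -> _ _]; rewrite orbT.
  rewrite in_setU1 (negbTE wv) /= => wN.
  have : 6 * m + 1 <= #|v |: [set w' in V | [&& e v w', w' != w & e w w' || (w \in X) && (w' \in X)]]|.
    by rewrite cardsU1 inE ie /= andbF /= add1n addn1 ltnS loss.
  move=> h; apply: leq_trans h _; apply: subset_leq_card; apply/subsetP=> u.
  have vw : e v w by move: wN; rewrite inE => /andP[].
  rewrite in_setU1 => /orP[/eqP->|/badL[uL _ _]]; first by rewrite !inE eqxx se vw.
  by rewrite (negbTE wX) orbF => wu; rewrite inE uL.
- move=> x /setIP[xX xL]; have xv : x != v by apply: contraNneq vX => <-.
  have xN : x \in N by move: xL; rewrite in_setU1 (negbTE xv).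
  have xX' : x \in X' by rewrite inE xX.
  have vx : e v x by move: xN; rewrite inE => /andP[].
  have h1 := loss x xN.
  have h2 : #|[set w' in V | [&& e v w', w' != x & e x w' || (x \in X) && (w' \in X)]]| <=
      #|X' :\ x| + #|[set y in L :\: X' | e x y] :\ v|.
    apply: leq_trans (leq_card_setU _ _); apply: subset_leq_card; apply/subsetP=> u.
    move=> /badL[uL uv ux H]; rewrite in_setU in_setD1 in_setI uL ux andbT /=.
    case: (boolP (u \in X)) => //= uX; rewrite !inE uv (negbTE uX) /=.
    move: H; rewrite (negbTE uX) andbF orbF => ->; rewrite andbT.
    by move: uL; rewrite in_setU1 in_set.
  have h3 := cardsD1 x X'; have h4 := cardsD1 v [set y in L :\: X' | e x y].
  have h5 : v \in [set y in L :\: X' | e x y].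
    by rewrite inE in_setD vX' in_setU1 eqxx se vx.
  move: h1 h2 h3 h4; rewrite xX' h5 /deg; clear; lia.
have YV := subset_trans YL LV.
pose P (p : {set T} * {set T}) := [/\ sepn e V p.1 p.2, X \subset p.1 & Y \subset p.2].
have PXV : P (X, V).
  split=> //=; split; first exact: (setUidPr XV).
  by move=> x y /setDP[xX /negP[]]; apply: (subsetP XV).
have [|[A B] [[/= S XA YB] minA]] := @ex_argmin _ P (fun p => #|p.1 :&: p.2|).
  by exists (X, V).
have leX : #|A :&: B| <= #|X| by have := minA _ PXV; rewrite /= (setIidPl XV).
have [|W [phi R]] := menger (subsetIr A B) YB (e := e).
  move=> B1 B2 SB sub1 sub2; have [S3 eqI _] := sepn_glue S SB sub1.
  have := minA (A :|: B1, B2); rewrite /= eqI; apply; split=> //=.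
  exact: subset_trans XA (subsetUl _ _).
have [HR dis] := R.
pose Z := phi @: (A :&: B).
have ZY : Z \subset Y.
  apply/subsetP=> _ /imsetP[x xX ->]; have [_ _ eqW _] := HR x xX.
  by have /setIP[] : phi x \in W x :&: Y by rewrite eqW inE.
have YZ y : y \in A -> y \in Y -> y \in Z.
  move=> yA yY; have yAB : y \in A :&: B by rewrite inE yA (subsetP YB).
  have [yW _ eqW _] := HR y yAB.
  have : y \in W y :&: Y by rewrite inE yW.
  by rewrite eqW inE => /eqP->; apply: imset_f.
have Zm : #|Z| <= 2 * m by apply: leq_trans (leq_imset_card _ _) (leq_trans leX Xm).
have XZ : X' :&: Y \subset Z.
  by apply/subsetP=> y /setIP[/setIP[yX _] yY]; apply: YZ => //; apply: (subsetP XA).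
have L0 := HY Z ZY Zm XZ.
have dW : {in A :&: B, forall x, [disjoint W x & Y :\: Z]}.
  move=> x xAB; have [_ _ eqW _] := HR x xAB.
  rewrite disjoint_subset; apply/subsetP=> z zW; rewrite !inE negb_and negbK.
  case: (boolP (z \in Y)) => zY; rewrite ?orbT // orbF.
  have : z \in W x :&: Y by rewrite inE zW.
  by rewrite eqW inE => /eqP->; apply: imset_f.
have L1 := routes_lk se R dW L0.
apply: (no_rigid se ie M Xm nl IH S XA leX).
  apply/set0Pn; apply: NNPP => none; have BA : B \subset A.
    by apply/subsetP=> z zB; apply: contraT => zA; case: none; exists z; rewrite inE zA.
  move: Ym; rewrite ltnNge => /negP[]; apply: leq_trans (leq_trans leX Xm).
  by apply: subset_leq_card; rewrite (setIidPr BA).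
apply: lk_mono L1 => //; rewrite setDIr_self subUset subxx andbT.
apply/subsetP=> y /setDP[yY yZ]; rewrite inE (subsetP YB) // andbT.
by apply: contra yZ => yA; apply: YZ.
Qed.

End Counterexample.

(* A variant of the theorem of Thomas and Wollan on linkages in graphs with many edges. *)
Theorem massed_lk m e V X : 0 < m -> symmetric e -> irreflexive e ->
  massed (12 * m) e V X -> #|X| <= 2 * m -> lk e (V :\: X) X.
Proof.
move=> m0; have [n] := ubnP #|V|; elim: n e V X => // n IHn e V X ltV.
have [k] := ubnP #|[set p : T * T | e p.1 p.2]|.
elim: k e => // k IHk e lte se ie M Xm; apply: NNPP => nl.
apply: (no_counterexample m0 se ie M Xm nl).
  by move=> V' e' X' lt'; apply: IHn; rewrite ltnS in ltV; apply: leq_trans lt' ltV.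
move=> e' lt' se' ie' M'; apply: IHk => //; rewrite ltnS in lte.
exact: leq_trans lt' lte.
Qed.

End MassedTheorem.

(** * Matchings *)

Section Involutions.
Variable D : finType.
Implicit Types (a b f g : D -> D) (x y z w : D) (O : {set D}).

(** The orbit of [y] under two involutions applied in turn, [b] first. For two matchings it is the
    alternating path that starts at a vertex missed by [a]. *)
Fixpoint track a b y n := if n is m.+1 then (if odd m then a else b) (track a b y m) else y.

(** A coincidence at odd distance shrinks from both ends to equal consecutive terms. One at even
    distance moves back to the start, where [a y = y] also produces equal consecutive terms. *)
Lemma track_inj a b y n : involutive a -> involutive b -> a y = y ->
  (forall i, i < n -> track a b y i.+1 != track a b y i) ->
  forall i j, i <= n -> j <= n -> track a b y i = track a b y j -> i = j.
Proof.
move=> ia ib ay no; set w := track a b y.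
have back m : w m = (if odd m then a else b) (w m.+1) by rewrite /w /=; case: ifP.
have even d i : ~~ odd d -> i + d.+2 <= n -> w i != w (i + d.+2).
  move=> od; elim: i => [|i IH] le.
    apply/eqP=> eqw; have := no d.+1 le.
    by rewrite -/w add0n in eqw *; rewrite (back d.+1) -eqw /= od /w /= ay eqxx.
  apply: contraNneq (IH (ltnW le)) => eqw; rewrite (back i) eqw addSn (back (i + _)).
  by rewrite oddD /= negbK (negbTE od) addbF.
have odd_ k i : i + k.*2.+1 <= n -> w i != w (i + k.*2.+1).
  elim: k i => [|k IH] i le; first by rewrite addn1 eq_sym no // -addn1.
  have le' : i.+1 + k.*2.+1 <= n by apply: leq_trans le; rewrite doubleS; lia.
  apply: contraNneq (IH _ le') => eqw.
  have -> : i.+1 + k.*2.+1 = i + k.*2.+2 by rewrite addSnnS.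
  rewrite (back (i + k.*2.+2)) -addnS -doubleS -eqw /w /= oddD /= negbK odd_double addbF.
  by [].
have lt i j : i < j -> j <= n -> w i != w j.
  move=> ij jn; have [d eqd] : exists d, j = i + d.+1 by exists (j - i).-1; lia.
  rewrite eqd in jn *; case: (boolP (odd d)) => od.
    by case: d od {eqd} jn => // d; apply: even.
  by move: jn; rewrite -(even_halfK od); apply: odd_.
move=> i j le_in le_jn eqw; case: (ltngtP i j) => // ij.
  by have := lt i j ij le_jn; rewrite eqw eqxx.
by have := lt j i ij le_in; rewrite eqw eqxx.
Qed.

Definition trail a b y n := [set track a b y i | i : 'I_n.+1].

(** Finiteness forces equal consecutive terms, and at the first such place the involution that is
    due fixes the current term. *)
Lemma dihedral a b y : involutive a -> involutive b -> a y = y -> exists n,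
  (forall i j, i <= n -> j <= n -> track a b y i = track a b y j -> i = j) /\
  (if odd n then a else b) (track a b y n) = track a b y n.
Proof.
move=> ia ib ay; set w := track a b y.
have [|n [/eqP eqn minn]] := @nat_min (fun n => w n.+1 == w n).
  apply: NNPP => none.
  have inj : injective (fun i : 'I_#|D|.+1 => w i).
    move=> i j /= eqw; apply: val_inj.
    apply: (track_inj (n := #|D|) ia ib ay _ _ _ eqw); try by rewrite -ltnS.
    by move=> k _; apply/negP=> eqk; apply: none; exists k.
  by have := leq_card _ inj; rewrite card_ord ltnn.
exists n; split; last exact: eqn.
apply: track_inj => // i lt; apply/negP=> eqi; have := minn i eqi; by rewrite leqNgt lt.
Qed.

Section Trail.
Variables (a b : D -> D) (y : D) (n : nat).
Hypotheses (ia : involutive a) (ib : involutive b) (ay : a y = y).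
Local Notation w := (track a b y).
Hypothesis inj : forall i j, i <= n -> j <= n -> w i = w j -> i = j.
Hypothesis stop : (if odd n then a else b) (w n) = w n.
Local Notation O := (trail a b y n).

Lemma trail_in i : i <= n -> w i \in O.
Proof. by rewrite -ltnS => lt; apply/imsetP; exists (Ordinal lt). Qed.

Lemma trailP x : x \in O -> exists2 i, i <= n & x = w i.
Proof. by case/imsetP=> i _ ->; exists i; rewrite // -ltnS. Qed.

Lemma track_step i : i < n -> (if odd i then a else b) (w i) = w i.+1.
Proof. by []. Qed.

Lemma track_back i : (if odd i then a else b) (w i.+1) = w i.
Proof. by rewrite /=; case: ifP. Qed.

Lemma trail_closed x : x \in O -> a x \in O /\ b x \in O.
Proof.
case/trailP=> i le ->.
have up : (if odd i then a else b) (w i) \in O.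
  move: le; rewrite leq_eqVlt => /predU1P[->|lt]; first by rewrite stop trail_in.
  by rewrite track_step // trail_in.
have down : (if odd i then b else a) (w i) \in O.
  case: i le {up} => [_|i le]; first by rewrite /= ay (@trail_in 0).
  by have := track_back i; rewrite [odd i.+1]/= if_neg => ->; apply: trail_in; apply: ltnW.
by case: (odd i) up down.
Qed.

Lemma trail_fixed_a x : x \in O -> a x = x -> x = y \/ odd n /\ x = w n.
Proof.
case/trailP=> i le -> fx; case: (posnP i) => [->|i0]; [by left|right].
case: (boolP (odd i)) => oi.
  case: (ltngtP i n) le => // [lt _|<- _]; last by [].
  by have := inj lt (ltnW lt); rewrite -track_step // oi fx => /(_ erefl) /eqP; rewrite eqn_leq ltnn.
case: i i0 le fx oi => // i _ le fx; rewrite /= negbK => oi.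
have := track_back i; rewrite oi fx => /inj h.
by have := h le (ltnW le) => /eqP; rewrite eqn_leq ltnn.
Qed.

Lemma trail_fixed_b x : x \in O -> b x = x -> ~~ odd n /\ x = w n.
Proof.
case/trailP=> i le -> fx; case: (boolP (odd i)) => oi.
  case: i le fx oi => // i le fx; rewrite /= => oi.
  have := track_back i; rewrite (negbTE oi) fx => /inj h.
  by have := h le (ltnW le) => /eqP; rewrite eqn_leq ltnn.
case: (ltngtP i n) le => // [lt _|<- _]; last by [].
have := inj lt (ltnW lt); rewrite -track_step // (negbTE oi) fx => /(_ erefl) /eqP.
by rewrite eqn_leq ltnn.
Qed.

Lemma trail_back (C : {set D}) i : (forall x, x \in C -> a x \in C /\ b x \in C) ->
  w i \in C -> y \in C.
Proof.
move=> cl; elim: i => // i IH /cl[aC bC]; apply: IH.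
by have := track_back i; case: ifP => _ <-.
Qed.

End Trail.

Definition switch O f g x := if x \in O then f x else g x.

Lemma switch_inv O f g : involutive f -> involutive g ->
  (forall x, x \in O -> f x \in O) -> (forall x, x \in O -> g x \in O) -> involutive (switch O f g).
Proof.
move=> jf jg cf cg x; rewrite /switch; case: (boolP (x \in O)) => xO; first by rewrite cf.
by rewrite ifN //; apply: contra xO => /cg; rewrite jg.
Qed.

Lemma odd_moved f (C : {set D}) : involutive f -> (forall x, x \in C -> f x \in C) ->
  odd #|C| = odd #|[set x in C | f x == x]|.
Proof.
move=> jf; have [n] := ubnP #|C|; elim: n C => // n IH C lt cl.
case: (pickP (fun x => (x \in C) && (f x != x))) => [x /andP[xC fx]|none]; last first.
  by congr odd; apply: eq_card => x; rewrite inE; have := none x; case: (x \in C) => //= /negbFE->.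
have fxC : f x \in C :\ x by rewrite !inE fx cl.
have := cardsD1 x C; rewrite (cardsD1 (f x) (C :\ x)) xC fxC => cC.
have -> : #|[set u in C | f u == u]| = #|[set u in (C :\ x) :\ f x | f u == u]|.
  apply: eq_card => u; rewrite !inE; case: (eqVneq u (f x)) => [->|_] /=.
    by rewrite jf eq_sym (negbTE fx) andbF.
  by case: (eqVneq u x) => [->|_] //=; rewrite (negbTE fx) andbF.
rewrite -IH ?cC ?addnA ?oddD //=; first by move: lt; rewrite cC; clear; lia.
move=> u; rewrite !inE => /and3P[ufx ux uC]; rewrite cl // andbT.
by rewrite (inj_eq (inv_inj jf)) ux /=; apply: contraNneq ufx => <-; rewrite jf.
Qed.

End Involutions.

Section TutteBerge.
Variable D : finType.
Implicit Types (e : rel D) (f g h : D -> D) (u v x y z : D) (A O U : {set D}).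

(* Matchings are encoded as involutions; the unmatched vertices are the fixed points. *)
Definition matching e A f :=
  [/\ involutive f, forall x, f x != x -> x \in A & forall x, f x != x -> e x (f x)].

Definition unm A f := [set x in A | f x == x].

Definition maxmatching e A f :=
  matching e A f /\ forall g, matching e A g -> #|unm A f| <= #|unm A g|.

Lemma matching_id e A : matching e A id.
Proof. by split=> // x; rewrite eqxx. Qed.

Lemma matching_in e A f x : matching e A f -> x \in A -> f x \in A.
Proof.
move=> [jf fA _] xA; case: (eqVneq (f x) x) => [->//|fx]; apply: fA.
by rewrite jf eq_sym.
Qed.

Lemma matching_sub e A A' f : A \subset A' -> matching e A f -> matching e A' f.
Proof. by move=> /subsetP AA' [jf fA fe]; split=> // x /fA/AA'. Qed.

Lemma maxmatching_exists e A : exists f, maxmatching e A f.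
Proof.
have [|f [mf minf]] := @ex_argmin _ (matching e A) (fun f => #|unm A f|).
  by exists id; apply: matching_id.
by exists f; split.
Qed.

Lemma matching_switch e A O f g : matching e A f -> matching e A g ->
  (forall x, x \in O -> f x \in O) -> (forall x, x \in O -> g x \in O) ->
  matching e A (switch O f g).
Proof.
move=> [jf fA fe] [jg gA ge] cf cg; split; first exact: switch_inv.
  by move=> x; rewrite /switch; case: ifP => _; [apply: fA|apply: gA].
by move=> x; rewrite /switch; case: ifP => _; [apply: fe|apply: ge].
Qed.

Lemma track_matching e A f g y i : matching e A f -> matching e A g -> y \in A ->
  track f g y i \in A.
Proof.
move=> mf mg yA; elim: i => //= i IH.
by case: ifP => _; [apply: matching_in mf _|apply: matching_in mg _].
Qed.

(** The alternating path from [y] ends at a vertex missed by [f], for otherwise it would augment the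
    matching that misses [y]. Exchanging along it frees [y], and the path contains at most one of
    [x] and [z]. *)
Lemma gallai_exchange e A f x y z : y \in A ->
  (exists2 g, maxmatching e A g & g y = y) -> maxmatching e A f -> f x = x -> f z = z -> x != z ->
  exists2 g, maxmatching e A g & g y = y /\ (g x = x \/ g z = z).
Proof.
move=> yA [a [ma amax] ay] [mb bmax]; set b := f in mb bmax * => bx bz xz.
have [ia _ _] := ma; have [ib _ _] := mb.
have [n [inj stop]] := dihedral ia ib ay; set O := trail a b y n.
have cl u : u \in O -> a u \in O /\ b u \in O by apply: trail_closed.
have cla u : u \in O -> a u \in O by case/cl.
have clb u : u \in O -> b u \in O by case/cl.
have yO : y \in O by apply: (@trail_in D a b y n 0).
have wO : track a b y n \in O by apply: trail_in.
have wA : track a b y n \in A by apply: track_matching ma mb yA.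
case: (boolP (odd n)) => on.
  have m' := matching_switch mb ma clb cla; have := amax _ m'.
  rewrite leqNgt => /negP[]; apply: proper_card; apply/properP; split.
    apply/subsetP=> u; rewrite !inE /switch; case: ifP => // uO /andP[-> /eqP bu].
    by have [] := trail_fixed_b ia ib inj uO bu; rewrite on.
  exists y; rewrite !inE yA /=; first by apply/eqP.
  by rewrite /switch yO; apply/eqP=> /(trail_fixed_b ia ib inj yO)[]; rewrite on.
rewrite (negbTE on) in stop.
have m' := matching_switch ma mb cla clb; exists (switch O a b).
  split=> // g mg; apply: leq_trans (bmax g mg).
  have wB : track a b y n \in unm A b by rewrite inE wA stop eqxx.
  rewrite [leqRHS](cardsD1 (track a b y n)) wB.
  apply: leq_trans (subset_leq_card (_ : _ \subset y |: (unm A b :\ track a b y n))) _.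
    apply/subsetP=> u; rewrite !inE /switch; case: ifP => uO /andP[-> eu] /=.
      by case: (trail_fixed_a ia ib inj uO (eqtype.eqP eu)) => [->|[]]; rewrite ?eqxx // (negbTE on).
    by rewrite eu andbT; apply/orP; right; apply: contraFneq uO => ->.
  by rewrite cardsU1 leq_add2r leq_b1.
rewrite /switch yO ay; split=> //.
case: (boolP (x \in O)) => xO; last by left.
case: (boolP (z \in O)) => zO; last by right.
have [_ xw] := trail_fixed_b ia ib inj xO bx; have [_ zw] := trail_fixed_b ia ib inj zO bz.
by rewrite xw zw eqxx in xz.
Qed.

Lemma max_nonadjacent e A f x y : symmetric e -> irreflexive e -> maxmatching e A f ->
  x \in A -> y \in A -> f x = x -> f y = y -> ~~ e x y.
Proof.
move=> se ie [[jf fA fe] fmax] xA yA fx fy; apply/negP=> xy.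
have nxy : x != y by apply: contraTneq xy => ->; rewrite ie.
pose g u := if u == x then y else if u == y then x else f u.
have fE u v : f v = v -> (f u == v) = (u == v).
  by move=> fv; rewrite -{1}fv (inj_eq (inv_inj jf)).
have mg : matching e A g.
  split=> u; rewrite /g.
  - case: (eqVneq u x) => [->|ux]; first by rewrite eq_sym (negbTE nxy) eqxx.
    case: (eqVneq u y) => [->|uy]; first by rewrite eqxx.
    by rewrite !fE // (negbTE ux) (negbTE uy) jf.
  - case: (eqVneq u x) => [->//|ux]; case: (eqVneq u y) => [->//|uy]; exact: fA.
  - case: (eqVneq u x) => [->//|ux]; case: (eqVneq u y) => [->|uy]; last exact: fe.
    by rewrite se.
have := fmax g mg; rewrite leqNgt => /negP[]; apply: proper_card; apply/properP; split.
  apply/subsetP=> u; rewrite !inE /g => /andP[-> /=].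
  case: (eqVneq u x) => [->|ux]; first by rewrite fx eqxx.
  by case: (eqVneq u y) => [->|uy] //; rewrite fy eqxx.
by exists x; rewrite !inE xA /= ?fx ?eqxx // /g eqxx eq_sym.
Qed.

(** Gallai's lemma, by induction along the walk. Some maximum matching misses the second vertex and
    one end of the walk: missing [x] contradicts adjacency, and missing the other end reduces to the
    shorter walk. *)
Lemma gallai_critical e A p x f : symmetric e -> irreflexive e ->
  (forall z, z \in A -> exists2 g, maxmatching e A g & g z = z) ->
  path e x p -> {subset x :: p <= A} -> maxmatching e A f -> f x = x ->
  f (last x p) = last x p -> x = last x p.
Proof.
move=> se ie crit; elim: p x f => //= z p IH x f /andP[xz pth] sub mf fx fy.
have xA : x \in A by apply: sub; rewrite inE eqxx.
have zA : z \in A by apply: sub; rewrite !inE eqxx orbT.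
have sub' : {subset z :: p <= A} by move=> u up; apply: sub; rewrite inE up orbT.
apply/eqP; apply: contraT => ne.
have [g mg [gz [gx|gy]]] := gallai_exchange zA (crit z zA) mf fx fy ne.
  by have := max_nonadjacent se ie mg xA zA gx gz; rewrite xz.
have zy := IH z g pth sub' mg gz gy.
by have := max_nonadjacent se ie mf xA zA fx; rewrite zy fy -zy xz => /(_ erefl).
Qed.

(** The vertices missed by [g] lie in distinct components of [A :\: U] and stand for the odd
    components. When Gallai's lemma does not apply, some vertex is covered by every maximum matching
    and goes into [U]. *)
Theorem tutte_berge e A : symmetric e -> irreflexive e -> exists U f g,
  [/\ U \subset A, matching e A f, matching e (A :\: U) g,
      #|unm A f| + #|U| <= #|unm (A :\: U) g|
    & {in unm (A :\: U) g &, forall x y, conn e (A :\: U) x y -> x = y}].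
Proof.
move=> se ie; have [n] := ubnP #|A|; elim: n A => // n IH A lt.
case: (classic (forall z, z \in A -> exists2 g, maxmatching e A g & g z = z)) => [crit|].
  have [f mf] := maxmatching_exists e A; have [mf1 _] := mf.
  exists set0, f, f; rewrite setD0 cards0 addn0; split=> //; first exact: sub0set.
  move=> x y; rewrite !inE => /andP[xA /eqP fx] /andP[yA /eqP fy] /(conn_path xA).
  move=> [p [pth eqy _ sub]]; rewrite -eqy in fy *; exact: gallai_critical crit pth sub mf fx fy.
move=> ncrit; have [v vA cov] : exists2 v, v \in A & forall g, maxmatching e A g -> g v != v.
  apply: NNPP => none; apply: ncrit => z zA; apply: NNPP => none'; apply: none; exists z => // g mg.
  by apply/eqP=> gz; apply: none'; exists g.
have cA := cardsD1 v A; rewrite vA in cA.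
have [|U [f [g [UA mf mg le H]]]] := IH (A :\ v).
  by move: lt; rewrite cA; clear; lia.
have vU : v \notin U by apply/negP=> /(subsetP UA); rewrite !inE eqxx.
have eqD : A :\: (v |: U) = (A :\ v) :\: U by rewrite setDDl.
have [h [mh hmax]] := maxmatching_exists e A.
have mfA : matching e A f by apply: matching_sub mf; apply: subD1set.
have fv : f v = v.
  by apply/eqP; apply: contraT; have [_ fA _] := mf; move=> /fA; rewrite !inE eqxx.
have cf : #|unm A f| = #|unm (A :\ v) f|.+1.
  rewrite (cardsD1 v) !inE vA fv eqxx add1n; congr _.+1; apply: eq_card => u.
  by rewrite !inE andbA.
have lt2 : #|unm A h| < #|unm A f|.
  rewrite ltn_neqAle hmax // andbT; apply/eqP=> eqc.
  have := cov f; rewrite fv eqxx => /(_ _)/negP[] //; split=> // k mk.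
  by rewrite -eqc; apply: hmax.
(* The numbers of missed vertices have the same parity, so the strict improvement is by at least
   two, which pays for [v] in [U]. *)
have par : odd #|unm A h| = odd #|unm A f|.
  have cl k : matching e A k -> forall x, x \in A -> k x \in A by move=> mk x; apply: matching_in mk.
  have [jh _ _] := mh; have [jf _ _] := mf.
  by rewrite /unm -(odd_moved jh (cl _ mh)) -(odd_moved jf (cl _ mfA)).
exists (v |: U), h, g; rewrite eqD; split=> //.
  by rewrite subUset sub1set vA (subset_trans UA) // subD1set.
rewrite cardsU1 vU; apply: leq_trans le; move: lt2 par; rewrite cf.
by clear; lia.
Qed.

End TutteBerge.

(** * Ears of the wrong parity *)

Lemma skolem (A B : Type) (b0 : B) (P : A -> Prop) (Q : A -> B -> Prop) :
  (forall a, P a -> exists b, Q a b) -> exists f, forall a, P a -> Q a (f a).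
Proof.
move=> H; exists (fun a => epsilon (inhabits b0) (Q a)) => a /H; exact: epsilon_spec.
Qed.

(** An element conflicts only with itself and one partner, so every choice discards at most two
    elements. *)
Lemma greedy_spread (D : finType) (d0 : D) (R : D -> D -> Prop) (B : {set D}) (pt : D -> D) N :
  (forall x y, x \in B -> y \in B -> y != x -> y != pt x -> R x y /\ R y x) ->
  2 * N <= #|B| -> exists g : nat -> D, (forall i, i < N -> g i \in B) /\
  forall i j, i < N -> j < N -> i != j -> R (g i) (g j).
Proof.
elim: N B => [|N IH] B H le; first by exists (fun=> d0).
have [x xB] : exists x, x \in B by apply/card_gt0P; apply: leq_trans le; rewrite muln_gt0.
have sub : (B :\ x) :\ pt x \subset B by apply: subset_trans (subD1set _ _) (subD1set _ _).
have [||g [gB gR]] := IH ((B :\ x) :\ pt x).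
- by move=> u v uB vB; apply: H; apply: (subsetP sub).
- have := cardsD1 x B; have := cardsD1 (pt x) (B :\ x); rewrite xB.
  by move: le; case: (_ \in _); clear; lia.
have xg i : i < N -> R x (g i) /\ R (g i) x.
  move=> /gB gi; apply: H => //; first exact: (subsetP sub).
    by move: gi; rewrite !inE => /and3P[].
  by move: gi; rewrite !inE => /and3P[].
exists (fun i => if i is i'.+1 then g i' else x); split.
  by case=> // i lt; apply: (subsetP sub); apply: gB.
by case=> [|i] [|j] //= li lj ij; [apply: (proj1 (xg j lj))|apply: (proj2 (xg i li))|apply: gR].
Qed.

Definition ear (T : finType) (e : rel T) (W K : {set T}) x c y :=
  [/\ x \in K, y \in K, x != y, path e x (rcons c y) & uniq c /\ {subset c <= W}].

(* The ear has size c + 1 edges: its length has the wrong parity for the colours of its ends. *)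
Definition wrong (T : Type) (col : T -> bool) x (c : seq T) y := odd (size c) = col x (+) col y.

Section DoubleCover.
Variable T : finType.
Variables (e : rel T) (V K : {set T}) (col : T -> bool).
Hypotheses (se : symmetric e) (ie : irreflexive e) (KV : K \subset V).
Local Notation D := (T * bool)%type.
Implicit Types (p q r : D) (u v w x y z : T).

(* Comparing a matching of this cover with the one pairing the two copies of each vertex of
   V \ K gives alternating paths between vertices of K that keep their level along edges of the
   graph and change it at each inner vertex; such a path ends at a copy of the right colour
   exactly when it projects to a wrong ear. *)
Definition cover_verts : {set D} := [set p | (p.1 \in V) && ((p.1 \in K) ==> (p.2 == col p.1))].
Definition cover_edge : rel D :=
  [rel p q | (e p.1 q.1 && (p.2 == q.2)) || ((p.1 == q.1) && (p.2 != q.2))].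
Definition flip p : D := if p.1 \in K then p else (p.1, ~~ p.2).
Local Notation A := cover_verts.
Local Notation h := cover_edge.

Lemma cover_sym : symmetric h.
Proof. by move=> p q; rewrite /cover_edge /= se [q.2 == _]eq_sym [q.1 == _]eq_sym. Qed.

Lemma cover_irr : irreflexive h.
Proof. by move=> p; rewrite /cover_edge /= ie !eqxx. Qed.

Lemma flip_inv : involutive flip.
Proof. by move=> [x b]; rewrite /flip /=; case: (boolP (x \in K)) => [|/negbTE] /= ->; rewrite ?negbK. Qed.

Lemma flip1 p : (flip p).1 = p.1.
Proof. by rewrite /flip; case: ifP. Qed.

Lemma flip_fix p : (flip p == p) = (p.1 \in K).
Proof. by case: p => x b; rewrite /flip /=; case: ifP => _; rewrite ?eqxx // xpair_eqE eqxx; case: b. Qed.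

Lemma flip_in p : p \in A -> flip p \in A.
Proof. by rewrite !inE flip1 /flip; case: ifP => // ->. Qed.

Lemma same_fiber p q : p \in A -> q \in A -> p.1 = q.1 -> q = p \/ q = flip p.
Proof.
case: p q => x b [y c]; rewrite !inE /flip /= => /andP[_ pK] /andP[_ qK] xy.
rewrite -xy in qK *; case: ifP pK qK => /= [_ /eqP-> /eqP->|_ _ _]; first by left.
by case: b; case: c; auto.
Qed.

Section Ears.
Variables (f : D -> D) (p : D) (n : nat).
Hypotheses (mf : matching h A f) (pA : p \in A) (pK : p.1 \in K).
Local Notation w := (track flip f p).
Hypothesis inj : forall i j, i <= n -> j <= n -> w i = w j -> i = j.
Hypothesis stop : (if odd n then flip else f) (w n) = w n.
Hypothesis on : odd n.

Let wA i : w i \in A.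
Proof. by elim: i => //= i IH; case: ifP => _; [apply: flip_in|apply: matching_in mf _]. Qed.

Let nE : n = n./2.*2.+1.
Proof. by rewrite -[LHS]odd_double_half on. Qed.

Let flip_even i : w i.*2.+2 = flip (w i.*2.+1).
Proof. by rewrite /= odd_double. Qed.

(** A matching step inside a fibre would coincide with a flip and repeat a vertex of the trail. So
    it follows an edge of the graph and keeps the level. *)
Let level i : i <= n./2 -> e (w i.*2).1 (w i.*2.+1).1 /\ (w i.*2).2 = (w i.*2.+1).2.
Proof.
move=> le; have lt : i.*2 < n by rewrite nE ltnS leq_double.
have [jf _ fe] := mf.
have fw : f (w i.*2) = w i.*2.+1 by rewrite /= odd_double.
have ne : w i.*2.+1 != w i.*2.
  apply/eqP=> eqf; have := inj lt (ltnW lt) eqf.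
  by move/eqP; rewrite eqn_leq ltnn.
have := fe (w i.*2); rewrite fw => /(_ ne).
move=> /orP[/andP[-> /eqP->]//|/andP[/eqP eq1 _]]; exfalso.
have [eqw|eqw] := same_fiber (wA i.*2) (wA i.*2.+1) eq1.
  by move: ne; rewrite eqw eqxx.
case: i le lt {ne eq1 fw} eqw => [|i] le lt eqw.
  have := inj lt (leq0n _); rewrite eqw /flip /= pK => /(_ erefl); by [].
rewrite doubleS flip_even flip_inv in eqw.
have lt' : i.*2.+1 <= n by move: lt; rewrite doubleS; clear; lia.
by have := inj lt lt' eqw; clear; lia.
Qed.

(** Only odd positions are listed, since an inner vertex shows up as two consecutive copies joined
    by a flip. *)
Definition trail_interior := mkseq (fun i => (w i.*2.+1).1) n./2.

Lemma trail_path : rcons trail_interior (w n).1 = mkseq (fun i => (w i.*2.+1).1) (n./2).+1.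
Proof. by rewrite /trail_interior /mkseq -[in RHS]addn1 iotaD map_cat add0n cats1 {2}nE. Qed.

(** Equal projections mean equal copies or flipped ones, and the flipped copy already has its own
    place on the trail; injectivity of the trail therefore makes the projection simple. *)
Lemma trail_ear : ear e (V :\: K) K p.1 trail_interior (w n).1.
Proof.
have nK : (w n).1 \in K by have := stop; rewrite on -flip_fix => ->.
split=> //.
- apply/eqP=> /(same_fiber pA (wA n)) eqw.
  have : w n = w 0 by case: eqw => ->; rewrite // /flip pK.
  by move/(inj (leqnn _) (leq0n _)) => n0; have := on; rewrite n0.
- rewrite trail_path; apply/(pathP p.1) => i; rewrite size_mkseq => lt.
  rewrite nth_mkseq //; have [lv _] := level lt; move: lv.
  case: i lt => [|i] lt //; rewrite -nth_behead nth_mkseq; last exact: ltnW.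
  by rewrite doubleS flip_even flip1.
have lt2 i : i < n./2 -> i.*2.+2 <= n by move=> lt; rewrite nE ltnS ltn_double.
split.
  apply/(uniqP p.1) => i j; rewrite !inE size_mkseq => li lj; rewrite !nth_mkseq //.
  have ln k : k < n./2 -> k.*2.+1 <= n by move=> /lt2/ltnW.
  case/(same_fiber (wA _) (wA _)) => [|].
    by move=> /(inj (ln _ lj) (ln _ li)) /eqP; rewrite eqSS => /eqP/double_inj->.
  rewrite -flip_even => /(inj (ln _ lj) (lt2 _ li)); clear; lia.
move=> u /mapP[i]; rewrite mem_iota => /andP[_ lt] ->.
rewrite inE; have := wA i.*2.+1; rewrite inE => /andP[-> _]; rewrite andbT -flip_fix -flip_even.
apply/eqP=> /(inj (lt2 _ lt) (ltnW (lt2 _ lt))); clear; lia.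
Qed.

Lemma trail_wrong : wrong col p.1 trail_interior (w n).1.
Proof.
rewrite /wrong size_mkseq.
have colA q : q \in A -> q.1 \in K -> q.2 = col q.1 by rewrite inE => /andP[_ /implyP H] /H/eqP.
have [_ nK _ _ _] := trail_ear.
have key i : i <= n./2 -> (w i.*2.+1).2 = col p.1 (+) odd i.
  elim: i => [|i IH] le; first by have [_ <-] := level le; rewrite addbF; apply: colA.
  have [_ <-] := level le; rewrite doubleS flip_even /flip.
  have -> : ((w i.*2.+1).1 \in K) = false.
    have [_ _ _ _ [_ sub]] := trail_ear.
    have : (w i.*2.+1).1 \in trail_interior by apply: map_f; rewrite mem_iota.
    by move/sub; rewrite inE => /andP[/negbTE].
  by rewrite /= IH ?(ltnW le) //; case: (col _); case: (odd i).
by rewrite -(colA _ (wA n) nK) {2}nE key // addbA addbb.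
Qed.

Lemma trail_support u : u \in p.1 :: rcons trail_interior (w n).1 ->
  exists2 q, q \in trail flip f p n & q.1 = u.
Proof.
rewrite inE => /predU1P[->|]; first by exists p => //; apply: (@trail_in _ flip f p n 0).
rewrite trail_path => /mapP[i]; rewrite mem_iota => /andP[_ lt] ->.
exists (w i.*2.+1) => //; apply: trail_in.
by rewrite nE ltnS leq_double -ltnS.
Qed.

End Ears.

End DoubleCover.

Section OddEars.
Variable T : finType.
Variables (e : rel T) (V K : {set T}) (col : T -> bool).
Hypotheses (se : symmetric e) (ie : irreflexive e) (KV : K \subset V).
Local Notation D := (T * bool)%type.
Implicit Types (p q r : D) (u v w x y z : T).
Local Notation A := (cover_verts V K col).
Local Notation h := (cover_edge e).
Local Notation flp := (flip K).

Definition support x (c : seq T) y := x :: rcons c y.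

(** A trail starts at every vertex of [K] and ends at an unmatched vertex or at another vertex of
    [K]. At most [#|unm A f|] trails are of the first kind; the others are found once from each end,
    which costs the factor two. *)
Lemma many_ears N f : matching h A f -> 0 < #|K| -> #|unm A f| + 2 * N <= #|K| ->
  exists (x y : nat -> T) (c : nat -> seq T),
  (forall i, i < N -> ear e (V :\: K) K (x i) (c i) (y i) /\ wrong col (x i) (c i) (y i)) /\
  forall i j, i < N -> j < N -> i != j ->
    [disjoint support (x i) (c i) (y i) & support (x j) (c j) (y j)].
Proof.
move=> mf K0 le; have ia := @flip_inv T K; have [jf fA _] := mf.
pose KA := [set p in A | p.1 \in K].
have fixK p : p \in KA -> flp p = p by rewrite inE -flip_fix => /andP[_ /eqP].
have cKA : #|KA| = #|K|.
  rewrite -(card_imset (mem K) (f := fun v => (v, col v))) => [|u v []//].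
  apply: eq_card => -[v b]; rewrite !inE /=; apply/idP/imsetP => [/andP[/andP[_ +] vK]|[u uK [-> ->]]].
    by rewrite vK /= => /eqP->; exists v.
  by rewrite uK (subsetP KV) //= eqxx.
have [n nP] := skolem 0 (fun p (pK : p \in KA) => dihedral ia jf (fixK p pK)).
pose t p := track flp f p (n p); pose O p := trail flp f p (n p).
have pO p : p \in O p by apply: (@trail_in _ flp f p (n p) 0).
have tO p : t p \in O p by apply: trail_in.
have clO p : p \in KA -> forall q, q \in O p -> flp q \in O p /\ f q \in O p.
  by move=> pK q; have [_ stop] := nP p pK; apply: trail_closed => //; apply: fixK.
have meet p q r : p \in KA -> r \in O p -> r \in O q -> q \in O p.
  by move=> pK up /trailP[i _ eqi]; apply: (trail_back (i := i) ia jf (clO p pK)); rewrite -eqi.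
pose B := [set p in KA | odd (n p)].
have BKA p : p \in B -> p \in KA by rewrite inE => /andP[].
have cB : #|KA :\: B| <= #|unm A f|.
  rewrite -(card_in_imset (f := t)).
    apply: subset_leq_card; apply/subsetP=> _ /imsetP[p /setDP[pK pB] ->].
    have np : ~~ odd (n p) by move: pB; rewrite inE pK.
    have [_] := nP p pK; rewrite (negbTE np) -/(t p) => ft; rewrite inE ft eqxx andbT.
    have pA : p \in A by move: pK; rewrite inE => /andP[].
    rewrite /t; elim: (n p) => //= i IH.
    by case: ifP => _; [apply: flip_in|apply: matching_in mf _].
  move=> p q /setDP[pK pB] /setDP[qK qB] eqt.
  have qO : q \in O p by apply: (meet _ _ (t p)); rewrite ?eqt // -eqt.
  have [inj _] := nP p pK; have np : ~~ odd (n p) by move: pB; rewrite inE pK.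
  have [->//|[]] := trail_fixed_a ia jf inj qO (fixK q qK).
  by rewrite (negbTE np).
have BKA' : B \subset KA by apply/subsetP.
have leB : 2 * N <= #|B|.
  have := cardsID B KA; rewrite (setIidPr BKA'); move: cB le; rewrite cKA; clear; lia.
have [p0 p0K] : exists p, p \in KA by apply/card_gt0P; rewrite cKA.
have [||g [gB gR]] := @greedy_spread _ p0 (fun p q => [disjoint O p & O q]) B t N.
- move=> p q pB qB qp qt; rewrite (disjoint_sym (mem (O q))); suff -> : [disjoint O p & O q] by [].
  rewrite -setI_eq0; apply/eqP/setP=> u; rewrite [RHS]inE inE; apply/negP=> /andP[up uq].
  have qO := meet p q u (BKA _ pB) up uq; have [inj _] := nP p (BKA _ pB).
  by case: (trail_fixed_a ia jf inj qO (fixK q (BKA _ qB))) => [|[_]] eqq; rewrite eqq eqxx in qp qt.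
- exact: leB.
have gA i : i < N -> g i \in A /\ (g i).1 \in K.
  by move=> /gB/BKA; rewrite inE => /andP[].
exists (fun i => (g i).1), (fun i => (t (g i)).1), (fun i => trail_interior K f (g i) (n (g i))).
split=> [i lt|i j li lj ij].
  have [giA giK] := gA i lt; have [inj stop] := nP _ (BKA _ (gB i lt)).
  have on : odd (n (g i)) by have := gB i lt; rewrite inE => /andP[].
  by split; [exact: trail_ear mf giA giK inj stop on|exact: trail_wrong mf giA giK inj stop on].
rewrite disjoint_subset; apply/subsetP=> u ui; rewrite inE; apply/negP=> uj.
have on k : k < N -> odd (n (g k)) by move/gB; rewrite inE => /andP[].
have [p pO1 pu] := trail_support (on i li) ui.
have [q qO1 qu] := trail_support (on j lj) uj.
have OA k : k < N -> forall q, q \in O (g k) -> q \in A.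
  move=> lk q' /trailP[m _ ->]; elim: m => [|m IH] /=; first by have [] := gA k lk.
  by case: ifP => _; [apply: flip_in|apply: matching_in mf _].
have qOi : q \in O (g i).
  case: (same_fiber (OA i li p pO1) (OA j lj q qO1)) => [|->//|->]; first by rewrite pu.
  by have [] := clO _ (BKA _ (gB i li)) p pO1.
have := gR i j li lj ij; rewrite disjoint_subset => /subsetP/(_ q qOi).
by rewrite inE qO1.
Qed.

(** Each vertex missed by [g] is moved inside its component to a representative in the fibre of a
    vertex that is not full. Vertices that are neither full nor represented form [X], of size at
    most [#|K| + #|U| - #|F| < 2 N]. Connectivity excludes full vertices, and the level of the
    represented copy is the colour. *)
Lemma barrier_colouring N f : 0 < N -> 2 * N < #|K| ->
  (forall X : {set T}, X \subset V -> #|X| <= 2 * N ->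
     forall x y, x \in V :\: X -> y \in V :\: X -> conn e (V :\: X) x y) ->
  matching h A f -> #|K| < #|unm A f| + 2 * N ->
  forall (U : {set D}) (g : D -> D), U \subset A -> matching h (A :\: U) g -> #|unm A f| + #|U| <= #|unm (A :\: U) g| ->
    {in unm (A :\: U) g &, forall p q, conn h (A :\: U) p q -> p = q} ->
  exists (X : {set T}) (col' : T -> bool), [/\ X \subset V, #|X| < 2 * N &
    forall x y, x \in V :\: X -> y \in V :\: X -> e x y -> col' x != col' y].
Proof.
move=> N0 KN con mf lt U g UA mg le uniqF.
set F := unm (A :\: U) g in le uniqF; have ia := @flip_inv T K; have [jg gA _] := mg.
(* The flip restricted to the surviving copies is still an involution; it also fixes the copies
   whose partner was deleted with [U]. *)
pose flp' p := if (p \in A :\: U) && (flp p \in A :\: U) then flp p else p.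
have ia' : involutive flp'.
  move=> p; rewrite /flp'; case: (boolP ((p \in _) && _)) => [/andP[pA fpA]|/negbTE nA].
    by rewrite ia fpA pA.
  by rewrite nA.
have sh := cover_sym se.
have flpc p : p \in A :\: U -> conn h (A :\: U) p (flp' p).
  move=> pA; rewrite /flp'; case: ifP => [/andP[_ fpA]|_]; last exact: conn_refl.
  case: (eqVneq (flp p) p) => [->|ne]; first exact: conn_refl.
  apply: conn1 => //; rewrite /cover_edge /= flip1 eqxx /=.
  by move: ne; rewrite flip_fix /flip => /negbTE-> /=; case: (p.2); rewrite orbT.
have gc p : p \in A :\: U -> conn h (A :\: U) p (g p).
  move=> pA; case: (eqVneq (g p) p) => [->|ne]; first exact: conn_refl.
  by have [_ _ ge] := mg; apply: conn1 (ge _ ne) pA (matching_in mg pA).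
(* The orbit stays in one component, so it cannot end at a second vertex missed by [g] and must end
   at a fixed point of [flp']. *)
have rP p : p \in F -> exists q : D,
    [/\ q \in A :\: U, conn h (A :\: U) p q & flp' q = q].
  rewrite inE => /andP[pA /eqP gp].
  have [n [inj stop]] := dihedral jg ia' gp.
  have [wA wc] : track g flp' p n \in A :\: U /\ conn h (A :\: U) p (track g flp' p n).
    elim: n {inj stop} => [|n [IH1 IH2]] /=; first by split=> //; apply: conn_refl.
    have st : conn h (A :\: U) p ((if odd n then g else flp') (track g flp' p n)).
      by apply: conn_trans IH2 _; case: ifP => _; [apply: gc|apply: flpc].
    by split; rewrite -?(conn_in st).
  exists (track g flp' p n); split=> //; move: stop; case: (boolP (odd n)) => // on gw.
  have wF : track g flp' p n \in F by rewrite inE wA gw eqxx.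
  have pF : p \in F by rewrite inE pA gp eqxx.
  have := inj n 0 (leqnn _) (leq0n _) (esym (uniqF p _ pF wF wc)) => n0.
  by rewrite n0 in on.
have [k0 _] : exists k, k \in K by apply/card_gt0P; apply: leq_ltn_trans KN.
have {rP}[r rP] := skolem (k0, true) rP.
pose R := r @: F.
have RA q : q \in R -> q \in A :\: U by case/imsetP=> p /rP[? _ _] ->.
have RR : {in R &, forall p q, conn h (A :\: U) p q -> p = q}.
  move=> _ _ /imsetP[p pF ->] /imsetP[q qF ->] c.
  have [_ cp _] := rP p pF; have [_ cq _] := rP q qF.
  congr r; apply: uniqF => //; apply: conn_trans cp (conn_trans c _).
  by rewrite conn_sym.
have Rfl q : q \in R -> q.1 \in K \/ flp q \in U.
  move=> qR; have qA := RA q qR; case/imsetP: qR => p pF eqq.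
  have [_ _] := rP p pF; rewrite -eqq /flp' qA /=; case: ifP => [_ /eqP|].
    by rewrite flip_fix; left.
  move/negbT; rewrite in_setD negb_and negbK => /orP[]; first by right.
  by have /setDP[qA' _] := qA; rewrite flip_in.
pose full v := [&& v \in V, v \notin K, (v, true) \notin U & (v, false) \notin U].
pose Y := [set v in V | ~~ full v]; pose X := Y :\: (fst @: R).
have fstR : {in R &, injective fst}.
  move=> p q pR qR eq1; have /setDP[pA pU] := RA p pR; have /setDP[qA qU] := RA q qR.
  case: (same_fiber pA qA eq1) => // eqq.
  by case: (Rfl p pR) => [pK|]; [rewrite eqq /flip pK|rewrite -eqq (negbTE qU)].
have cR : #|fst @: R| = #|F|.
  rewrite card_in_imset // card_in_imset // => p q pF qF eqr; apply: uniqF => //.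
  have [_ cp _] := rP p pF; have [_ cq _] := rP q qF.
  by apply: conn_trans cp _; rewrite eqr conn_sym.
have RY : fst @: R \subset Y.
  apply/subsetP=> _ /imsetP[q qR ->]; have /setDP[qA qU] := RA q qR.
  have qV : q.1 \in V by move: qA; rewrite inE => /andP[].
  rewrite inE qV /full qV /=; case: (Rfl q qR) => [->//|].
  rewrite /flip; case: ifP => [qK|_]; first by rewrite (negbTE qU).
  by case: q {qR qV qA} qU => v [] /= _ ->; rewrite ?andbF.
have cY : #|Y| <= #|K| + #|U|.
  apply: leq_trans (leq_add (leqnn _) (leq_imset_card fst U)).
  apply: leq_trans (leq_card_setU _ _); apply: subset_leq_card; apply/subsetP=> v.
  rewrite inE => /andP[vV]; rewrite /full vV /= in_setU.
  case: (boolP (v \in K)) => //= vK; rewrite negb_and !negbK => /orP[] vU.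
    by apply/imsetP; exists (v, true).
  by apply/imsetP; exists (v, false).
have cX : #|X| < 2 * N.
  have := cardsID (fst @: R) Y; rewrite (setIidPr RY) cR -/X.
  by move: cY le lt; clear; lia.
have XV : X \subset V by apply/subsetP=> v /setDP[]; rewrite inE => /andP[].
(* The component of a full vertex contains at most one representative. Removing it along with [X],
   at most [2 N] vertices in all, leaves a connected graph in which fullness spreads along edges
   until it reaches a vertex of [K], and those are never full. *)
have nfull v : ~~ full v.
  apply/negP=> vF; have /and4P[vV vK vt vf] := vF.
  have fullA u b : full u -> (u, b) \in A :\: U.
    by move=> /and4P[uV uK ut uf]; rewrite !inE /= uV (negbTE uK) /= andbT; case: b.
  pose Z := X :|: [set u in V | [exists b, ((u, b) \in R) && conn h (A :\: U) (v, true) (u, b)]].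
  have cZ : #|Z| <= 2 * N.
    apply: leq_trans (leq_card_setU _ _) _; apply: leq_trans (leq_add (leqnn _) (_ : _ <= 1)) _.
      apply/card_le1_eqP=> x y; rewrite !inE => /andP[_ /existsP[b /andP[xR xc]]] /andP[_ /existsP[b' /andP[yR yc]]].
      have := RR _ _ xR yR; have c : conn h (A :\: U) (x, b) (y, b').
        by apply: conn_trans yc; rewrite conn_sym.
      by case/(_ c).
    by rewrite addn1.
  have ZV : Z \subset V.
    by rewrite subUset XV; apply/subsetP=> u; rewrite inE => /andP[].
  have [k kK kZ] : exists2 k, k \in K & k \notin Z.
    apply: NNPP => none; move: KN; rewrite ltnNge => /negP[]; apply: leq_trans cZ.
    by apply: subset_leq_card; apply/subsetP=> k kK; apply: contraT => kZ; case: none; exists k.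
  have vZ : v \in V :\: Z.
    rewrite inE vV andbT in_setU negb_or; apply/andP; split.
      by rewrite !inE vF andbF andbF.
    rewrite inE vV /=; apply/existsP=> -[b /andP[vR _]].
    by case: (Rfl _ vR) => /=; [apply/negP|rewrite /flip /= (negbTE vK); case: b {vR} => /=; apply/negP].
  have kVZ : k \in V :\: Z by rewrite inE kZ (subsetP KV).
  have /(conn_path vZ)[s [pth eqk _ sub]] := con Z ZV cZ v k vZ kVZ.
  have : full (last v s) && conn h (A :\: U) (v, true) (last v s, true).
    elim/last_ind: s pth sub {eqk} => [|s w IH]; first by rewrite vF conn_refl.
    rewrite rcons_path last_rcons => /andP[pth lw] sub.
    have [|lF lc] := andP (IH pth _).
      by move=> u us; apply: sub; rewrite -rcons_cons mem_rcons inE us orbT.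
    have /setDP[wV] : w \in V :\: Z by apply: sub; rewrite -rcons_cons mem_rcons inE eqxx.
    rewrite in_setU negb_or => /andP[wX]; rewrite inE wV /= => /existsP nw.
    case: (boolP (full w)) => wF /=.
      apply: conn_trans lc _; apply: conn1; [|exact: fullA|exact: fullA].
      by rewrite /cover_edge /= lw.
    have : w \in fst @: R by apply: contraT => nR; move: wX; rewrite !inE nR wV wF.
    case/imsetP=> -[w' b] qR /= eqw; rewrite -{}eqw in qR; case: nw; exists b; rewrite qR /=.
    apply: conn_trans lc _; apply: (@conn_trans _ _ _ (last v s, b)).
      case: b {qR}; first exact: conn_refl.
      apply: conn1; [|exact: fullA|exact: fullA].
      by rewrite /cover_edge /= eqxx orbT.
    by apply: conn1 (fullA _ _ lF) (RA _ qR); rewrite /cover_edge /= lw eqxx.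
  by rewrite eqk => /andP[/and4P[_ /negP[]]].
(* Adjacent vertices represented at the same level would have their representatives in one
   component, hence equal. *)
exists X, (fun v => (v, true) \in R); split=> // x y /setDP[xV xX] /setDP[yV yX] xy.
have inR v : v \in V -> v \notin X -> exists b, (v, b) \in R.
  move=> vV vX; have : v \in fst @: R by apply: contraT => nR; move: vX; rewrite !inE nR vV nfull.
  by case/imsetP=> -[v' b] qR /= ->; exists b.
apply/eqP=> eqc; suff [b [xR yR]] : exists b, (x, b) \in R /\ (y, b) \in R.
  have := RR _ _ xR yR; have c : conn h (A :\: U) (x, b) (y, b).
    by apply: conn1 (RA _ xR) (RA _ yR); rewrite /cover_edge /= xy eqxx.
  by case/(_ c) => eqxy; rewrite eqxy ie in xy.
have [bx xR] := inR x xV xX; have [b y_R] := inR y yV yX.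
case: (boolP ((x, true) \in R)) eqc => [xt /esym yt|xf /esym/negbT yf]; first by exists true.
exists false; split; first by case: bx xR => // xR; rewrite xR in xf.
by case: b y_R => // yR; rewrite yR in yf.
Qed.

Theorem odd_ears_or_colouring N : 0 < N -> 2 * N < #|K| ->
  (forall X : {set T}, X \subset V -> #|X| <= 2 * N ->
     forall x y, x \in V :\: X -> y \in V :\: X -> conn e (V :\: X) x y) ->
  (exists (x y : nat -> T) (c : nat -> seq T),
    (forall i, i < N -> ear e (V :\: K) K (x i) (c i) (y i) /\ wrong col (x i) (c i) (y i)) /\
    forall i j, i < N -> j < N -> i != j ->
      [disjoint support (x i) (c i) (y i) & support (x j) (c j) (y j)]) \/
  exists (X : {set T}) (col' : T -> bool), [/\ X \subset V, #|X| < 2 * N &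
    forall x y, x \in V :\: X -> y \in V :\: X -> e x y -> col' x != col' y].
Proof.
move=> N0 KN con.
have [U [f [g [UA mf mg le uniqF]]]] := tutte_berge A (cover_sym se) (cover_irr ie).
case: (leqP (#|unm A f| + 2 * N) #|K|) => [lef|ltf]; [left|right].
  by apply: many_ears mf _ lef; apply: leq_ltn_trans KN.
exact: barrier_colouring mf ltf U g UA mg le uniqF.
Qed.

End OddEars.

(** * A dense bipartite hub *)

Section Hub.
Variable T : finType.
Implicit Types (e : rel T) (A B K V W X Y Z : {set T}) (u v x y z : T) (col : T -> bool).

Lemma sum_deg_rho e V : \sum_(v in V) deg e V v = rho e V V.
Proof.
rewrite sum_deg; apply: eq_card => p; rewrite !inE.
by case: (p.1 \in V); case: (p.2 \in V); case: (e _ _).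
Qed.

Lemma rho_remove e V v : symmetric e -> irreflexive e -> v \in V ->
  rho e V V = rho e (V :\ v) (V :\ v) + 2 * deg e V v.
Proof.
move=> se ie vV; rewrite -!sum_deg_rho (big_setD1 v vV) /=.
have d1 x : deg e V x = deg e (V :\ v) x + e x v.
  rewrite /deg (cardsD1 v) inE vV addnC; congr (_ + _); apply: eq_card => y.
  by rewrite !inE andbA.
rewrite (eq_bigr (fun x => deg e (V :\ v) x + e x v)) => [|x _]; last exact: d1.
rewrite big_split /=; set S := \sum_(i in _) deg _ _ _.
have -> : \sum_(x in V :\ v) (e x v : nat) = deg e V v.
  rewrite -big_mkcondr sum1_card; apply: eq_card => y; rewrite !inE unfold_in !inE se.
  by case: eqP => [->|_] //=; rewrite ie andbF.
by clear; lia.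
Qed.

Definition bichromatic e col : rel T := [rel x y | e x y && (col x != col y)].

Lemma bichromatic_sym e col : symmetric e -> symmetric (bichromatic e col).
Proof. by move=> se x y; rewrite /bichromatic /= se eq_sym. Qed.

Lemma bichromatic_irr e col : irreflexive (bichromatic e col).
Proof. by move=> x; rewrite /bichromatic /= eqxx andbF. Qed.

(** Changing the colour of [v] alone exchanges its bichromatic and monochromatic edges and cannot
    enlarge a maximum cut. *)
Lemma max_cut e V : symmetric e -> irreflexive e -> exists col, forall v, v \in V ->
  deg e V v <= 2 * deg (bichromatic e col) V v.
Proof.
move=> se ie; have [|col [_ maxc]] := @ex_argmax (T -> bool) (fun=> True)
    (fun col => rho (bichromatic e col) V V) #|{: T * T}| (ex_intro _ (fun=> true) I).
  by move=> col _; apply: max_card.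
exists col => v vV; pose col' u := if u == v then ~~ col v else col u.
have le := maxc col' Logic.I.
have sb c := bichromatic_sym c se; have ib c := @bichromatic_irr e c.
rewrite (rho_remove (sb _) (ib col') vV) (rho_remove (sb _) (ib col) vV) in le.
have eq0 : rho (bichromatic e col) (V :\ v) (V :\ v) <= rho (bichromatic e col') (V :\ v) (V :\ v).
  apply: rho_le => x y /andP[xy cxy] xV yV _; rewrite xV yV /bichromatic /= xy /= andbT.
  by move: xV yV; rewrite !inE /col' => /andP[/negbTE-> _] /andP[/negbTE-> _].
have : deg e V v <= deg (bichromatic e col) V v + deg (bichromatic e col') V v.
  apply: leq_trans (leq_card_setU _ _); apply: subset_leq_card; apply/subsetP=> y.
  rewrite !inE /bichromatic /= => /andP[-> vy]; rewrite vy /= /col' eqxx.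
  case: (eqVneq y v) => [yv|_]; first by rewrite yv ie in vy.
  by case: (col v); case: (col y).
by move: le eq0; clear; lia.
Qed.

Lemma rho_bichromatic e col V : 2 * rho (bichromatic e col) V V <= #|V| * #|V|.
Proof.
pose V1 := [set v in V | col v]; pose V0 := V :\: V1.
have cV : #|V1| + #|V0| = #|V|.
  by rewrite -(cardsID V1 V) (setIidPr _) //; apply/subsetP=> v; rewrite inE => /andP[].
have le : rho (bichromatic e col) V V <= #|V1| * #|V0| + #|V0| * #|V1|.
  rewrite -!cardsX; apply: leq_trans (leq_card_setU _ _); apply: subset_leq_card.
  apply/subsetP=> -[x y]; rewrite !inE /bichromatic /= => /and4P[/andP[_ cxy] xV yV _].
  by rewrite xV yV /=; case: (col x) (col y) cxy => [] [].
rewrite -cV; move: le; move: #|V1| #|V0| (rho _ _ _) => a b r; clear.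
by have [h _] := nat_AGM2 a b; move: h; rewrite -mulnn; nia.
Qed.

Lemma superset_of_card Z K n : Z \subset K -> #|Z| <= n -> n <= #|K| ->
  exists X, [/\ Z \subset X, X \subset K & #|X| = n].
Proof.
have [d] := ubnP (n - #|Z|); elim: d Z => // d IH Z lt ZK leZ leK.
case: (ltngtP #|Z| n) leZ => // [ltZ _|eqZ _]; last by exists Z.
have [x xKZ] : exists x, x \in K :\: Z.
  by apply/card_gt0P; have := cardsID Z K; rewrite (setIidPr ZK); move: ltZ leK; clear; lia.
have /setDP[xK xZ] := xKZ.
have cx : #|x |: Z| = #|Z|.+1 by rewrite cardsU1 xZ.
have [||||X [ZX XK cX]] := IH (x |: Z).
- by move: lt ltZ; rewrite cx; clear; lia.
- by rewrite subUset sub1set xK.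
- by rewrite cx.
- exact: leK.
by exists X; split=> //; apply: subset_trans (subsetUr _ _) ZX.
Qed.

(** Enlarging [Z] to exactly [4 k] vertices makes the last clause of massedness automatic:
    separations of smaller order have an empty far side. With [m = 2 k] the density [12 m] becomes
    [24 k]. *)
Lemma lk_of_hub k e K : 0 < k -> symmetric e -> irreflexive e -> 4 * k <= #|K| ->
  (forall X, X \subset K -> #|X| = 4 * k -> 24 * k * #|K :\: X| < rho e K (K :\: X)) ->
  (forall A B, sepn e K A B -> #|A :&: B| < 4 * k -> A :\: B != set0 -> B \subset A) ->
  forall Z, Z \subset K -> #|Z| <= 4 * k -> lk e (K :\: Z) Z.
Proof.
move=> k0 se ie le dense nosep Z ZK cZ.
have [X [ZX XK cX]] := superset_of_card ZK cZ le.
apply: (@lk_mono _ e e (K :\: X) _ X) => //; first exact: setDS.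
apply: (@massed_lk _ (2 * k)) => //; rewrite ?muln_gt0 ?cX ?mulnA //.
split=> //; first exact: dense.
move=> A B S XA; rewrite cX => lt; have ltA : #|A :&: B| < #|A|.
  by apply: leq_trans lt _; rewrite -cX; apply: subset_leq_card.
have nz : A :\: B != set0 by rewrite -card_gt0; have := cardsID B A; move: ltA; clear; lia.
have BA := nosep A B S lt nz; have -> : B :\: A = set0 by apply/eqP; rewrite setD_eq0.
rewrite /rho (_ : [set p | _] = set0) ?cards0 //.
by apply/setP=> p; rewrite !inE !andbF.
Qed.

Theorem hub_exists k e V : 0 < k -> symmetric e -> irreflexive e -> V != set0 ->
  (forall v, v \in V -> 49 * k <= deg e V v) ->
  exists K col, [/\ K \subset V, 44 * k < #|K| &
    forall Z, Z \subset K -> #|Z| <= 4 * k -> lk (bichromatic e col) (K :\: Z) Z].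
Proof.
move=> k0 se ie V0 degV; have [col cutV] := max_cut V se ie.
set b := bichromatic e col in cutV *.
have sb : symmetric b by apply: bichromatic_sym.
have ib : irreflexive b by apply: bichromatic_irr.
(* In terms of edges: more than [49 k (n - 4 k) / 4] of them on [n] vertices. The offset
   [196 = 49 * 4] is chosen so that, across a separation of order at most [4 k], one of the sides
   inherits the condition. *)
pose P W := [/\ W \subset V, 12 * k <= #|W| & 49 * k * #|W| < 2 * rho b W W + 196 * k * k].
have cV : 49 * k <= #|V|.
  by have [v vV] := set0Pn _ V0; apply: leq_trans (degV v vV) (deg_card _ _ _).
have PV : P V.
  split=> //; first by move: cV; clear; lia.
  have : #|V| * (49 * k) <= 2 * rho b V V.
    rewrite -sum_deg_rho big_distrr -sum_nat_const /=; apply: leq_sum => v vV.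
    exact: leq_trans (degV v vV) (cutV v vV).
  by rewrite mulnC; move: k0; case: k {P cV degV} => // k _; move: (_ * #|V|) => n; clear; lia.
have [|K [[KV cK eK] minK]] := ex_argmin (P := P) (fun W => #|W|); first by exists V.
have bip := rho_bichromatic e col K; rewrite -/b in bip.
(* A bipartite graph has at most [n^2 / 4] edges, so [n^2 - 49 k n + 196 k^2 > 0]. The smaller root
   lies below [12 k] and the larger one above [44 k]. *)
have big : 44 * k < #|K|.
  rewrite ltnNge; apply/negP=> small; move: cK eK bip small.
  by move: #|K| (rho _ _ _) => n r; clear; nia.
have smaller W : W \subset K -> #|W| < #|K| -> 12 * k <= #|W| ->
    2 * rho b W W + 196 * k * k <= 49 * k * #|W|.
  move=> WK lt cW; rewrite leqNgt; apply/negP=> eW.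
  have := minK W; rewrite leqNgt lt => H; have := H (And3 (subset_trans WK KV) cW eW); by [].
(* Removing [v] relaxes the density bound by [49 k] and takes four times the degree of [v] from
   [2 rho]; minimality makes the second quantity the larger one. *)
have degK v : v \in K -> 12 * k < deg b K v.
  move=> vK; have := rho_remove sb ib vK; have cKv := cardsD1 v K; rewrite vK in cKv.
  have := smaller _ (subD1set K v); rewrite cKv => /(_ (ltnSn _)).
  have -> : 12 * k <= #|K :\ v| by move: big k0; rewrite cKv; clear; lia.
  move=> /(_ isT); move: eK; rewrite cKv mulnDr muln1.
  by move: (rho _ _ _) (rho _ _ _) (49 * k * _) => r1 r2 n; move: (196 * k * k) => c; clear; lia.
have nosep A B : sepn b K A B -> #|A :&: B| <= 4 * k -> A :\: B != set0 -> B :\: A != set0 -> False.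
  move=> S le /set0Pn[x xAB] /set0Pn[y yBA]; have [AK BK _] := sepnW S; have [eqK no] := S.
  have /setDP[xA xB] := xAB; have /setDP[yB yA] := yBA.
  have S' : sepn b K B A by split=> [|u v uB vA]; rewrite ?(setUC B) // sb; apply: no.
  have cA : 12 * k <= #|A|.
    apply: leq_trans (ltnW (degK x (subsetP AK x xA))) _; apply: subset_leq_card; apply/subsetP=> u.
    rewrite inE => /andP[uK xu]; exact: (sepn_edge sb S' xAB uK xu).
  have cB : 12 * k <= #|B|.
    apply: leq_trans (ltnW (degK y (subsetP BK y yB))) _; apply: subset_leq_card; apply/subsetP=> u.
    rewrite inE => /andP[uK yu]; exact: (sepn_edge sb S yBA uK yu).
  have ltA : #|A| < #|K| by apply: proper_card; apply/properP; split=> //; exists y => //; apply: (subsetP BK).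
  have ltB : #|B| < #|K| by apply: proper_card; apply/properP; split=> //; exists x => //; apply: (subsetP AK).
  have rAB : rho b K K <= rho b A A + rho b B B.
    apply: leq_trans (leq_card_setU _ _); apply: subset_leq_card; apply/subsetP=> -[u v].
    rewrite !inE /= => /and4P[uv uK vK _]; rewrite uv /=.
    case: (boolP ((u \in B) && (v \in B))) => [/andP[-> ->]|]; first by rewrite /= orbT.
    have inAB z : z \in K -> z \notin B -> z \in A by rewrite -eqK inE => /orP[//|->].
    rewrite negb_and => /orP[uB|vB].
      have uA := inAB u uK uB; have uAB : u \in A :\: B by rewrite inE uA uB.
      by rewrite uA (sepn_edge sb S' uAB vK uv).
    have vA := inAB v vK vB; have vAB : v \in A :\: B by rewrite inE vA vB.
    by rewrite vA (sepn_edge sb S' vAB uK) // sb.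
  have := smaller A AK ltA cA; have := smaller B BK ltB cB; have := cardsUI A B; rewrite eqK.
  move: eK rAB le; move: #|K| #|A| #|B| #|_ :&: _| => n1 n2 n3 n4.
  move: (rho _ _ _) (rho _ _ _) (rho _ _ _) => r1 r2 r3; clear; nia.
exists K, col; split=> //; apply: lk_of_hub => //.
- by move: big; clear; lia.
- move=> X XK cX; have := cardsID X K; rewrite (setIidPr XK) cX => cKX.
  have : rho b K K <= rho b K (K :\: X) + #|X| * #|X|.
    rewrite -cardsX; apply: leq_trans (leq_card_setU _ _); apply: subset_leq_card; apply/subsetP=> -[u v].
    rewrite !inE /= => /and4P[-> -> -> _] /=; rewrite !andbT.
    by case: (u \in X); case: (v \in X).
  rewrite cX; move: big cKX eK; move: #|K| #|_ :\: _| (rho _ _ _) (rho _ _ _) => n d r r'.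
  by clear; nia.
move=> A B S lt nz; rewrite -setD_eq0; apply: contraT => nz'.
by case: (nosep A B S (ltnW lt) nz nz').
Qed.

End Hub.

(** * Rerouting disjoint paths along ears *)

Section Rerouting.
Variable T : finType.
Variables (e : rel T) (V K S : {set T}).
Implicit Types (q : T -> seq T) (u v w x y z s : T) (p c : seq T).
Hypotheses (se : symmetric e) (KV : K \subset V).

Definition path_family q :=
  (forall s, s \in S -> [/\ path e s (q s), uniq (s :: q s), {subset s :: q s <= V},
      last s (q s) \in K & {in belast s (q s), forall u, u \notin K}]) /\
  forall s s' u, s \in S -> s' \in S -> u \in s :: q s -> u \in s' :: q s' -> s = s'.

Lemma menger_family : S \subset V ->
  (forall A B, sepn e V A B -> S \subset A -> K \subset B -> #|S| <= #|A :&: B|) ->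
  exists q, path_family q.
Proof.
move=> SV H; have [W [phi [HW dis]]] := menger SV KV H.
have pP s : s \in S -> exists p, [/\ path e s p, uniq (s :: p), {subset s :: p <= W s},
    last s p \in K & {in belast s p, forall u, u \notin K}].
  move=> sS; have [sW WV WK cs] := HW s sS; have [p [pth eqp up sub]] := conn_path sW cs.
  have pK : phi s \in K by have /setIP[] : phi s \in W s :&: K by rewrite WK inE.
  exists p; rewrite eqp; split=> // u; case/lastP: p pth eqp up sub => // p z _.
  rewrite last_rcons belast_rcons => -> up sub us; apply/negP=> uK.
  have : u \in W s :&: K by rewrite inE uK sub // -rcons_cons mem_rcons inE us orbT.
  by rewrite WK inE => /eqP eqv; move: up; rewrite -rcons_cons rcons_uniq -eqv us.
have [q qP] := skolem [::] pP; exists q; split=> [s sS|s s' u sS sS' us us'].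
  have [pth uq sub lK bK] := qP s sS; split=> // u us; have [_ /subsetP WV _ _] := HW s sS.
  by apply: WV; apply: sub.
have [_ _ sub _ _] := qP s sS; have [_ _ sub' _ _] := qP s' sS'.
apply: contraTeq (sub u us) => ne; have := dis s s' sS sS' ne.
by rewrite disjoint_sym disjoint_subset => /subsetP/(_ u (sub' u us')).
Qed.

Section Ears.
Variables (N : nat) (x y : nat -> T) (c : nat -> seq T).
Local Notation supp i := (support (x i) (c i) (y i)).
Hypothesis ears : forall i, i < N -> ear e (V :\: K) K (x i) (c i) (y i).
Hypothesis dis : forall i j, i < N -> j < N -> i != j -> [disjoint supp i & supp j].

Let same u v := [exists i : 'I_N, (u \in supp i) && (v \in supp i)].

(** Steps within a single ear are free, so minimal cost favours paths that follow an ear once they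
    have met it. *)
Fixpoint cost u p := if p is v :: p' then ~~ same u v + cost v p' else 0.

Lemma cost_cat u p1 p2 : cost u (p1 ++ p2) = cost u p1 + cost (last u p1) p2.
Proof. by elim: p1 u => //= v p1 IH u; rewrite IH addnA. Qed.

Lemma supp_inj i j u : i < N -> j < N -> u \in supp i -> u \in supp j -> i = j.
Proof.
move=> li lj ui uj; apply/eqP; apply: contraTT uj => ij; have := dis li lj ij.
by rewrite disjoint_subset => /subsetP/(_ u ui).
Qed.

Lemma cost_stay i u p : i < N -> u \in supp i -> cost u p = 0 -> last u p \in supp i.
Proof.
move=> li; elim: p u => //= v p IH u ui /eqP; rewrite addn_eq0 => /andP[].
rewrite eqb0 negbK => /existsP[j /andP[uj vj]] /eqP; apply: IH.
by rewrite -(supp_inj (ltn_ord j) li uj ui).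
Qed.

Lemma cost_inside i u p : i < N -> {subset u :: p <= supp i} -> cost u p = 0.
Proof.
move=> li; elim: p u => //= v p IH u sub; rewrite IH => [|z zp]; last first.
  by apply: sub; rewrite inE zp orbT.
have -> // : same u v; apply/existsP; exists (Ordinal li).
by rewrite !sub // !inE eqxx ?orbT.
Qed.

Lemma supp_V i : i < N -> {subset supp i <= V}.
Proof.
move=> /ears[xK yK _ _ [_ sub]] u; rewrite inE mem_rcons inE => /or3P[/eqP->|/eqP->|/sub].
- exact: (subsetP KV).
- exact: (subsetP KV).
- by case/setDP.
Qed.

(* Among all path families take one leaving the ears as rarely as possible: if it met an ear
   without ending on it, the path met first could be diverted to an end of the ear. *)
Lemma reroute : (exists q, path_family q) -> exists q, path_family q /\
  forall i, i < N -> (exists s u, [/\ s \in S, u \in s :: q s & u \in supp i]) ->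
    exists2 s, s \in S & last s (q s) \in supp i.
Proof.
move=> /(ex_argmin (fun q => \sum_(s in S) cost s (q s)))[q [[famq disq] minq]].
exists q; split=> // i li hit; apply: NNPP => none.
have noend s : s \in S -> last s (q s) \notin supp i.
  by move=> sS; apply/negP=> lP; apply: none; exists s.
have [xK yK xy pth [uc sub]] := ears li.
pose a u := [exists s in S, u \in s :: q s].
have aK u : a u -> u \in supp i -> u \notin K.
  case/exists_inP=> s sS us ui; apply/negP=> uK; have [_ _ _ _ bK] := famq s sS.
  have := noend s sS; move: us bK; rewrite lastI mem_rcons inE => /orP[/eqP<-|us bK].
    by rewrite ui.
  by have := bK u us; rewrite uK.
have xi : x i \in supp i by rewrite inE eqxx.
have yi : y i \in supp i by rewrite inE mem_rcons inE eqxx orbT.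
have [p1 [p2 [eqc aL before]]] : exists p1 p2, [/\ rcons (c i) (y i) = p1 ++ p2,
    a (last (x i) p1) & {in belast (x i) p1, forall u, ~~ a u}].
  apply: first_hit; case: hit => s [u [sS us ui]]; apply/hasP; exists u => //.
  by apply/exists_inP; exists s.
set z := last (x i) p1 in aL.
have zi : z \in supp i.
  by have := mem_last (x i) p1; rewrite -/z !inE eqc mem_cat => /orP[->//|->]; rewrite orbT.
have zK := aK z aL zi.
case/lastP: p1 @z eqc aL before zi zK => [z|c1 z' z]; first by rewrite /z /= xK.
rewrite /z last_rcons {z}; move: z' => z eqc aL before zi zK; rewrite belast_rcons in before.
have eqc2 : exists p3, c i = rcons c1 z ++ p3.
  case/lastP: p2 eqc => [|p3 y']; rewrite ?cats0 -?rcons_cat.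
    by move/rcons_inj=> [_ eqy]; rewrite -eqy yK in zK.
  by move/rcons_inj=> [-> _]; exists p3.
have [p3 eqc3] := eqc2.
have c1i u : u \in x i :: c1 -> u \in supp i.
  by rewrite !inE eqc3 rcons_cat mem_cat mem_rcons inE => /orP[->//|->]; rewrite !orbT.
have c1K u : u \in c1 -> u \notin K.
  move=> uc1; have /setDP[] // : u \in V :\: K.
  by apply: sub; rewrite eqc3 mem_cat mem_rcons inE uc1 orbT.
have xc1 : x i \notin c1 by apply: contraTN xK => /c1K.
have [s sS zs] := exists_inP aL.
have [pths us subs lK bK] := famq s sS.
have [r1 [r2 [eqr lr]]] := split_last zs.
(* Since [z] is the first vertex of the ear, seen from [x i], that lies on any path of the family,
   the piece of the ear up to [x i] is untouched. The path through [z] can be diverted along it. *)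
pose r := rcons (rev c1) (x i); pose q' t := if t == s then r1 ++ r else q t.
have pthr : path e z r.
  move: pth; rewrite eqc cat_path => /andP[pth _].
  have := rev_path e (x i) (rcons c1 z); rewrite last_rcons belast_rcons rev_cons -/r.
  rewrite (eq_path (e' := e)) => [->//|u v]; exact: se.
have rE u : (u \in r) = (u \in x i :: c1) by rewrite mem_rcons !inE mem_rev.
have old t u : t \in S -> u \in s :: r1 ++ r -> u \in t :: q t -> t = s.
  move=> tS; rewrite -cat_cons mem_cat => /orP[ur1|ur] ut.
    by apply: (disq t s u) => //; rewrite eqr -cat_cons mem_cat ur1.
  rewrite rE in ur; have := before u ur; rewrite /a => /existsP[]; exists t; by rewrite tS.
have r2n : r2 != [::].
  by apply: contraNneq zK => r20; move: lK; rewrite eqr r20 cats0 lr.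
have fam' : path_family q'.
  split=> [t tS|t t' u tS tS']; rewrite /q'; last first.
    case: (eqVneq t s) => [->|nt]; case: (eqVneq t' s) => [->|nt'] // ut ut'.
    - by rewrite (old t' u).
    - exact: old ut' ut.
    - exact: disq ut ut'.
  case: (eqVneq t s) => [->|nt]; last exact: famq.
  split.
  - rewrite cat_path lr pthr andbT; by move: pths; rewrite eqr cat_path => /andP[].
  - rewrite -cat_cons cat_uniq; apply/and3P; split.
    + by move: us; rewrite eqr -cat_cons cat_uniq => /andP[].
    + apply/hasPn=> u; rewrite rE => ur; have := before u ur; apply: contra => ur1.
      by apply/exists_inP; exists s => //; rewrite eqr -cat_cons mem_cat ur1.
    + rewrite rcons_uniq mem_rev xc1 rev_uniq.
      by move: uc; rewrite eqc3 cat_uniq rcons_uniq => /andP[/andP[]].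
  - move=> u; rewrite -cat_cons mem_cat => /orP[ur1|].
      by apply: subs; rewrite eqr -cat_cons mem_cat ur1.
    by rewrite rE => /c1i; apply: supp_V.
  - by rewrite last_cat last_rcons.
  - move=> u; rewrite -rcons_cat belast_rcons -cat_cons mem_cat mem_rev => /orP[ur1|/c1K//].
    apply: bK; rewrite eqr; case/lastP: r2 r2n {eqr} => // r2 w _.
    by rewrite -rcons_cat belast_rcons -cat_cons mem_cat ur1.
(* The new tail is free of cost. The old one is not, as it starts on the ear at [z] and ends off the
   ear. *)
have := minq q' fam'; rewrite !(big_setD1 s sS) /= leqNgt => /negP[].
have -> : \sum_(t in S :\ s) cost t (q' t) = \sum_(t in S :\ s) cost t (q t).
  by apply: eq_bigr => t /setD1P[ts _]; rewrite /q' (negbTE ts).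
rewrite ltn_add2r /q' eqxx eqr !cost_cat lr ltn_add2l.
rewrite (@cost_inside i) => [|//|u]; last first.
  by rewrite inE rE => /predU1P[->//|]; apply: c1i.
rewrite lt0n; apply/eqP=> /(cost_stay li zi) lastr; have := noend s sS.
by rewrite eqr last_cat lr lastr.
Qed.

(** Each ear that is met contains the end of some path, and ears are disjoint, so at most [#|S|]
    ears are met. *)
Lemma unhit_ears k : (exists q, path_family q) -> #|S| + k <= N ->
  exists q (g : 'I_k -> nat), [/\ path_family q, injective g, forall i, g i < N &
    forall i s u, s \in S -> u \in s :: q s -> u \notin supp (g i)].
Proof.
move=> /reroute[q [fam H]] le.
pose hit (i : 'I_N) := [exists s in S, has (mem (supp i)) (s :: q s)].
pose F := [set i : 'I_N | hit i].
have cF : #|F| <= #|S|.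
  have fP i : i \in F -> exists s, s \in S /\ last s (q s) \in supp i.
    rewrite inE => /exists_inP[s sS /hasP[u us ui]].
    have [|s' sS' ls'] := H i (ltn_ord i); first by exists s, u.
    by exists s'.
  have {fP}[f fP] := skolem (x 0) fP.
  rewrite -(card_in_imset (f := f)); last first.
    move=> i j /fP[_ fi] /fP[_ fj] eqf; rewrite -eqf in fj.
    by apply: val_inj; apply: supp_inj fi fj.
  by apply: subset_leq_card; apply/subsetP=> _ /imsetP[i /fP[fS _] ->].
have cN : k <= #|~: F|.
  by have := cardsC F; rewrite card_ord; move: cF le; clear; lia.
exists q, (fun i => val (enum_val (widen_ord cN i) : 'I_N)); split=> //.
- by move=> i j /val_inj/enum_val_inj/(congr1 val) /= eqij; apply: val_inj.
- by move=> i; apply: ltn_ord.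
- move=> i s u sS us; have := enum_valP (widen_ord cN i); rewrite !inE.
  apply: contra => ui; apply/exists_inP; exists s => //; apply/hasP; by exists u.
Qed.

End Ears.
End Rerouting.

(** * Assembling odd cycles *)

Section Assembly.
Variable T : finType.
Implicit Types (e : rel T) (K S W Z : {set T}) (u v w x y : T) (col : T -> bool).

Lemma joins_path e W x y : symmetric e -> joins e W x y -> exists l,
  [/\ path e x (rcons l y), l != [::], uniq l & {subset l <= W}].
Proof.
move=> se [u [v [uW vW xu yv cuv]]]; have [p [pth lp up sub]] := conn_path uW cuv.
by exists (u :: p); rewrite rcons_path /= xu pth lp se yv.
Qed.

Lemma bichromatic_parity e col x l : path (bichromatic e col) x l ->
  odd (size l) = col x (+) col (last x l).
Proof.
elim: l x => [|y l IH] x /=; first by rewrite addbb.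
by move=> /andP[/andP[_ cxy] /IH ->]; case: (col x) (col y) cxy => [] [] // _; case: (col _).
Qed.

Lemma bichromatic_path e col x l : path (bichromatic e col) x l -> path e x l.
Proof. by apply: sub_path => u v /andP[]. Qed.

Variables (k : nat) (e : rel T) (S K : {set T}) (col : T -> bool).
Variables (p p' d d' : 'I_k -> T) (cp cd : 'I_k -> seq T).
Hypothesis se : symmetric e.
Hypothesis hub : forall Z, Z \subset K -> #|Z| <= 4 * k -> lk (bichromatic e col) (K :\: Z) Z.
Local Notation sP i := (support (p i) (cp i) (p' i)).
Local Notation sD i := (support (d i) (cd i) (d' i)).
Hypothesis earP : forall i, ear e (~: K) K (p i) (cp i) (p' i) /\ wrong col (p i) (cp i) (p' i).
Hypothesis endD : forall i, [/\ d i \in K, d' i \in K & {subset cd i <= ~: K}].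
Hypothesis meetS : forall i, has (mem S) (sP i) \/
  path e (d i) (rcons (cd i) (d' i)) /\ has (mem S) (sD i).
Hypothesis uniqPD : forall i, uniq (sP i ++ sD i).
Hypothesis disPD : forall i j, i != j -> [disjoint sP i ++ sD i & sP j ++ sD j].

Let Z := [set p i | i : 'I_k] :|: [set p' i | i : 'I_k] :|: [set d i | i : 'I_k]
  :|: [set d' i | i : 'I_k].

Let ends i : [/\ p i \in Z, p' i \in Z, d i \in Z & d' i \in Z].
Proof. by rewrite /Z; split; rewrite !in_setU imset_f ?orbT. Qed.

Let ZK : Z \subset K.
Proof.
rewrite /Z !subUset; apply/andP; split; [apply/andP; split; [apply/andP; split|]|];
  apply/subsetP=> _ /imsetP[i _ ->].
- by have [[]] := earP i.
- by have [[]] := earP i.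
- by have [] := endD i.
- by have [] := endD i.
Qed.

Let cZ : #|Z| <= 4 * k.
Proof.
have im (f : 'I_k -> T) : #|[set f i | i : 'I_k]| <= k.
  by rewrite -[leqRHS]card_ord; apply: leq_imset_card.
have -> : 4 * k = k + k + k + k by clear; lia.
by do 3!(apply: leq_trans (leq_card_setU _ _) _; apply: leq_add => //).
Qed.

Let supp_out i u : u \in sP i ++ sD i -> u \notin K :\: Z.
Proof.
rewrite mem_cat /support !(in_cons, mem_rcons) => H; rewrite in_setD negb_and negbK.
have [[_ _ _ _ [_ subP]] _] := earP i; have [_ _ subD] := endD i.
have [pZ p'Z dZ d'Z] := ends i.
have out v : v \in cp i \/ v \in cd i -> v \notin K.
  by case=> [/subP|/subD]; rewrite inE.
case/orP: H => /or3P[/eqP->|/eqP->|uc].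
- by rewrite pZ.
- by rewrite p'Z.
- by rewrite out ?orbT //; left.
- by rewrite dZ.
- by rewrite d'Z.
- by rewrite out ?orbT //; right.
Qed.

(* An ear through S is closed by one link if it is wrong; a right one is closed by two links
   through a wrong ear. *)
Let two i := ~~ has (mem S) (sP i) && (odd (size (cd i)) != col (d i) (+) col (d' i)).
(** Two links are requested for every index. When both ears are used they join [p] to [d] and [p']
    to [d']; otherwise each would close its own ear, and only one of them enters the cycle. *)
Let src (ib : 'I_k * bool) :=
  if ib.2 then (if two ib.1 then p' ib.1 else d ib.1) else p ib.1.
Let tgt (ib : 'I_k * bool) :=
  if ib.2 then d' ib.1 else (if two ib.1 then d ib.1 else p' ib.1).

Let ends_distinct i : uniq [:: p i; p' i; d i; d' i].
Proof.
have := uniqPD i; apply: subseq_uniq; rewrite /support.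
rewrite -[[:: _; _; _; _]]/([:: p i; p' i] ++ [:: d i; d' i]).
by apply: cat_subseq; rewrite /= eqxx sub1seq mem_rcons inE eqxx.
Qed.

Let link_ends f g (i j : 'I_k) : f i \in [:: p i; p' i; d i; d' i] ->
  g j \in [:: p j; p' j; d j; d' j] -> f i = g j -> i = j.
Proof.
have sub t u : u \in [:: p t; p' t; d t; d' t] -> u \in sP t ++ sD t.
  rewrite mem_cat !inE !mem_rcons !inE.
  by case/or4P=> /eqP->; rewrite eqxx ?orbT.
move=> /sub fi /sub gj eqfg; apply/eqP; apply: contraT => ij.
by have := disPD ij; rewrite disjoint_subset => /subsetP/(_ _ fi); rewrite inE eqfg gj.
Qed.

Let src_in i b : src (i, b) \in [:: p i; p' i; d i; d' i].
Proof. by rewrite /src /= !inE; case: b; case: (two i); rewrite eqxx ?orbT. Qed.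

Let tgt_in i b : tgt (i, b) \in [:: p i; p' i; d i; d' i].
Proof. by rewrite /tgt /= !inE; case: b; case: (two i); rewrite eqxx ?orbT. Qed.

Let links : exists W : 'I_k * bool -> {set T}, [/\ forall ib, W ib \subset K :\: Z,
  forall ib jb, ib != jb -> [disjoint W ib & W jb]
  & forall ib, joins (bichromatic e col) (W ib) (src ib) (tgt ib)].
Proof.
have inZ i u : u \in [:: p i; p' i; d i; d' i] -> u \in Z.
  by have [pZ p'Z dZ d'Z] := ends i; rewrite !in_cons in_nil orbF => /or4P[] /eqP->.
apply: (hub ZK cZ).
- by case=> i b; apply: inZ (src_in i b).
- by case=> i b; apply: inZ (tgt_in i b).
- move=> [i b] [j c] eqs.
  have eqij := link_ends (f := fun i => src (i, b)) (g := fun j => src (j, c)) (src_in i b) (src_in j c) eqs.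
  rewrite -eqij in eqs *; congr (_, _); move: eqs (ends_distinct i); rewrite /src /= !inE.
  by case: b; case: c; case: (two i) => //= ->; rewrite eqxx ?orbT ?andbF.
- move=> [i b] [j c] eqs.
  have eqij := link_ends (f := fun i => tgt (i, b)) (g := fun j => tgt (j, c)) (tgt_in i b) (tgt_in j c) eqs.
  rewrite -eqij in eqs *; congr (_, _); move: eqs (ends_distinct i); rewrite /tgt /= !inE.
  by case: b; case: c; case: (two i) => //= ->; rewrite eqxx ?orbT ?andbF.
- move=> [i b] [j c]; apply/eqP=> eqs.
  have eqij := link_ends (f := fun i => src (i, b)) (g := fun j => tgt (j, c)) (src_in i b) (tgt_in j c) eqs.
  rewrite -eqij in eqs *; move: eqs (ends_distinct i); rewrite /src /tgt /= !inE.
  by case: b; case: c; case: (two i) => //= ->; rewrite eqxx ?orbT ?andbF.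
Qed.

(** The link has the right parity for the colours of its two ends and the ear has not, so the
    lengths add up to an odd number. *)
Let close_one x c y l : path e x (rcons c y) -> uniq (support x c y) -> wrong col x c y ->
  path (bichromatic e col) y (rcons l x) -> l != [::] -> uniq l ->
  {in l, forall u, u \notin support x c y} -> has (mem S) (support x c y) ->
  odd_S_cycle e S (support x c y ++ l).
Proof.
move=> pth us wr pl l0 ul dis hS; have par := bichromatic_parity pl.
rewrite last_rcons size_rcons /= in par.
split; last by rewrite has_cat hS.
  split.
  - by rewrite /support size_cat /= size_rcons; case: (l) l0 => // a l' _; clear; rewrite /=; lia.
  - by rewrite cat_uniq us ul andbT; apply/hasPn=> u /dis.
  - by rewrite /= rcons_cat cat_path last_rcons pth; apply: bichromatic_path pl.
rewrite /support size_cat /= size_rcons oddD /= wr.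
by move: par; case: (odd (size l)) => /=; case: (col x); case: (col y).
Qed.

Theorem assemble : exists C : 'I_k -> seq T, (forall i, odd_S_cycle e S (C i)) /\
  (forall i j, i != j -> [disjoint C i & C j]).
Proof.
have [W [WK disW jW]] := links.
suff cyc i : exists c, odd_S_cycle e S c /\
    forall u, u \in c -> u \in sP i ++ sD i \/ u \in W (i, false) :|: W (i, true).
  have [C CP] := skolem [::] (fun i (_ : True) => cyc i).
  exists C; split=> [i|i j ij]; first by have [] := CP i Logic.I.
  have [_ subi] := CP i Logic.I; have [_ subj] := CP j Logic.I.
  rewrite disjoint_subset; apply/subsetP=> u /subi ui; rewrite inE; apply/negP=> /subj uj.
  have WKi t : u \in W (t, false) :|: W (t, true) -> u \in K :\: Z.
    by rewrite inE => /orP[]; apply: (subsetP (WK _)).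
  case: ui uj => ui [] uj.
  - by have := disPD ij; rewrite disjoint_subset => /subsetP/(_ _ ui); rewrite inE uj.
  - by have := supp_out ui; rewrite (WKi _ uj).
  - by have := supp_out uj; rewrite (WKi _ ui).
  have dW b c : u \in W (i, b) -> u \in W (j, c) -> False.
    move=> ub uc; have : (i, b) != (j, c) by rewrite xpair_eqE (negbTE ij).
    by move/disW; rewrite disjoint_subset => /subsetP/(_ _ ub); rewrite inE uc.
  by case/setUP: ui => ui; case/setUP: uj => uj; apply: (dW _ _ ui uj).
have sb := bichromatic_sym col se.
pose G u := u \in sP i ++ sD i \/ u \in W (i, false) :|: W (i, true).
have GP u : u \in sP i -> G u by move=> uP; left; rewrite mem_cat uP.
have GD u : u \in sD i -> G u by move=> uD; left; rewrite mem_cat uD orbT.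
have GW b u : u \in W (i, b) -> G u.
  by move=> uW; right; apply/setUP; case: b uW; [right|left].
have [[pK p'K pp' pthP [ucp subP]] wrP] := earP i.
have uPD := uniqPD i; have [uP nPD uD] := and3P (etrans (esym (cat_uniq _ _)) uPD).
have out b u : u \in W (i, b) -> u \notin sP i ++ sD i.
  by move=> uW; apply: contraL (subsetP (WK _) _ uW) => /supp_out.
have outP b u : u \in W (i, b) -> u \notin sP i.
  by move/out; rewrite mem_cat negb_or => /andP[].
have outD b u : u \in W (i, b) -> u \notin sD i.
  by move/out; rewrite mem_cat negb_or => /andP[].
case: (boolP (two i)) => t2; last first.
  have jP := joins_sym sb (jW (i, false)); have jD := joins_sym sb (jW (i, true)).
  rewrite /src /tgt /= (negbTE t2) in jP jD.
  case: (boolP (has (mem S) (sP i))) => hP.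
    have [l [pl l0 ul sl]] := joins_path sb jP.
    exists (sP i ++ l); split; first by apply: close_one => // u /sl; apply: outP.
    by move=> u; rewrite mem_cat => /orP[/GP|/sl/GW].
  have [|[pthD hD]] := meetS i; first by rewrite (negbTE hP).
  have wrD : wrong col (d i) (cd i) (d' i).
    by move: t2; rewrite /two hP /= negbK => /eqP.
  have [l [pl l0 ul sl]] := joins_path sb jD.
  exists (sD i ++ l); split; first by apply: close_one => // u /sl; apply: outD.
  by move=> u; rewrite mem_cat => /orP[/GD|/sl/GW].
have /andP[hP wD] := t2.
have [|[pthD hD]] := meetS i; first by rewrite (negbTE hP).
have jP := joins_sym sb (jW (i, false)); have jD := jW (i, true).
rewrite /src /tgt /= t2 in jP jD.
have [l2 [pl2 _ ul2 sl2]] := joins_path sb jP.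
have [l1 [pl1 _ ul1 sl1]] := joins_path sb jD.
have par1 := bichromatic_parity pl1; have par2 := bichromatic_parity pl2.
rewrite !last_rcons !size_rcons /= in par1 par2.
have pthD' : path e (d' i) (rcons (rev (cd i)) (d i)).
  have := rev_path e (d i) (rcons (cd i) (d' i)); rewrite last_rcons belast_rcons rev_cons.
  by rewrite (eq_path (e' := e)) => [->//|u v]; apply: se.
pose rD := d' i :: rcons (rev (cd i)) (d i).
have rE : rD = rev (sD i) by rewrite /rD /support rev_cons rev_rcons.
exists (sP i ++ (l1 ++ (rD ++ l2))); split; last first.
  by move=> u; rewrite -/(G u) !mem_cat rE mem_rev => /or4P[/GP|/sl1/GW|/GD|/sl2/GW].
have uniq_all : uniq (sP i ++ (l1 ++ (rD ++ l2))).
  rewrite cat_uniq uP; apply/and3P; split=> //.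
    apply/hasPn=> u; rewrite !mem_cat rE mem_rev => /or3P[/sl1/outP//|uDi|/sl2/outP//].
    by apply: contraL uDi => uPi; apply: contra nPD => uDi; apply/hasP; exists u.
  rewrite cat_uniq ul1; apply/and3P; split=> //.
    apply/hasPn=> u; rewrite mem_cat rE mem_rev => /orP[uDi|/sl2 u2].
      by apply: contraL uDi => /sl1/outD.
    apply/negP=> /sl1 u1; have : (i, true) != (i, false) by rewrite xpair_eqE andbF.
    by move/disW; rewrite disjoint_subset => /subsetP/(_ _ u1); rewrite inE u2.
  rewrite cat_uniq rE rev_uniq uD; apply/and3P; split=> //.
  by apply/hasPn=> u /sl2/outD; rewrite mem_rev.
split; last by rewrite !has_cat rE has_rev hD !orbT.
  split=> //.
    by rewrite !size_cat /support /rD /= !size_rcons; clear; lia.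
  rewrite -[cycle _ _]/(path e (p i) (rcons (rcons (cp i) (p' i) ++ (l1 ++ (rD ++ l2))) (p i))).
  have -> : l1 ++ (rD ++ l2) = rcons l1 (d' i) ++ (rcons (rev (cd i)) (d i) ++ l2).
    by rewrite cat_rcons.
  rewrite !rcons_cat !cat_path !last_rcons pthP pthD' (bichromatic_path pl1).
  by rewrite (bichromatic_path pl2).
(* One of the two ears is wrong, the other one and both links are right: the total is odd. *)
rewrite !size_cat /support /rD /= !size_rcons size_rev !oddD /= wrP.
move: par1 par2 wD; case: (odd (size l1)); case: (odd (size l2)); case: (odd (size (cd i))) => /=;
  by case: (col (p i)); case: (col (p' i)); case: (col (d i)); case: (col (d' i)).
Qed.

End Assembly.

(** * The case of many disjoint wrong ears *)

Section ManyEars.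
Variable T : finType.
Implicit Types (e : rel T) (A B K S V X Z : {set T}) (u v x y z s t : T).

(** The choice is greedy: with [#|P|] candidates at every index, earlier choices never exhaust
    them. *)
Lemma sdr (I : finType) t0 (P : {set I}) (N : I -> {set T}) :
  (forall i, i \in P -> #|P| <= #|N i|) ->
  exists f : I -> T, (forall i, i \in P -> f i \in N i) /\ {in P &, injective f}.
Proof.
have [n] := ubnP #|P|; elim: n P => // n IH P lt H.
have [P0|[i iP]] := set_0Vmem P.
  by exists (fun=> t0); split=> [i|i j]; rewrite P0 inE.
have cP := cardsD1 i P; rewrite iP in cP.
have [||f [fN finj]] := IH (P :\ i).
- by move: lt; rewrite cP; clear; lia.
- by move=> j /setD1P[_ jP]; apply: leq_trans (H j jP); rewrite cP leqnSn.
have [x] : exists x, x \in N i :\: f @: (P :\ i).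
  apply/card_gt0P; have := cardsID (f @: (P :\ i)) (N i); have := H i iP.
  have : #|f @: (P :\ i)| <= #|P :\ i| by apply: leq_imset_card.
  have := subset_leq_card (subsetIr (N i) (f @: (P :\ i))).
  by move: cP; clear; lia.
move=> /setDP[xN xf]; exists (fun j => if j == i then x else f j); split=> [j jP|j l jP lP].
  by case: eqP => [->//|/eqP ji]; apply: fN; rewrite !inE ji.
have new m : m \in P -> m != i -> f m != x.
  by move=> mP mi; apply: contraNneq xf => <-; apply: imset_f; rewrite !inE mi.
case: (eqVneq j i) => [->|ji]; case: (eqVneq l i) => [->|li] //.
- by move=> eqx; have := new l lP li; rewrite -eqx eqxx.
- by move=> eqx; have := new j jP ji; rewrite eqx eqxx.
- by apply: finj; rewrite !inE ?ji ?li.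
Qed.

Lemma sep_conn e V A B x y : symmetric e -> sepn e V A B -> x \in A :\: B ->
  conn e (V :\: (A :&: B)) x y -> y \in A :\: B.
Proof.
move=> se S xAB; have [AV BV VAB] := sepnW S.
have xV : x \in V :\: (A :&: B).
  by have /setDP[xA xB] := xAB; rewrite !inE (subsetP AV) // (negbTE xB) andbF.
move=> /(conn_path xV)[p [pth <- _ sub]]; elim: p x {xV} xAB pth sub => //= z p IH x xAB /andP[xz pth] sub.
apply: IH => //; last by move=> u up; apply: sub; rewrite inE up orbT.
have /setDP[zV] : z \in V :\: (A :&: B) by apply: sub; rewrite !inE eqxx orbT.
rewrite inE negb_and => zAB; have /setDP[xA xB] := xAB.
case: (boolP (z \in A)) zAB => [zA /= zB|zA _]; first by rewrite inE zA zB.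
by case: (sepn_no S xA xB (VAB z zV zA) zA xz).
Qed.

Lemma ear_uniq e K W x c y : ear e W K x c y -> [disjoint W & K] -> uniq (support x c y).
Proof.
move=> [xK yK xy _ [uc sub]] dis.
have out u : u \in K -> u \notin c.
  move=> uK; apply/negP=> /sub uW; move: dis; rewrite disjoint_subset => /subsetP/(_ u uW).
  by rewrite inE uK.
by rewrite /= mem_rcons inE negb_or xy out // rcons_uniq out.
Qed.

Section Connected.
Variables (e : rel T) (n : nat).
Hypotheses (se : symmetric e) (ie : irreflexive e) (con : k_connected e n).

Lemma k_connected_conn X x y : #|X| < n -> x \notin X -> y \notin X -> conn e (~: X) x y.
Proof.
move=> lt xX yX; have [_ H] := con; have := H X lt x y xX yX.
by apply: connect_sub => u v /and3P[uv uX vX]; apply: conn1; rewrite ?inE.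
Qed.

Lemma k_connected_deg x : n <= deg e setT x.
Proof.
rewrite leqNgt; apply/negP=> lt; have [big _] := con.
set N := [set y in setT | e x y] in lt; have xN : x \notin N by rewrite !inE ie.
have [y] : exists y, y \in ~: (x |: N).
  apply/card_gt0P; have := cardsC (x |: N); rewrite cardsU1 xN; move: lt big.
  by rewrite /deg -/N; clear; lia.
rewrite !inE negb_or => /andP[yx yN]; have yN' : y \notin N by rewrite !inE.
case: (conn_first (k_connected_conn lt xN yN')) => [xy|[z xz [+ _]]].
  by rewrite xy eqxx in yx.
by rewrite !inE xz andbF.
Qed.

Lemma k_connected_degC X x : n <= deg e (~: X) x + #|X|.
Proof.
apply: leq_trans (k_connected_deg x) _; apply: leq_trans (_ : _ <= deg e (~: X) x + deg e X x) _.
  by rewrite -(setUCr X) setUC; apply: deg_setU.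
by rewrite leq_add2l deg_card.
Qed.

End Connected.

Definition disjoint_odd_cycles k e S := exists C : 'I_k -> seq T,
  (forall i, odd_S_cycle e S (C i)) /\ (forall i j, i != j -> [disjoint C i & C j]).

Lemma cycles_of_ears k e S S1 K col (x y : nat -> T) (c : nat -> seq T) :
  0 < k -> symmetric e -> irreflexive e -> k_connected e (50 * k) ->
  S1 \subset S -> #|S1| = k -> K \subset ~: S1 -> 44 * k < #|K| ->
  (forall Z, Z \subset K -> #|Z| <= 4 * k -> lk (bichromatic e col) (K :\: Z) Z) ->
  (forall i, i < 3 * k -> ear e (~: S1 :\: K) K (x i) (c i) (y i) /\ wrong col (x i) (c i) (y i)) ->
  (forall i j, i < 3 * k -> j < 3 * k -> i != j ->
    [disjoint support (x i) (c i) (y i) & support (x j) (c j) (y j)]) ->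
  disjoint_odd_cycles k e S.
Proof.
move=> k0 se ie con SS cS KV bigK hub ears dis; set V := ~: S1 in KV ears.
have ears1 i : i < 3 * k -> ear e (V :\: K) K (x i) (c i) (y i) by move=> /ears[].
pose s (i : 'I_k) : T := enum_val (cast_ord (esym cS) i).
have sS i : s i \in S1 by apply: enum_valP.
have sinj : injective s by move=> i j /enum_val_inj/cast_ord_inj.
have sV i : s i \notin V by rewrite inE negbK.
(* One system of representatives gives each [s i] two private neighbours in [V], from which the two
   halves of its ear will start. *)
have [|f [fN finj']] := @sdr _ (s (Ordinal k0)) [set: 'I_k * bool] (fun ib => [set u in V | e (s ib.1) u]).
  move=> [i b] _; rewrite cardsT card_prod card_ord card_bool.
  by have := k_connected_degC ie con S1 (s i); rewrite cS -/V /deg /=; clear; lia.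
have finj : injective f by move=> i j; apply: finj'; rewrite inE.
have fV ib : f ib \in V by have := fN ib; rewrite !inE => /(_ isT)/andP[].
have sf ib : e (s ib.1) (f ib) by have := fN ib; rewrite !inE => /(_ isT)/andP[].
pose Src := [set f ib | ib : 'I_k * bool].
have fS ib : f ib \in Src by apply: imset_f.
have cSrc : #|Src| = 2 * k by rewrite card_imset // card_prod card_ord card_bool mulnC.
have SrcV : Src \subset V by apply/subsetP=> _ /imsetP[ib _ ->].
(* A separator of fewer than [2 k] vertices, together with [S1], has fewer than [3 k] vertices and
   cannot disconnect the graph. *)
have [q0 fam0] : exists q, path_family e V K Src q.
  apply: menger_family => // A B SB sA KB; rewrite cSrc leqNgt; apply/negP=> lt.
  have cA := subset_leq_card sA; have cB := subset_leq_card KB; rewrite cSrc in cA.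
  have [u uAB] : exists u, u \in A :\: B.
    by apply/card_gt0P; have := cardsID B A; move: lt cA; clear; lia.
  have [v vBA] : exists v, v \in B :\: A.
    by apply/card_gt0P; have := cardsID A B; rewrite setIC; move: lt cB bigK; clear; lia.
  have [AV BV _] := sepnW SB; have /setDP[uA uB] := uAB; have /setDP[vB vA] := vBA.
  have eqV : V :\: (A :&: B) = ~: (S1 :|: (A :&: B)) by rewrite setCU setDE.
  have : conn e (V :\: (A :&: B)) u v.
    rewrite eqV; apply: (k_connected_conn con).
    - by have := cardsUI S1 (A :&: B); rewrite cS; move: lt k0; clear; lia.
    - by rewrite -in_setC -eqV !inE (negbTE uB) andbF -in_setC (subsetP AV).
    - by rewrite -in_setC -eqV !inE (negbTE vA) -in_setC (subsetP BV).
  by move/(sep_conn se SB uAB); rewrite inE vB.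
have [|q [g [[qP qdis] ginj gN unhit]]] := @unhit_ears _ e V K Src se KV _ x y c ears1 dis k (ex_intro _ q0 fam0).
  by rewrite cSrc; clear; lia.
pose b ib := belast (f ib) (q (f ib)); pose d ib := last (f ib) (q (f ib)).
have bd ib : f ib :: q (f ib) = rcons (b ib) (d ib) by apply: lastI.
pose D i := support (d (i, false)) (rev (b (i, false)) ++ s i :: b (i, true)) (d (i, true)).
have DE i : D i = rev (f (i, false) :: q (f (i, false))) ++ s i :: f (i, true) :: q (f (i, true)).
  by rewrite /D /support !bd rev_rcons rcons_cat.
have qV ib u : u \in f ib :: q (f ib) -> u \in V by have [_ _ sub _ _] := qP _ (fS ib); apply: sub.
have DP i u : u \in D i -> u = s i \/ exists b, u \in f (i, b) :: q (f (i, b)).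
  rewrite DE mem_cat mem_rev in_cons => /or3P[uf|/eqP->|ut]; [|by left|].
    by right; exists false.
  by right; exists true.
have suppV i u : u \in support (x (g i)) (c (g i)) (y (g i)) -> u \in V.
  exact: (supp_V KV ears1 (gN i)).
have bK ib u : u \in b ib -> u \notin K by have [_ _ _ _ H] := qP _ (fS ib); apply: H.
apply: (@assemble _ k e S K col (fun i => x (g i)) (fun i => y (g i)) (fun i => d (i, false))
  (fun i => d (i, true)) (fun i => c (g i)) (fun i => rev (b (i, false)) ++ s i :: b (i, true))) => //.
- move=> i; have [[xK yK xy pth [uc sub]] wr] := ears _ (gN i); split=> //; split=> //.
  by split=> // u /sub /setDP[_ uK]; rewrite inE.
- move=> i; have dK ib : d ib \in K by have [] := qP _ (fS ib).
  split=> // u; rewrite mem_cat mem_rev in_cons inE => /or3P[/bK//|/eqP->|/bK//].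
  by apply: contra (sV i); apply: (subsetP KV).
- move=> i; right; split; last first.
    apply/hasP; exists (s i); last exact: (subsetP SS).
    by rewrite -/(D i) DE mem_cat in_cons eqxx orbT.
  have [pth1 _ _ _ _] := qP _ (fS (i, false)); have [pth2 _ _ _ _] := qP _ (fS (i, true)).
  rewrite rcons_cat rcons_cons -bd cat_path /= pth2 (sf (i, true)) andbT.
  have -> : path e (d (i, false)) (rev (b (i, false))).
    by rewrite rev_path (eq_path (e' := e)) // => u v; apply: se.
  have -> : last (d (i, false)) (rev (b (i, false))) = f (i, false).
    rewrite /d /b; case: (q _) => //= u l; by rewrite rev_cons last_rcons.
  by rewrite se (sf (i, false)).
- move=> i; rewrite -/(D i) cat_uniq; apply/and3P; split.
  + apply: ear_uniq (ears1 _ (gN i)) _.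
    by rewrite disjoint_subset; apply/subsetP=> u /setDP[_ uK]; rewrite inE.
  + apply/hasPn=> u /DP[->|[a ua]]; first by apply: contra (sV i); apply: suppV.
    exact: unhit (fS _) ua.
  + have [_ u1 _ _ _] := qP _ (fS (i, false)); have [_ u2 _ _ _] := qP _ (fS (i, true)).
    have nsf a : s i \notin f (i, a) :: q (f (i, a)) by apply: contra (sV i); apply: qV.
    rewrite DE cat_uniq rev_uniq u1 cons_uniq nsf u2 !andbT andTb.
    apply/hasPn=> u; rewrite in_cons mem_rev => /predU1P[->|ut]; first exact: nsf.
    by apply/negP=> uf; have /finj := qdis _ _ u (fS _) (fS _) ut uf.
- move=> i j ij; rewrite disjoint_subset; apply/subsetP=> u ui; rewrite inE; apply/negP.
  rewrite -/(D j) mem_cat; move: ui; rewrite -/(D i) mem_cat.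
  move=> /orP[ui|/DP[->|[a ua]]] /orP[uj|/DP[uj|[a' ua']]].
  + have : g i != g j by apply: contra ij => /eqP/ginj->.
    by move/(dis _ _ (gN i) (gN j)); rewrite disjoint_subset => /subsetP/(_ _ ui); rewrite inE uj.
  + by have := suppV _ _ ui; rewrite uj (negbTE (sV j)).
  + by have := unhit i _ _ (fS _) ua'; rewrite ui.
  + by have := suppV _ _ uj; rewrite (negbTE (sV i)).
  + by have /eqP := sinj _ _ uj; rewrite (negbTE ij).
  + by have := qV _ _ ua'; rewrite (negbTE (sV i)).
  + by have := unhit j _ _ (fS _) ua; rewrite uj.
  + by have := qV _ _ ua; rewrite uj (negbTE (sV j)).
  + have /finj := qdis _ _ u (fS _) (fS _) ua ua'; by case=> eqij; rewrite eqij eqxx in ij.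
Qed.

End ManyEars.

(** * The case of a graph that is bipartite up to few vertices *)

Section Colouring.
Variables (T : finType) (e : rel T) (S X0 : {set T}) (k : nat) (col0 : T -> bool).
Implicit Types (A B X Z : {set T}) (u v w x y z : T).
Hypotheses (k0 : 0 < k) (se : symmetric e) (ie : irreflexive e).
Hypothesis con : k_connected e (50 * k).
Hypothesis bigS : 2 * k <= #|S| + 1.
Hypothesis smallX : #|X0| < 7 * k.
Hypothesis proper : forall x y, x \notin X0 -> y \notin X0 -> e x y -> col0 x != col0 y.

Let R := ~: X0.
Let nb b x := [set y in R | e x y && (col0 y == b)].
(** The threshold [7 k] is [3 k + 4 k]: the neighbours picked in [many_resources] must avoid at most
    [3 k] forbidden vertices, and [4 k] distinct ones are picked. *)
Let Z := [set x in X0 | (7 * k <= #|nb true x|) && (7 * k <= #|nb false x|)].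
(** A vertex of [X0] outside [Z] has fewer than [7 k] neighbours in one colour class and receives
    that colour, so nearly all its edges to [R] become bichromatic. *)
Let col x := if x \in X0 then #|nb true x| < 7 * k else col0 x.
Local Notation bi := (bichromatic e col).

Let sb : symmetric bi. Proof. exact: bichromatic_sym. Qed.
Let ib : irreflexive bi. Proof. exact: bichromatic_irr. Qed.

Let RZ x : x \in R -> x \notin Z.
Proof. by rewrite !inE => /negbTE->. Qed.

Let colR x : x \in R -> col x = col0 x.
Proof. by rewrite inE /col => /negbTE->. Qed.

(** Of at least [50 k] neighbours, fewer than [7 k] lie in [X0] and fewer than [7 k] in the class of
    the same colour. *)
Let degR x : x \notin Z -> 36 * k < deg bi R x.
Proof.
move=> xZ; have := k_connected_degC ie con X0 x; rewrite -/R => le.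
have split : deg e R x <= deg bi R x + #|nb (col x) x|.
  apply: leq_trans (leq_card_setU _ _); apply: subset_leq_card; apply/subsetP=> y.
  rewrite in_setU !in_set => /andP[yR xy]; have yR' : y \in R by rewrite inE.
  rewrite yR /bichromatic /= xy (colR yR') /= eq_sym; by case: (_ == _).
have : #|nb (col x) x| < 7 * k.
  case: (boolP (x \in X0)) => xX.
    rewrite /col xX; case: (ltnP #|nb true x| (7 * k)) => // ge.
    by rewrite ltnNge; apply: contra xZ => ge'; rewrite !inE xX -/(nb true x) -/(nb false x) ge ge'.
  have -> : nb (col x) x = set0; last by rewrite cards0 muln_gt0 k0.
  apply/setP=> y; rewrite !inE /col (negbTE xX); apply/negP=> /and3P[yX xy cxy].
  by have := proper xX yX xy; rewrite eq_sym cxy.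
by move: le split smallX; clear; lia.
Qed.

(** Edges inside [R] are all bichromatic, so connectivity passes to the bichromatic graph. After
    deleting [X0], [Q] and a separator, fewer than [12 k] vertices, the rest is connected, and every
    vertex of [K] has a bichromatic neighbour in it. *)
Let hub (Q : {set T}) : #|Q| <= k -> forall Y : {set T}, Y \subset ~: (Z :|: Q) -> #|Y| <= 4 * k ->
  lk bi (~: (Z :|: Q) :\: Y) Y.
Proof.
move=> cQ; set K := ~: _.
have RK x : x \in R -> x \notin Q -> x \in K by move=> xR xQ; rewrite inE in_setU negb_or RZ.
have KZ x : x \in K -> x \notin Z by rewrite inE in_setU negb_or => /andP[].
have degK A x : x \in K -> R \subset A :|: Q -> 35 * k < deg bi A x.
  move=> xK sub; have := degR (KZ x xK); have := deg_sub bi x sub; have := deg_setU bi A Q x.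
  by have := deg_card bi Q x; move: cQ; clear; lia.
have RKQ : R \subset K :|: Q.
  by apply/subsetP=> x xR; rewrite in_setU; case: (boolP (x \in Q)) => xQ; rewrite ?orbT // RK.
have bigK : 42 * k < #|K|.
  have [big _] := con; have ZX : Z \subset X0 by apply/subsetP=> x; rewrite inE => /andP[].
  have := subset_leq_card ZX; have := cardsUI Z Q; have := cardsC (Z :|: Q); rewrite -/K.
  by move: big smallX cQ; clear; lia.
apply: lk_of_hub => //.
- by move: bigK; clear; lia.
- move=> X XK cX; apply: leq_trans (deg_rho _ (subsetDl _ _)).
  have := cardsID X K; rewrite (setIidPr XK) cX => cKX.
  apply: leq_trans (_ : #|K :\: X| * (35 * k) <= _).
    by move: cKX bigK k0; move: #|K| #|_ :\: _| => a b; clear; nia.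
  rewrite -sum_nat_const; apply: leq_sum => v /setDP[vK _].
  exact: ltnW (degK _ _ vK RKQ).
move=> A B SP lt /set0Pn[x xAB]; apply/subsetP=> y yB; apply: contraT => yA.
have [AK BK KAB] := sepnW SP; have /setDP[xA xB] := xAB.
have yBA : y \in B :\: A by rewrite inE yA.
have xK := subsetP AK x xA; have yK := subsetP BK y yB.
have SP' : sepn bi K B A.
  by have [eqK no] := SP; split=> [|u v uB vA]; rewrite ?(setUC B) // sb; apply: no.
pose Rm := ~: (X0 :|: Q :|: (A :&: B)).
have RmR u : u \in Rm -> u \in R by rewrite !inE !negb_or => /andP[/andP[->]].
have RmK u : u \in Rm -> u \in K :\: (A :&: B).
  by move=> uR; have := uR; rewrite /Rm !in_setC !in_setU !negb_or in_setD => /andP[/andP[uX uQ] ->];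
    rewrite RK // RmR.
have nbr u : u \in K -> exists2 u', u' \in Rm & bi u u'.
  move=> uK; apply: deg_gt0.
  have : 35 * k < deg bi (Rm :|: (A :&: B)) u.
    apply: degK => //; apply/subsetP=> v; rewrite !inE !negb_or => ->.
    by case: (v \in A); case: (v \in B); case: (v \in Q).
  have := deg_setU bi Rm (A :&: B) u; have := deg_card bi (A :&: B) u.
  by move: lt k0; clear; lia.
have [x' x'R xx'] := nbr x xK; have [y' y'R yy'] := nbr y yK.
have x'AB : x' \in A :\: B.
  have /setDP[x'K x'I] := RmK _ x'R; have x'A := sepn_edge sb SP' xAB x'K xx'.
  by move: x'I; rewrite in_setI x'A in_setD x'A andbT.
have y'B : y' \in B.
  by have /setDP[y'K _] := RmK _ y'R; exact: (sepn_edge sb SP yBA y'K yy').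
have cR : conn e Rm x' y'.
  apply: (k_connected_conn con); rewrite ?in_setC -?in_setC //.
  have := cardsUI X0 Q; have := cardsUI (X0 :|: Q) (A :&: B).
  by move: lt cQ smallX k0; clear; lia.
have : conn bi (K :\: (A :&: B)) x' y'.
  apply: conn_sub cR => u v uv uR vR; apply: conn1; [|exact: RmK|exact: RmK].
  rewrite /bichromatic /= uv !colR ?RmR // proper // -?in_setC; exact: RmR.
by move/(sep_conn sb SP x'AB); rewrite inE y'B.
Qed.

Let mono : rel T := [rel x y | e x y && (col x == col y)].

Let smono : symmetric mono. Proof. by move=> x y; rewrite /mono /= se eq_sym. Qed.
Let imono : irreflexive mono. Proof. by move=> x; rewrite /mono /= ie. Qed.

Section Resources.
Variable f : T -> T.
Hypothesis mf : matching mono (~: Z) f.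

Let fZ x : x \in Z -> f x = x.
Proof.
by move=> xZ; apply/eqP; apply: contraT => fx; have [_ H _] := mf; have := H x fx; rewrite inE xZ.
Qed.

(* One end of every matching edge. *)
Let Tr := [set x | enum_rank x < enum_rank (f x)].

Let moved_Tr : [set x | f x != x] \subset Tr :|: f @: Tr.
Proof.
have [jf _ _] := mf; apply/subsetP=> x; rewrite !inE => fx.
case: (ltngtP (enum_rank x) (enum_rank (f x))) => [//|lt|/val_inj/enum_rank_inj eqx] /=.
  by apply/imsetP; exists (f x); rewrite ?inE jf.
by rewrite -eqx eqxx in fx.
Qed.

Lemma few_resources : maxmatching mono (~: Z) f -> #|Z :|: Tr| < k ->
  exists X, #|X| <= 2 * k - 2 /\ forall c, odd_S_cycle e S c -> ~~ has (mem X) c -> False.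
Proof.
(* At most [k - 1] elements, each accounting for one vertex of [Z] or the two ends of a matching
   edge, give at most [2 k - 2] vertices. *)
move=> maxf lt; pose X := Z :|: [set x | f x != x]; exists X; split.
  have ZTr : [disjoint Z & Tr].
    by rewrite disjoint_subset; apply/subsetP=> x /fZ fx; rewrite !inE fx ltnn.
  have cU : #|Z :|: Tr| = #|Z| + #|Tr| by apply/eqP; rewrite (leq_card_setU Z Tr).
  have := cardsUI Z [set x | f x != x]; have := subset_leq_card moved_Tr.
  have := cardsUI Tr (f @: Tr); have : #|f @: Tr| <= #|Tr| by apply: leq_imset_card.
  by rewrite -/X; move: lt cU; clear; lia.
move=> c [[c3 _ cyc] oc _] /hasPn nX.
case: c c3 cyc oc nX => // x p _ cyc oc nX.
have out u : u \in x :: p -> u \notin Z /\ f u = u.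
  move=> up; have : u \notin X := nX u up.
  by rewrite /X in_setU negb_or => /andP[-> +]; rewrite inE negbK => /eqP.
have pb : path bi x (rcons p x).
  apply: (sub_in_path (P := mem (x :: p))) cyc => [u v up vp uv|]; last first.
    apply/allP=> u; rewrite in_cons mem_rcons => /predU1P[->|//]; exact: mem_head.
  have [uZ fu] := out u up; have [vZ fv] := out v vp.
  have := max_nonadjacent smono imono maxf; move=> /(_ u v); rewrite !in_setC => /(_ uZ vZ fu fv).
  by rewrite /mono /bichromatic /= uv.
have := bichromatic_parity pb; rewrite last_rcons size_rcons addbb.
by move: oc => /= /negbTE ->.
Qed.

Let Tr_ne x : x \in Tr -> f x != x.
Proof. by move=> xT; apply/eqP=> fx; move: xT; rewrite inE fx ltnn. Qed.

Let fTr x : x \in Tr -> f x \notin Tr.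
Proof. by have [jf _ _] := mf; rewrite !inE jf -leqNgt => /ltnW. Qed.

Lemma many_resources : k <= #|Z :|: Tr| -> disjoint_odd_cycles k e S.
Proof.
move=> le; have [jf fA fe] := mf.
pose r (i : 'I_k) : T := enum_val (widen_ord le i).
have rZT i : r i \in Z \/ r i \in Tr by apply/setUP; apply: enum_valP.
have rinj : injective r.
  by move=> i j /enum_val_inj/(congr1 val) /= eqij; apply: val_inj.
have cross i j : r i = f (r j) -> i = j.
  move=> eqr; case: (rZT j) => [/fZ eqf|jT]; first by apply: rinj; rewrite eqr.
  case: (rZT i) => [iZ|iT]; last by have := fTr jT; rewrite -eqr iT.
  by have := fZ iZ; rewrite eqr jf => eqj; have := Tr_ne jT; rewrite -eqj eqxx.
(* A vertex of [Z] is fixed by [f], so this covers both kinds of resources: single vertices and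
   matching edges. *)
pose core i u := (u == r i) || (u == f (r i)).
have core_inj i j u : core i u -> core j u -> i = j.
  move=> /orP[] /eqP-> /orP[] /eqP.
  - exact: rinj.
  - exact: cross.
  - by move/esym/cross.
  - by move/(inv_inj jf)/rinj.
pose B := [set u | [exists i, core i u]].
have coreB i u : core i u -> u \in B by move=> cu; rewrite inE; apply/existsP; exists i.
pose I := [set i | (r i \notin S) && (f (r i) \notin S)].
have cover (P : {set 'I_k}) (A : {set T}) : (forall u, u \in A -> exists2 i, i \in P & core i u) ->
    #|A| <= 2 * #|P|.
  move=> H; have -> : 2 * #|P| = #|P| + #|P| by clear; lia.
  apply: leq_trans (leq_add (leq_imset_card r P) (leq_imset_card (f \o r) P)).
  apply: leq_trans (leq_card_setU _ _); apply: subset_leq_card; apply/subsetP=> u /H[i iP].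
  rewrite in_setU => /orP[] /eqP->; first by rewrite imset_f.
  by rewrite (imset_f (f \o r)) ?orbT.
have cB : #|B| <= 2 * k.
  rewrite -[X in _ <= 2 * X]card_ord -cardsT; apply: cover => u.
  by rewrite inE => /existsP[i ci]; exists i.
have cSB : #|S :&: B| <= 2 * #|~: I|.
  apply: cover => u; rewrite !inE => /andP[uS /existsP[i ci]]; exists i => //.
  by rewrite !inE negb_and !negbK; case/orP: ci => /eqP <-; rewrite uS ?orbT.
(* The resources that meet [S] contain at most [2 (k - #|I|)] of its vertices. As [#|S| >= 2 k - 1],
   at least [2 #|I| - 1] vertices of [S] lie outside all resources, enough for [I] when it is
   nonempty. *)
have [|s [sN sinj]] := @sdr _ _ (r (Ordinal k0)) I (fun=> S :\: B).
  move=> i iI; have : 0 < #|I| by apply/card_gt0P; exists i.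
  by have := cardsID B S; have := cardsC I; rewrite card_ord; move: cSB bigS; clear; lia.
have sS i : i \in I -> s i \in S by case/sN/setDP.
have sB i : i \in I -> s i \notin B by case/sN/setDP.
pose Q := s @: I.
have cQ : #|Q| <= k.
  by apply: leq_trans (leq_imset_card _ _) _; rewrite -[leqRHS]card_ord; apply: max_card.
have cBQ : #|B :|: Q| <= 3 * k by have := cardsUI B Q; move: cB cQ; clear; lia.
(* For each resource four hub vertices are picked: two as ends of the ear through [s i], two as
   neighbours of either colour of a vertex of [Z]. Where no such neighbour is called for, any vertex
   of [R] serves as a placeholder. *)
pose N (j : 'I_k * (bool * bool)) : {set T} :=
  if j.2.1 then (if j.1 \in I then [set y in R | e (s j.1) y] else R)
  else (if r j.1 \in Z then nb j.2.2 (r j.1) else R).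
have NR j : N j \subset R.
  by apply/subsetP=> y; rewrite /N; case: ifP => _; case: ifP => _ //; rewrite in_set => /andP[].
have cN j : 7 * k <= #|N j|.
  have cR : 43 * k < #|R|.
    by have [big _] := con; have := cardsC X0; rewrite -/R; move: big smallX; clear; lia.
  rewrite /N; case: ifP => _; case: ifP => jP; try by move: cR; clear; lia.
    by have := k_connected_degC ie con X0 (s j.1); rewrite -/R /deg; move: smallX; clear; lia.
  by move: jP; rewrite in_set => /andP[_ /andP[]]; case: (j.2.2).
have [|g [gN ginj']] := @sdr _ _ (r (Ordinal k0)) [set: 'I_k * (bool * bool)] (fun j => N j :\: (B :|: Q)).
  move=> j _; rewrite cardsT !card_prod card_ord card_bool.
  have := cardsID (B :|: Q) (N j); have := cN j.
  have := subset_leq_card (subsetIr (N j) (B :|: Q)); move: cBQ.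
  by clear; lia.
have ginj : injective g by move=> i j; apply: ginj'; rewrite inE.
have {gN} gP j : g j \in N j /\ g j \notin B :|: Q by have /setDP := gN j (in_setT j).
have gR j : g j \in R by have [gj _] := gP j; apply: (subsetP (NR j)).
have gB j : g j \notin B by have [_] := gP j; rewrite in_setU negb_or => /andP[].
have gQ j : g j \notin Q by have [_] := gP j; rewrite in_setU negb_or => /andP[].
pose K := ~: (Z :|: Q).
have KE u : (u \in K) = (u \notin Z) && (u \notin Q) by rewrite in_setC in_setU negb_or.
have gK j : g j \in K by rewrite KE RZ ?gQ.
have coreQ i u : core i u -> u \notin Q.
  by move=> cu; apply/negP=> /imsetP[j jI eqj]; have := sB j jI; rewrite -eqj (coreB i u cu).
pose p i := if r i \in Z then g (i, (false, true)) else r i.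
pose p' i := if r i \in Z then g (i, (false, false)) else f (r i).
pose cp i := if r i \in Z then [:: r i] else [::].
pose d i := g (i, (true, true)); pose d' i := g (i, (true, false)).
pose cd i := if i \in I then [:: s i] else [::].
have suppE i u : u \in support (p i) (cp i) (p' i) ++ support (d i) (cd i) (d' i) ->
    [\/ exists a, u = g (i, a), core i u | i \in I /\ u = s i].
  rewrite mem_cat => /orP[].
    rewrite /p /cp /p'; case: ifP => _; rewrite !inE.
      by case/or3P=> /eqP->; [constructor 1; exists (false, true)|constructor 2; rewrite /core eqxx
        |constructor 1; exists (false, false)].
    by case/orP=> /eqP->; constructor 2; rewrite /core eqxx ?orbT.
  rewrite /cd; case: ifP => iI; rewrite !inE.
    by case/or3P=> /eqP->; [constructor 1; exists (true, true)|constructor 3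
      |constructor 1; exists (true, false)].
  by case/orP=> /eqP->; constructor 1; [exists (true, true)|exists (true, false)].
apply: (@assemble _ k e S K col p p' d d' cp cd) => //.
- exact: hub cQ.
- move=> i; rewrite /wrong /p /p' /cp; case: ifP => iZ.
    have [gt _] := gP (i, (false, true)); have [gf _] := gP (i, (false, false)).
    rewrite /N /= iZ !in_set in gt gf.
    case/and3P: gt => gtX et /eqP ct; case/and3P: gf => gfX ef /eqP cf.
    rewrite !colR // ct cf; split=> //; split; rewrite ?gK //=.
    + by apply/eqP=> /ginj.
    + by rewrite se et ef.
    + by split=> // u; rewrite mem_seq1 => /eqP->; rewrite in_setC KE iZ.
  have iT : r i \in Tr by case: (rZT i) => //; rewrite iZ.
  have ne := Tr_ne iT; have /andP[ef /eqP cf] := fe _ ne.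
  rewrite -cf addbb; split=> //; split=> //=.
  + by rewrite KE iZ (coreQ i) // /core eqxx.
  + rewrite KE (coreQ i) ?andbT; last by rewrite /core eqxx orbT.
    by rewrite -in_setC; apply: fA; rewrite jf eq_sym.
  + by rewrite eq_sym.
  + by rewrite ef.
- move=> i; rewrite !gK; split=> // u; rewrite /cd; case: ifP => // iI.
  by rewrite mem_seq1 => /eqP->; rewrite in_setC KE imset_f ?andbF.
- move=> i; case: (boolP (i \in I)) => iI; [right|left].
    have [gt _] := gP (i, (true, true)); have [gf _] := gP (i, (true, false)).
    rewrite /N /= iI !in_set in gt gf; case/andP: gt => _ et; case/andP: gf => _ ef.
    by rewrite /cd iI /= se et ef sS // orbT.
  move: iI; rewrite inE negb_and !negbK /p /cp /p' => iS.
  case: ifP => iZ; rewrite /= orbF.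
    by rewrite (fZ iZ) orbb in iS; rewrite iS orbT.
  exact: iS.
- move=> i.
  have nc u a : core i u -> (g (i, a) == u) = false.
    by move=> cu; apply/negP=> /eqP eqg; have := gB (i, a); rewrite eqg (coreB i u cu).
  have nc' u a : core i u -> (u == g (i, a)) = false by rewrite eq_sym; apply: nc.
  have c1 : core i (r i) by rewrite /core eqxx.
  have c2 : core i (f (r i)) by rewrite /core eqxx orbT.
  have gg a b : (g (i, a) == g (i, b)) = (a == b) by rewrite (inj_eq ginj) xpair_eqE eqxx.
  have simp := (gg, fun a => nc _ a c1, fun a => nc _ a c2, fun a => nc' _ a c1, fun a => nc' _ a c2).
  have fr : r i \notin Z -> (r i == f (r i)) = false.
    by move=> iZ; case: (rZT i) => [|iT]; [rewrite (negbTE iZ)|rewrite eq_sym (negbTE (Tr_ne iT))].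
  rewrite /support /p /p' /cp /cd /d /d'; case: (boolP (i \in I)) => iI.
    have ns a : (g (i, a) == s i) = false.
      by apply/negP=> /eqP eqg; have := gQ (i, a); rewrite eqg imset_f.
    have ns' a : (s i == g (i, a)) = false by rewrite eq_sym ns.
    have cs u : core i u -> (u == s i) = false.
      by move=> cu; apply/negP=> /eqP eqg; have := sB i iI; rewrite -eqg (coreB i u cu).
    by case: (boolP (r i \in Z)) => iZ;
      rewrite /= !in_cons !in_nil !(simp, ns, ns', cs _ c1, cs _ c2) ?fr.
  by case: (boolP (r i \in Z)) => iZ; rewrite /= !in_cons !in_nil !simp ?fr.
- move=> i j ij; rewrite disjoint_subset; apply/subsetP=> u ui; rewrite inE; apply/negP=> uj.
  have nij : i <> j by apply/eqP.
  case: (suppE i u ui) => [[a eqa]|ci|[iI eqi]]; case: (suppE j u uj) => [[b eqb]|cj|[jI eqj]].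
  + by rewrite eqa in eqb; have [] := ginj _ _ eqb.
  + by have := gB (i, a); rewrite -eqa (coreB j u cj).
  + by have := gQ (i, a); rewrite -eqa eqj imset_f.
  + by have := gB (j, b); rewrite -eqb (coreB i u ci).
  + by apply: nij; apply: core_inj ci cj.
  + by have := sB j jI; rewrite -eqj (coreB i u ci).
  + by have := gQ (j, b); rewrite -eqb eqi imset_f.
  + by have := sB i iI; rewrite -eqi (coreB j u cj).
  + by apply: nij; apply: sinj; rewrite // -eqi.
Qed.

End Resources.

Theorem cycles_of_colouring : disjoint_odd_cycles k e S \/
  exists X, #|X| <= 2 * k - 2 /\ forall c, odd_S_cycle e S c -> ~~ has (mem X) c -> False.
Proof.
have [f maxf] := maxmatching_exists mono (~: Z); have [mf _] := maxf.
case: (leqP k #|Z :|: [set x | enum_rank x < enum_rank (f x)]|) => [le|lt].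
  by left; apply: many_resources mf le.
by right; apply: few_resources mf maxf lt.
Qed.

End Colouring.
Theorem theorem11 (T : finType) (e : rel T) (S : {set T}) (k : nat) :
  simple_graph e -> 0 < k -> k_connected e (50 * k) ->
  (exists C : 'I_k -> seq T,
      (forall i, odd_S_cycle e S (C i)) /\
      (forall i j, i != j -> [disjoint C i & C j]))
  \/
  (exists X : {set T}, #|X| <= 2 * k - 2 /\
      (forall c : seq T, odd_S_cycle e S c -> ~~ has (mem X) c -> False)).
Proof.
move=> [se ie] k0 con; case: (leqP #|S| (2 * k - 2)) => [small|bigS].
  by right; exists S; split=> // c [_ _ ->].
have bigS' : 2 * k <= #|S| + 1 by move: bigS; clear; lia.
have [|||S1 [_ SS cS]] := @superset_of_card _ set0 S k; rewrite ?sub0set ?cards0 //.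
  by move: bigS' k0; clear; lia.
pose V := ~: S1.
have degV v : v \in V -> 49 * k <= deg e V v.
  by move=> _; have := k_connected_degC ie con S1 v; rewrite cS -/V; clear; lia.
have V0 : V != set0.
  have [big _] := con; rewrite -card_gt0; have := cardsC S1; rewrite cS -/V; move: big.
  by clear; lia.
have [K [col [KV bigK hub]]] := hub_exists k0 se ie V0 degV.
have [||X XV cX|[x [y [c [ears dis]]]]|[X [col' [XV cX proper]]]] :=
    @odd_ears_or_colouring _ e V K col se ie KV (3 * k).
- by rewrite muln_gt0.
- by move: bigK; clear; lia.
- have -> : V :\: X = ~: (S1 :|: X) by rewrite setCU setDE.
  move=> x y xV yV; apply: (k_connected_conn con); rewrite -?in_setC //.
  by have := cardsUI S1 X; rewrite cS; move: cX k0; clear; lia.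
- by left; apply: (cycles_of_ears k0 se ie con SS cS KV bigK hub ears dis).
have cSX : #|S1 :|: X| < 7 * k by have := cardsUI S1 X; rewrite cS; move: cX; clear; lia.
apply: (cycles_of_colouring k0 se ie con bigS' cSX (col0 := col')) => x y xX yX.
have inV u : u \notin S1 :|: X -> u \in V :\: X.
  by rewrite in_setU negb_or in_setD => /andP[uS ->]; rewrite in_setC.
by apply: proper; apply: inV.
Qed.
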